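(* Let $(u^1,\dots,u^n)$ be a weak $F$-monotone solution in the whole of $\mathbb{R}^N$ of the system $-\mathrm{div}(a_i(x,|\nabla u^i|(X))\nabla u^i(X))=F_i(x,u^1(X),\dots,u^n(X))$, $i=1,\dots,n$, satisfying the regularity assumption (R) of the context. Assume that, for any $i=1,\dots,n$, $\mathcal{A}^i(x,\nabla u^i(X))$ satisfies condition (B) of the context and is positive definite at almost any $X\in\mathbb{R}^N$, and that there exist $C_1,\dots,C_n\ge1$ such that the largest eigenvalue $\overline{\mathcal{A}}^i(X)$ of $\mathcal{A}^i(x,\nabla u^i(X))$ satisfies $$\int_{B_R}\overline{\mathcal{A}}^i(X)|\nabla u^i(X)|^2\,dX\le C_iR^2\qquad\text{for any }R\ge\max\{C_1,\dots,C_n\}.$$ Then there exist $\bar u^i:\mathbb{R}^m\times\mathbb{R}\to\mathbb{R}$ and $\omega_i\in\mathbb{S}^{N-m-1}$, $i=1,\dots,n$, such that $$u^i(X)=u^i(x,y)=\bar u^i(x,\langle\omega_i,y\rangle)\qquad\text{for any }(x,y)\in\mathbb{R}^m\times\mathbb{R}^{N-m}.$$ If, in addition, there exists $U\subseteq\mathbb{R}^m\times\mathbb{R}^n$ open such that, for every $j,k=1,\dots,n$, $F_{jk}>0$ (or $F_{jk}<0$) in $U$, then $\omega_j=\omega_k=\omega$.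
   Context: Setting. $1\le m<N$, $X=(x,y)\in\mathbb{R}^m\times\mathbb{R}^{N-m}$, $y=(y_1,\dots,y_{N-m})$; $\nabla$ is the full gradient in $\mathbb{R}^N$; $B_R$ is the ball of radius $R$ centered at the origin of $\mathbb{R}^N$; $\mathbb{S}^{N-m-1}$ is the unit sphere of $\mathbb{R}^{N-m}$. Here $\Omega=\mathbb{R}^N$. Coefficients: for $i=1,\dots,n$, $a_i\in L^\infty(\mathbb{R}^m\times[\alpha_-,\alpha_+])$ for any $\alpha_+>\alpha_->0$; $\inf_{x\in\mathbb{R}^m}a_i(x,t)>0$ for any fixed $t\in(0,+\infty)$; and for any fixed $x\in\mathbb{R}^m$ the map $t\mapsto a_i(x,t)$ is $C^1$ on $(0,+\infty)$. Nonlinearity: $F=F(x,\xi^1,\dots,\xi^n)$ is such that, for any $i=1,\dots,n$ and any fixed $(x,\xi^1,\dots,\xi^{i-1},\xi^{i+1},\dots,\xi^n)\in\mathbb{R}^m\times\mathbb{R}^{n-1}$, the map $\xi^i\mapsto F(x,\xi^1,\dots,\xi^i,\dots,\xi^n)$ belongs to $C^2(\mathbb{R})$. $F_i$ denotes the derivative of $F$ with respect to $\xi^i$, and $F_{ij}$ the second derivative of $F$ with respect to $\xi^i$ and $\xi^j$. Weak solution: for any $\psi\in C_c^\infty(\Omega,\mathbb{R}^n)$ and every $i$, $\int_\Omega\langle a_i(x,|\nabla u^i|(X))\nabla u^i(X),\nabla\psi^i(X)\rangle dX=\int_\Omega F_i(x,u^1,\dots,u^n)\psi^i(X)\,dX$.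 $F$-monotone solution: (i) for every $i\in\{1,\dots,n\}$, $\partial_{y_{N-m}}u^i\ne0$ in $\Omega$; (ii) for $i<j$, $F_{ij}\,\partial_{y_{N-m}}u^i\,\partial_{y_{N-m}}u^j\ge0$, where $F_{ij}$ is evaluated at $(x,u^1(X),\dots,u^n(X))$. (R): $u^i\in C^1(\Omega)\cap C^2(\Omega\cap\{\nabla u^i\ne0\})\cap L^\infty(\Omega)$ and $\nabla u^i\in L^\infty(\Omega,\mathbb{R}^N)\cap W^{1,2}_{loc}(\Omega,\mathbb{R}^N)$, $i=1,\dots,n$. Matrices: for $x\in\mathbb{R}^m$, $\eta\in\mathbb{R}^N\setminus\{0\}$, $\mathcal{A}^k_{ij}(x,\eta)=a_k(x,|\eta|)\delta_{ij}+\frac{\partial a_k}{\partial t}(x,|\eta|)\frac{\eta_i\eta_j}{|\eta|}$, $1\le i,j\le N$. (B): $X\mapsto\mathcal{A}^i(x,\nabla u^i(X))$ belongs to $L^\infty(\{\nabla u^i\ne0\}\cap B_R)$ for any $R>0$ and any $i=1,\dots,n$.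
   Formalization: U is required to meet the set of values {(x,u^1(X),...,u^n(X))} (otherwise the last claim is false), and the mixed derivatives F_ij, i≠j, undefined under separate C^2 regularity, are assumed to exist and be continuous in ξ. *)

(* Defs.v *)
From HB Require Import structures.
From mathcomp Require Import all_boot all_order all_algebra.
From mathcomp Require Import all_classical all_reals all_analysis.

Set Implicit Arguments.
Unset Strict Implicit.
Unset Printing Implicit Defensive.
Import Order.TTheory GRing.Theory Num.Theory.
Import numFieldNormedType.Exports.

Local Open Scope ring_scope.
Local Open Scope classical_set_scope.

(* The product sigma-algebra on R^n, following the library's [n.-tuple T].    *)
Definition measure_rV_display : measure_display -> measure_display.
Proof. exact. Qed.

Section measurable_rV.
Context {R : realType}.
Variable n : nat.

Let coors : 'I_n -> 'rV[R]_n -> measurableTypeR R := fun i v => v ord0 i.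

Let rV_set0 : g_sigma_preimage coors set0.
Proof. exact: sigma_algebra0. Qed.

Let rV_setC A : g_sigma_preimage coors A -> g_sigma_preimage coors (~` A).
Proof. exact: sigma_algebraC. Qed.

Let rV_bigcup (F : _^nat) : (forall i, g_sigma_preimage coors (F i)) ->
  g_sigma_preimage coors (\bigcup_i (F i)).
Proof. exact: sigma_algebra_bigcup. Qed.

HB.instance Definition _ :=
  @isMeasurable.Build (measure_rV_display (R.-ocitv.-measurable).-sigma)
  'rV[R]_n (g_sigma_preimage coors) rV_set0 rV_setC rV_bigcup.

Lemma measurable_coor (i : 'I_n) :
  measurable_fun setT ((fun v => v ord0 i) : 'rV[R]_n -> measurableTypeR R).
Proof.
move=> _ Y mY; rewrite setTI; apply: sub_sigma_algebra => /=.
rewrite -bigcup_seq/=; exists i => /=; first by rewrite mem_index_enum.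
by exists Y => //; rewrite setTI.
Qed.

Lemma measurable_fun_rVP d (T : measurableType d) (f : T -> 'rV[R]_n) :
  (forall i, measurable_fun setT
     ((fun t => f t ord0 i) : T -> measurableTypeR R)) ->
  measurable_fun setT f.
Proof.
move=> mf; have key : @measurable _ 'rV[R]_n `<=`
    [set A | measurable (f @^-1` A)].
  apply: smallest_sub.
    split=> [|A mA|F mF] /=.
    - by rewrite preimage_set0.
    - by rewrite setTD preimage_setC; exact: measurableC.
    - by rewrite preimage_bigcup; exact: bigcupT_measurable.
  rewrite -bigcup_seq /=; apply: bigcup_sub => i _ A [B mB <-] /=.
  by rewrite setTI -[X in measurable X]setTI; exact: (mf i).
by move=> _ A mA; rewrite setTI; exact: key.
Qed.

End measurable_rV.

Section lebesgue_rV.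
Context {R : realType}.

Definition cons_rV n (p : measurableTypeR R * 'rV[R]_n) : 'rV[R]_n.+1 :=
  \row_j (if unlift ord0 j is Some k then p.2 ord0 k else p.1).

Definition uncons_rV n (v : 'rV[R]_n.+1) : measurableTypeR R * 'rV[R]_n :=
  (v ord0 ord0, \row_j v ord0 (lift ord0 j)).

Lemma cons_rV0 n (p : measurableTypeR R * 'rV[R]_n) :
  cons_rV p ord0 ord0 = p.1.
Proof. by rewrite mxE unlift_none. Qed.

Lemma cons_rVS n (p : measurableTypeR R * 'rV[R]_n) (j : 'I_n) :
  cons_rV p ord0 (lift ord0 j) = p.2 ord0 j.
Proof. by rewrite mxE liftK. Qed.

Lemma measurable_cons_rV n : measurable_fun setT (@cons_rV n).
Proof.
apply: measurable_fun_rVP => i; case: (unliftP ord0 i) => [j|] ->.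
- rewrite (_ : (fun t => _) = (fun v : 'rV[R]_n => v ord0 j) \o snd); last first.
    by apply/funext => t; rewrite cons_rVS.
  apply: (@measurableT_comp _ _ _ _ _ (measurableTypeR R)) => //.
  exact: measurable_coor.
- rewrite (_ : (fun t => _) = fst) //.
  by apply/funext => t; rewrite cons_rV0.
Qed.

Lemma measurable_uncons_rV n : measurable_fun setT (@uncons_rV n).
Proof.
apply/measurable_fun_pairP; split; first exact: measurable_coor.
apply: measurable_fun_rVP => i.
rewrite (_ : (fun t => _) = fun v : 'rV[R]_n.+1 => v ord0 (lift ord0 i)).
  exact: measurable_coor.
by apply/funext => t /=; rewrite mxE.
Qed.

Lemma cons_rVK n : cancel (@cons_rV n) (@uncons_rV n).
Proof.
move=> [x v]; rewrite /uncons_rV cons_rV0; congr pair.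
by apply/rowP => j; rewrite mxE cons_rVS.
Qed.

Section cons_measure.
Variable n : nat.
Variable mu : {sigma_finite_measure set 'rV[R]_n -> \bar R}.

Definition cons_measure : set 'rV[R]_n.+1 -> \bar R :=
  pushforward (lebesgue_measure \x mu)%E (@cons_rV n).

Let pf := measure_function_pushforward__canonical__measure_function_Measure
  (lebesgue_measure \x mu)%E (@measurable_cons_rV n).

Let cons_measure0 : cons_measure set0 = 0%E.
Proof. exact: (measure0 pf). Qed.

Let cons_measure_ge0 A : (0 <= cons_measure A)%E.
Proof. exact: (measure_ge0 pf). Qed.

Let cons_measure_sigma_additive : semi_sigma_additive cons_measure.
Proof. exact: (@measure_semi_sigma_additive _ _ _ pf). Qed.

HB.instance Definition _ := isMeasure.Build _ _ _ cons_measure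
  cons_measure0 cons_measure_ge0 cons_measure_sigma_additive.

Let cons_measure_sigma_finite : sigma_finite setT cons_measure.
Proof.
have /sigma_finiteP[F [TF ndF Foo]] :=
  sigma_finiteT (@lebesgue_measure R : {sigma_finite_measure set _ -> \bar R}).
have /sigma_finiteP[G [TG ndG Goo]] := sigma_finiteT mu.
exists (fun k => @uncons_rV n @^-1` (F k `*` G k)) => [|k].
  rewrite -preimage_bigcup (_ : \bigcup_k _ = setT) ?preimage_setT//.
  rewrite -setXTT TF TG predeqE => -[x y]; split.
    move=> [k _ []/= ? ?]; split; by exists k.
  move=> [/= [k _ Fkx] [l _ Gly]]; exists (maxn k l) => //; split.
  - by move: x Fkx; exact/subsetPset/ndF/leq_maxl.
  - by move: y Gly; exact/subsetPset/ndG/leq_maxr.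
have [mF Fy] := Foo k; have [mG Gy] := Goo k; split.
  rewrite -[X in measurable X]setTI; apply: measurable_uncons_rV => //.
  exact: measurableX.
rewrite /cons_measure /pushforward -comp_preimage.
rewrite (_ : _ \o _ = id) ?preimage_id; last first.
  by apply/funext => p /=; rewrite cons_rVK.
by rewrite product_measure1E// lte_mul_pinfty// ge0_fin_numE.
Qed.

HB.instance Definition _ := Measure_isSigmaFinite.Build _ _ _ cons_measure
  cons_measure_sigma_finite.

End cons_measure.

Fixpoint borel_lebesgue_rV n : {sigma_finite_measure set 'rV[R]_n -> \bar R} :=
  if n is k.+1 then cons_measure (borel_lebesgue_rV k) else \d_(0 : 'rV[R]_0).

(* R^n with the sigma-algebra of Lebesgue (not only Borel) measurable sets. *)
Definition lebesgue_space n : measurableType _ :=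
  caratheodory_type ((borel_lebesgue_rV n)^*)%mu.

Definition lebesgue_rV n : {measure set (lebesgue_space n) -> \bar R} :=
  @completed_measure_extension _ _ _ (borel_lebesgue_rV n).

End lebesgue_rV.
Arguments lebesgue_space R n : clear implicits.
Arguments lebesgue_rV R n : clear implicits.

Section calculus.
Context {R : realType}.

Definition dotv n (u v : 'rV[R]_n) : R := \sum_j u ord0 j * v ord0 j.

(* The library norm `|v| on 'rV[R]_n is the sup norm. *)
Definition enorm n (v : 'rV[R]_n) : R := Num.sqrt (dotv v v).

Definition eball n (r : R) : set 'rV[R]_n := [set X | enorm X < r].
Arguments eball n r : clear implicits.

Definition partial n (j : 'I_n) (u : 'rV[R]_n -> R) : 'rV[R]_n -> R :=
  'D_(delta_mx ord0 j) u.

Definition grad n (u : 'rV[R]_n -> R) (X : 'rV[R]_n) : 'rV[R]_n :=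
  \row_j partial j u X.

(* Meant for open O. *)
Fixpoint Ck k n (O : set 'rV[R]_n) (u : 'rV[R]_n -> R) : Prop :=
  (forall X, O X -> {for X, continuous u}) /\
  if k is k'.+1 then
    forall j, (forall X, O X -> derivable u X (delta_mx ord0 j)) /\
      Ck k' O (partial j u)
  else True.

Definition C2 (g : R -> R) : Prop :=
  (forall t, derivable g t 1 /\ derivable (derive1 g) t 1) /\
  continuous (derive1n 2 g).

Definition test_function n (psi : 'rV[R]_n -> R) : Prop :=
  (forall k, Ck k setT psi) /\ compact (closure [set X | psi X != 0]).

(* [f \_ O] is f extended by 0 outside O. *)
Definition Linfty n (O : set 'rV[R]_n) (f : 'rV[R]_n -> R) : Prop :=
  (f \_ O : lebesgue_space R n -> R) \in Lfun (lebesgue_rV R n) +oo%E.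

Definition L2loc n (f : 'rV[R]_n -> R) : Prop :=
  forall r, 0 < r -> (f \_ (eball n r) : lebesgue_space R n -> R) \in
    Lfun (lebesgue_rV R n) 2%:E.

Definition weak_partial n (j : 'I_n) (f g : 'rV[R]_n -> R) : Prop :=
  forall phi, test_function phi ->
  \int[lebesgue_rV R n]_X (f X * partial j phi X) =
  - \int[lebesgue_rV R n]_X (g X * phi X).

Definition W12loc n (f : 'rV[R]_n -> R) : Prop :=
  L2loc f /\ forall j, exists2 g, L2loc g & weak_partial j f g.

Definition posdefmx n (M : 'M[R]_n) : Prop :=
  forall v : 'rV[R]_n, v != 0 -> 0 < dotv (v *m M) v.

(* For a real symmetric matrix of positive size the set is finite and nonempty,
   so the supremum is attained. *)
Definition max_eigenvalue n (M : 'M[R]_n) : R :=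
  sup [set l | eigenvalue M l].

End calculus.
Arguments eball {R} n r.

(* R^m x R^(p+1) is 'rV[R]_(m + p.+1), with x = lsubmx X and y = rsubmx X, so
   N = m + p.+1 and N - m = p.+1 >= 1. *)
Section system.
Context {R : realType}.
Variables m p n : nat.
Notation N := (m + p.+1)%N.
Implicit Types (a : 'rV[R]_m -> R -> R) (F : 'rV[R]_m -> 'rV[R]_n -> R)
  (u : 'I_n -> 'rV[R]_N -> R).

Definition y_last : 'I_N := rshift m ord_max.

Definition values u (X : 'rV[R]_N) : 'rV[R]_n := \row_i u i X.

(* The values of a at t <= 0 are irrelevant. *)
Definition admissible_coefficient a : Prop :=
  [/\ forall al be, 0 < al -> al < be ->
        Linfty [set Z : 'rV[R]_(m + 1) |
                 al <= rsubmx Z ord0 ord0 /\ rsubmx Z ord0 ord0 <= be]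
               (fun Z => a (lsubmx Z) (rsubmx Z ord0 ord0)),
      forall t, 0 < t -> 0 < inf [set a x t | x in setT] &
      forall x t, 0 < t ->
        derivable (a x) t 1 /\ {for t, continuous (derive1 (a x))}].

Definition F1 F (i : 'I_n) (x : 'rV[R]_m) : 'rV[R]_n -> R :=
  partial i (F x).

Definition F2 F (i j : 'I_n) (x : 'rV[R]_m) : 'rV[R]_n -> R :=
  partial j (F1 F i x).

(* C^2 regularity in each variable xi^i separately does not make the mixed
   derivatives F_ij meaningful; their existence and continuity, implicit in the
   use of F_ij, is the second clause. *)
Definition admissible_nonlinearity F : Prop :=
  (forall x i xi, C2 (fun t => F x (xi + t *: delta_mx ord0 i))) /\
  (forall x (i j : 'I_n), i != j ->
     (forall xi, derivable (F1 F i x) xi (delta_mx ord0 j)) /\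
     continuous (F2 F i j x)).

Definition weak_solution (a : 'I_n -> 'rV[R]_m -> R -> R) F u : Prop :=
  forall psi : 'I_n -> 'rV[R]_N -> R, (forall i, test_function (psi i)) ->
  forall i,
  let lhs X := dotv (a i (lsubmx X) (enorm (grad (u i) X)) *: grad (u i) X)
                    (grad (psi i) X) in
  let rhs X := F1 F i (lsubmx X) (values u X) * psi i X in
  [/\ (lebesgue_rV R N).-integrable setT (EFin \o lhs),
      (lebesgue_rV R N).-integrable setT (EFin \o rhs) &
      \int[lebesgue_rV R N]_X lhs X = \int[lebesgue_rV R N]_X rhs X].

Definition F_monotone F u : Prop :=
  (forall i X, partial y_last (u i) X != 0) /\
  (forall (i j : 'I_n) X, (i < j)%N ->
     0 <= F2 F i j (lsubmx X) (values u X) *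
          partial y_last (u i) X * partial y_last (u j) X).

Definition regular (v : 'rV[R]_N -> R) : Prop :=
  [/\ Ck 1 setT v, Ck 2 [set X | grad v X != 0] v, Linfty setT v,
      forall j, Linfty setT (partial j v) & forall j, W12loc (partial j v)].

Definition Amx a (x : 'rV[R]_m) (eta : 'rV[R]_N) : 'M[R]_N :=
  \matrix_(i, j) (a x (enorm eta) * (i == j)%:R +
    derive1 (a x) (enorm eta) * (eta ord0 i * eta ord0 j / enorm eta)).

Definition Agrad a (v : 'rV[R]_N -> R) (X : 'rV[R]_N) : 'M[R]_N :=
  Amx a (lsubmx X) (grad v X).

Definition condition_B a (v : 'rV[R]_N -> R) : Prop :=
  forall r, 0 < r -> forall k l,
    Linfty ([set X | grad v X != 0] `&` eball N r) (fun X => Agrad a v X k l).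

End system.

(* Main.v *)
Require Import Defs.
From HB Require Import structures.
From mathcomp Require Import all_boot all_order all_algebra.
From mathcomp Require Import all_classical all_reals all_analysis.
From mathcomp Require Import measurable_realfun ess_sup_inf ring lra.

Set Implicit Arguments.
Unset Strict Implicit.
Unset Printing Implicit Defensive.
Import Order.TTheory GRing.Theory Num.Theory.
Import numFieldNormedType.Exports.

Local Open Scope ring_scope.
Local Open Scope classical_set_scope.

(* Let v = d_N u and w = d_k u, where y_N is the last y-variable and y_k any y-variable.
   Since v never vanishes, each u^i is C^2 and sigma = w / v is C^1. As x does not move
   in the y-directions, the equation can be differentiated in y_k and y_N. Testing the
   two resulting equations with w theta^2 and w^2 theta^2 / v, subtracting and summing
   over i, the left-hand sides give
     sum_i v_i^2 theta^2 <A_i grad sigma_i, grad sigma_i>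
       + 2 v_i w_i theta <A_i grad sigma_i, grad theta>,
   while the right-hand sides add up, on each slice {x} x R^(N-m), to minus
     sum_(i<j) F_ij v_i v_j (sigma_i - sigma_j)^2 theta^2 <= 0.
   The F_ii never enter: they cancel at the level of difference quotients of F.
   As the growth hypothesis bounds the energy of w against cutoffs theta_R uniformly in
   R, Young's inequality bounds J(R) = sum_i int v_i^2 theta_R^2 <A_i grad sigma_i, grad sigma_i>,
   and then J(R) <= (J(2R) - J(R/2)) / del + del K for every del > 0, so that J = 0.
   Hence grad sigma_i = 0 and grad_y u^i is parallel to a constant vector; moreover the
   coupling term vanishes, so sigma_j = sigma_k wherever F_jk <> 0. *)

(** * Directional calculus on R^n *)

(** The low regularity decides the form of the steps. F(x, .) is C^2 in each variable separately, so
    F_i(x, u) need not be C^1 in y, and both a and F may be discontinuous in x. Hence the derivative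
    of the right-hand side stays on the test function, fluxes are differentiated along y-lines only,
    and the cancellation is carried out on slices, where x is a parameter. Slices require Fubini for
    a product of Borel measures, whereas the weak formulation gives Lebesgue integrability; Borel
    representatives bridge the two. The pair phi = w theta^2, psi = w^2 theta^2 / v is chosen so
    that w phi = v psi, which is exactly the relation that removes F_ii. The recursive bound on J
    holds because grad theta_R lives on the annulus R < |X| < 2R, where theta_(2R)^2 - theta_(R/2)^2
    = 1. The coupling is shown to vanish only for almost every x, so in the last claim a point of U
    has to be moved slightly in x, which openness of U permits. *)

Section directional.
Context {R : realType}.
Implicit Types n : nat.

Lemma is_derive_line (V : normedModType R) (f : V -> R) (X v : V) (t : R) :
  derivable f (X + t *: v) v ->
  is_derive t 1 (fun s : R => f (X + s *: v)) ('D_v f (X + t *: v)).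
Proof.
move=> df.
have E : (fun h : R => h^-1 *: (((fun s : R => f (X + s *: v)) \o shift t) (h *: 1)
    - f (X + t *: v))) =
   (fun h : R => h^-1 *: ((f \o shift (X + t *: v)) (h *: v) - f (X + t *: v))).
  apply/funext => h /=; congr (_ *: (f _ - _)).
  by rewrite /= [h%:A]mulr1 scalerDl addrCA.
split; first by rewrite /derivable E.
by rewrite /derive E.
Qed.

Lemma line_MVT (V : normedModType R) (f : V -> R) (X v : V) (h : R) :
  (forall t, derivable f (X + t *: v) v) ->
  exists2 t, `|t| <= `|h| & f (X + h *: v) - f X = h * 'D_v f (X + t *: v).
Proof.
move=> df; pose g (s : R) := f (X + s *: v).
have dg (s : R) : is_derive s 1 g ('D_v f (X + s *: v)) by exact: is_derive_line.
have cg : continuous g.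
  by move=> s; apply: differentiable_continuous; apply/derivable1_diffP.
have g0 : g 0 = f X by rewrite /g scale0r addr0.
rewrite -[f X]g0 -/(g h); case: (leP 0 h) => h0.
  have [|c] := MVT_segment h0 (fun s _ => dg s); first exact: continuous_subspaceT.
  rewrite in_itv /= => /andP[c0 ch] ->; exists c; first by rewrite !ger0_norm.
  by rewrite subr0 mulrC.
have [|c] := MVT_segment (ltW h0) (fun s _ => dg s); first exact: continuous_subspaceT.
rewrite in_itv /= => /andP[c0 ch] E; exists c.
  by rewrite !ler0_norm ?lerN2 // ltW.
by rewrite -opprB E sub0r mulrN opprK mulrC.
Qed.

Lemma row_normP n (X : 'rV[R]_n) (c : R) : 0 <= c ->
  (`|X| <= c) <-> forall j, `|X ord0 j| <= c.
Proof.
move=> c0; split=> [Xc j|Xc].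
  apply: le_trans Xc; rewrite [X in _ <= X]mx_normrE.
  by apply/bigmax_geP; right; exists (ord0, j).
rewrite [X in X <= _]mx_normrE; apply/bigmax_leP; split => // -[i j] _ /=.
by rewrite (ord1 i).
Qed.

Lemma row_norm_coord n (X : 'rV[R]_n) j : `|X ord0 j| <= `|X|.
Proof. by apply: (row_normP X (normr_ge0 X)).1. Qed.

(** A staircase from Y to Y + H, one coordinate at a time, with the mean value theorem on each leg.
    Derivability is asked only in the directions that H uses: [continuous_partials] applies it to a
    function about whose i-th partial derivative nothing is assumed. *)
Lemma telescope_MVT n (f : 'rV[R]_n -> R) (Y H : 'rV[R]_n) :
  (forall k, H ord0 k != 0 -> forall X, derivable f X (delta_mx ord0 k)) ->
  exists c : 'I_n -> 'rV[R]_n, (forall k, `|c k - Y| <= `|H|) /\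
    f (Y + H) - f Y = \sum_k H ord0 k * partial k f (c k).
Proof.
move=> df.
pose P (i : nat) : 'rV[R]_n := \row_j (if (j < i)%N then H ord0 j else 0).
have PS (k : 'I_n) : P k.+1 = P k + H ord0 k *: delta_mx ord0 k.
  apply/rowP => j; rewrite !mxE eqxx /= ltnS leq_eqVlt.
  have [<-|jk] := eqVneq j k; first by rewrite eqxx ltnn /= mulr1 add0r.
  by rewrite (_ : (nat_of_ord j == k) = false) ?mulr0 ?addr0 //; apply/negbTE.
have step (k : 'I_n) : exists c : 'rV[R]_n, `|c - Y| <= `|H| /\
    f (Y + P k.+1) - f (Y + P k) = H ord0 k * partial k f c.
  have [H0|H0] := eqVneq (H ord0 k) 0.
    by exists Y; rewrite PS H0 scale0r addr0 subrr mul0r subrr normr0.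
  have [t tH E] := @line_MVT _ f (Y + P k) (delta_mx ord0 k) (H ord0 k)
    (fun t => df k H0 _).
  exists (Y + P k + t *: delta_mx ord0 k); split; last by rewrite PS addrA.
  rewrite addrAC (addrAC Y) subrr add0r.
  apply/row_normP => // j; rewrite !mxE eqxx /=.
  have [->|jk] := eqVneq j k.
    by rewrite ltnn add0r mulr1 (le_trans tH) // row_norm_coord.
  by rewrite mulr0 addr0; case: ifP => _; rewrite ?normr0 ?row_norm_coord.
have [c cP] := choice step.
exists c; split => [k|]; first exact: (cP k).1.
rewrite -(eq_bigr _ (fun k _ => (cP k).2)).
rewrite -(big_mkord xpredT (fun k => f (Y + P k.+1) - f (Y + P k))).
rewrite telescope_sumr //; congr (f (Y + _) - f _).
  by apply/rowP => j; rewrite mxE ltn_ord.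
by rewrite (_ : P 0 = 0) ?addr0 //; apply/rowP => j; rewrite !mxE.
Qed.


Lemma cvg_line (V : normedModType R) (f : V -> R) (y v : V) : derivable f y v ->
  f (h *: v + y) @[h --> (0 : R)^'] --> f y.
Proof.
move=> /derivable1P /derivable1_diffP /differentiable_continuous.
move=> cf; have {cf} : (f (h *: v + y)) @[h --> (0 : R)] --> f (0 *: v + y) := cf.
by rewrite scale0r add0r; apply: cvg_trans; apply: cvg_app; exact: cvg_within.
Qed.

Lemma cont_normP (V : normedModType R) (f : V -> R) (X : V) :
  {for X, continuous f} <-> forall e, 0 < e ->
    exists2 d, 0 < d & forall Z, `|Z - X| < d -> `|f Z - f X| <= e.
Proof.
split=> [cf e e0|cf].
  have /cvgrPdist_le /(_ e e0) /nbhs_normP[d /= d0 H] : f @ X --> f X := cf.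
  by exists d => // Z ZX; rewrite distrC; apply: H; rewrite /ball_ /= distrC.
apply/(@cvgrPdist_le _ _ _ (nbhs X)) => e e0; have [d d0 H] := cf e e0.
by apply/nbhs_normP; exists d => // Z; rewrite /ball_ /= distrC => /H; rewrite distrC.
Qed.

Definition C1 n (f : 'rV[R]_n -> R) := continuous f /\
  forall j, (forall X, derivable f X (delta_mx ord0 j)) /\ continuous (partial j f).

Lemma Ck1P n (f : 'rV[R]_n -> R) : Ck 1 setT f <-> C1 f.
Proof.
split=> [[/= cf df]|[cf df]].
  by split=> [X|j]; [exact: cf|split=> X; [exact: (df j).1|exact: (df j).2.1]].
split=> [X _|j]; first exact: cf.
by split=> [X _|]; [exact: (df j).1|split=> // X _; exact: (df j).2].
Qed.

(** The inner map only needs coordinates derivable along v. The mean value points of [telescope_MVT]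
    tend to c y because each coordinate is continuous along the line, and continuity of the partials
    of f gives the limit. *)
Lemma chain_rule (V : normedModType R) n (c : V -> 'rV[R]_n)
    (f : 'rV[R]_n -> R) (y v : V) : C1 f ->
  (forall j, derivable (fun z => c z ord0 j) y v) ->
  is_derive y v (f \o c)
    (\sum_j 'D_v (fun z => c z ord0 j) y * partial j f (c y)).
Proof.
move=> [_ df] dc.
have /choice[pt ptP] : forall h : R, exists p : 'I_n -> 'rV[R]_n,
    (forall k, `|p k - c y| <= `|c (h *: v + y) - c y|) /\
    f (c (h *: v + y)) - f (c y) =
    \sum_k (c (h *: v + y) - c y) ord0 k * partial k f (p k).
  move=> h; have [p [p1 p2]] := @telescope_MVT _ f (c y) (c (h *: v + y) - c y)
    (fun k _ => (df k).1).
  by exists p; split => //; rewrite -p2 [c y + _]addrC subrK.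
have cc : `|c (h *: v + y) - c y| @[h --> (0 : R)^'] --> (0 : R).
  apply/cvgrPdist_le => e e0.
  have H : \forall h \near (0 : R)^', forall j, `|c (h *: v + y) ord0 j - c y ord0 j| <= e.
    apply: filter_forall => j; have := cvg_line (dc j).
    by move=> /cvgrPdist_le /(_ e e0); apply: filterS => h; rewrite distrC.
  apply: filterS H => h H; rewrite sub0r normrN normr_id.
  by apply/(row_normP _ (ltW e0)) => j; rewrite !mxE.
have ptc k : pt h k @[h --> (0 : R)^'] --> c y.
  apply/cvgrPdist_le => e e0; move/cvgrPdist_le : cc => /(_ e e0).
  apply: filterS => h; rewrite sub0r normrN normr_id [X in _ -> X <= _]distrC.
  by apply: le_trans; exact: (ptP h).1.
have H : h^-1 *: (((f \o c) \o shift y) (h *: v) - (f \o c) y) @[h --> (0 : R)^'] -->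
    \sum_j 'D_v (fun z => c z ord0 j) y * partial j f (c y).
  have -> : (fun h : R => h^-1 *: (((f \o c) \o shift y) (h *: v) - (f \o c) y)) =
     (fun h => \sum_j (h^-1 *: (((fun z => c z ord0 j) \o shift y) (h *: v) - c y ord0 j))
        * partial j f (pt h j)).
    apply/funext => h; rewrite /= (ptP h).2 scaler_sumr; apply: eq_bigr => j _.
    by rewrite -scalerAl !mxE.
  apply: cvg_big => [|j _]; first exact: add_continuous.
  apply: cvgM; first exact: (dc j).
  by apply: (cvg_comp _ _ (ptc j)); exact: (df j).2.
by split; [apply/cvg_ex; eexists; exact: H|exact/cvg_lim].
Qed.

Lemma norm_e n (t : R) (j : 'I_n) : `|t *: delta_mx ord0 j : 'rV[R]_n| <= `|t|.
Proof.
apply/row_normP => // k; rewrite !mxE normrM.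
by case: (_ && _); rewrite ?mulr1n ?mulr0n ?normr1 ?normr0 ?mulr1 ?mulr0.
Qed.

(** Move first in direction i, where continuity along the line is used, then in the other
    directions, where locally bounded partials give a Lipschitz estimate. Meant for F_i, whose
    derivative F_ii need not be jointly continuous. *)
Lemma continuous_partials n (f : 'rV[R]_n -> R) (i : 'I_n) :
  (forall k, k != i -> (forall X, derivable f X (delta_mx ord0 k)) /\
      continuous (partial k f)) ->
  (forall X, {for 0, continuous (fun t : R => f (X + t *: delta_mx ord0 i))}) ->
  continuous f.
Proof.
move=> df cfi X; apply/cont_normP => e e0.
pose M := \sum_k (`|partial k f X| + 1).
have M0 : 0 <= M by apply: sumr_ge0 => k _; rewrite addr_ge0.
have e2 : 0 < e / 2 by rewrite divr_gt0.
have /cont_normP /(_ _ e2)[d1 d10 d1P] := cfi X.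
have /choice[d dP] : forall k : 'I_n, exists d, 0 < d /\ (k != i ->
    forall W, `|W - X| < d -> `|partial k f W| <= `|partial k f X| + 1).
  move=> k; have [->|ki] := eqVneq k i; first by exists 1.
  have /cont_normP /(_ 1 ltr01)[d d0 dP] := (df k ki).2 X.
  exists d; split => // _ W /dP; rewrite -lerBlDl; apply: le_trans.
  exact: lerB_dist.
pose d2 := \big[Num.min/1]_k d k.
have d20 : 0 < d2.
  by rewrite /d2; elim/big_ind: _ => // [x y x0 y0|k _]; rewrite ?lt_min ?x0 // (dP k).1.
have d2P (k : 'I_n) W : k != i -> `|W - X| < d2 ->
    `|partial k f W| <= `|partial k f X| + 1.
  move=> ki Wd; apply: (dP k).2 => //; apply: lt_le_trans Wd _.
  by rewrite /d2 (bigD1 k) //= ge_min lexx.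
(* d1 controls the leg in direction i, d2 / 2 keeps the sum of both displacements below d2, and the
   last term makes the remaining legs cost at most e / 2. *)
exists (Num.min (Num.min d1 (d2 / 2)) (e / 2 / (M + 1))).
  by rewrite !lt_min d10 !divr_gt0 // ltr_wpDl.
move=> Z; rewrite !lt_min -andbA => /and3P[Z1 Z2 Z3].
pose H := Z - X.
pose H' : 'rV[R]_n := \row_k (if k == i then 0 else H ord0 k).
pose Y := X + H ord0 i *: delta_mx ord0 i.
have YH : Y + H' = Z.
  apply/rowP => k; rewrite !mxE eqxx /=; have [->|ki] := eqVneq k i.
    by rewrite mulr1 addr0 addrC subrK.
  by rewrite mulr0 addr0 addrC subrK.
have H'H : `|H'| <= `|H|.
  apply/row_normP => // k; rewrite mxE; case: ifP => _; first by rewrite normr0.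
  exact: row_norm_coord.
have [k Hk|c [c1 c2]] := @telescope_MVT _ f Y H'.
  apply: (df k _).1; apply: contraNneq Hk => ->; by rewrite mxE eqxx.
have -> : f Z - f X = (f Y - f X) + (f (Y + H') - f Y) by rewrite YH; ring.
rewrite (splitr e); apply: (le_trans (ler_normD _ _)); apply: lerD.
  have := d1P (H ord0 i); rewrite scale0r addr0; apply; rewrite subr0.
  by apply: le_lt_trans Z1; exact: row_norm_coord.
rewrite c2; apply: (le_trans (ler_norm_sum _ _ _)).
apply: (@le_trans _ _ (`|H| * (M + 1))); last first.
  by rewrite -ler_pdivlMr ?ltr_wpDl // ltW.
apply: (@le_trans _ _ (`|H| * M)); last by rewrite ler_wpM2l // lerDl.
rewrite /M mulr_sumr; apply: ler_sum => k _; rewrite normrM.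
have [->|ki] := eqVneq k i.
  by rewrite mxE eqxx normr0 mul0r mulr_ge0 // addr_ge0.
apply: ler_pM => //; first by apply: le_trans H'H; exact: row_norm_coord.
apply: d2P => //.
have -> : c k - X = (c k - Y) + H ord0 i *: delta_mx ord0 i.
  by apply/rowP => l; rewrite !mxE; ring.
apply: (le_lt_trans (ler_normD _ _)); rewrite (splitr d2); apply: ltr_leD.
  by apply: le_lt_trans Z2; rewrite (le_trans (c1 k)).
rewrite (le_trans _ (ltW Z2)) //; apply: le_trans (norm_e _ _) _.
exact: row_norm_coord.
Qed.

(** Schwarz's theorem: the second difference over a square of side h is symmetric in i and j, and it
    equals h^2 times either mixed derivative at a point within 2h of X. *)
Lemma partial_comm n (f : 'rV[R]_n -> R) (i j : 'I_n) :
  (forall X, derivable f X (delta_mx ord0 i)) ->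
  (forall X, derivable f X (delta_mx ord0 j)) ->
  (forall X, derivable (partial i f) X (delta_mx ord0 j)) ->
  (forall X, derivable (partial j f) X (delta_mx ord0 i)) ->
  continuous (partial j (partial i f)) -> continuous (partial i (partial j f)) ->
  partial j (partial i f) = partial i (partial j f).
Proof.
have second (a b : 'I_n) : (forall X, derivable f X (delta_mx ord0 a)) ->
    (forall X, derivable (partial a f) X (delta_mx ord0 b)) ->
    forall X (h : R), exists t s, [/\ `|t| <= `|h|, `|s| <= `|h| &
    f (X + h *: delta_mx ord0 a + h *: delta_mx ord0 b) - f (X + h *: delta_mx ord0 b)
      - (f (X + h *: delta_mx ord0 a) - f X) =
    h * (h * partial b (partial a f) (X + t *: delta_mx ord0 a + s *: delta_mx ord0 b))].
  move=> da dab X h.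
  pose g Y := f (Y + h *: delta_mx ord0 b) - f Y.
  have dsh Y : is_derive Y (delta_mx ord0 a) (fun Y => f (Y + h *: delta_mx ord0 b))
      (partial a f (Y + h *: delta_mx ord0 b)).
    have E : (fun k : R => k^-1 *: (((fun Y => f (Y + h *: delta_mx ord0 b)) \o shift Y)
        (k *: delta_mx ord0 a) - f (Y + h *: delta_mx ord0 b))) =
      (fun k => k^-1 *: ((f \o shift (Y + h *: delta_mx ord0 b)) (k *: delta_mx ord0 a)
        - f (Y + h *: delta_mx ord0 b))).
      by apply/funext => k /=; rewrite addrA.
    split; first by rewrite /derivable E; exact: da.
    by rewrite /derive E.
  have dg Y : is_derive Y (delta_mx ord0 a) g
      (partial a f (Y + h *: delta_mx ord0 b) - partial a f Y).
    by apply: is_deriveB => //; exact: derivableP.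
  have dg' Y : derivable g Y (delta_mx ord0 a) by have [] := dg Y.
  have [t th E1] := @line_MVT _ g X (delta_mx ord0 a) h (fun t => dg' _).
  have [s sh E2] := @line_MVT _ (partial a f) (X + t *: delta_mx ord0 a)
    (delta_mx ord0 b) h (fun t => dab _).
  exists t, s; split => //; rewrite -[partial b _ _]/('D__ _ _) -E2.
  have [_ dv] := dg (X + t *: delta_mx ord0 a).
  by rewrite -dv -E1 /g; ring.
move=> di dj dij dji cij cji; apply/funext => X; apply/eqP; rewrite -subr_eq0.
rewrite -normr_eq0 eq_le normr_ge0 andbT.
apply/ler_addgt0Pl => e e0; rewrite addr0.
have e2 : 0 < e / 2 by rewrite divr_gt0.
have tri (p q z : R) : `|z - p| <= e / 2 -> `|z - q| <= e / 2 -> `|p - q| <= e.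
  move=> zp zq; rewrite (splitr e) -(subrKA z).
  by apply: (le_trans (ler_normD _ _)); rewrite lerD // distrC.
move: (cij X) (cji X) => /cont_normP /(_ _ e2)[d1 d10 d1P].
move=> /cont_normP /(_ _ e2)[d2 d20 d2P].
(* A third, so that a displacement of norm at most h + h stays below both radii. *)
pose h := Num.min d1 d2 / 3.
have h0 : 0 < h by rewrite divr_gt0 // lt_min d10.
have hd (a b : 'I_n) (t s : R) : `|t| <= `|h| -> `|s| <= `|h| ->
    `|X + t *: delta_mx ord0 a + s *: delta_mx ord0 b - X| < Num.min d1 d2.
  move=> th sh.
  rewrite (_ : _ - X = t *: delta_mx ord0 a + s *: delta_mx ord0 b); last first.
    by apply/rowP => l; rewrite !mxE; ring.
  apply: (le_lt_trans (ler_normD _ _)).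
  apply: (@le_lt_trans _ _ (h + h)).
    by rewrite -{1 2}(gtr0_norm h0); apply: lerD; apply: le_trans (norm_e _ _) _.
  by rewrite /h -mulrDr; move: h0; rewrite /h; lra.
have [t1 [s1 [t1h s1h E1]]] := second i j di dij X h.
have [t2 [s2 [t2h s2h E2]]] := second j i dj dji X h.
move: (hd i j _ _ t1h s1h) (hd j i _ _ t2h s2h).
rewrite !lt_min => /andP[/d1P H1 _] /andP[_ /d2P H2].
have EE : partial j (partial i f) (X + t1 *: delta_mx ord0 i + s1 *: delta_mx ord0 j) =
   partial i (partial j f) (X + t2 *: delta_mx ord0 j + s2 *: delta_mx ord0 i).
  apply: (mulfI (lt0r_neq0 h0)); apply: (mulfI (lt0r_neq0 h0)).
  apply: etrans (esym E1) _; apply: etrans _ E2.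
  rewrite (_ : X + h *: delta_mx ord0 i + h *: delta_mx ord0 j =
    X + h *: delta_mx ord0 j + h *: delta_mx ord0 i); first by ring.
  by apply/rowP => l; rewrite !mxE; ring.
rewrite EE in H1; exact: tri H1 H2.
Qed.


Lemma is_derive_lineP (V : normedModType R) (f : V -> R) (X v : V) (d : R) :
  is_derive (0 : R) 1 (fun s : R => f (X + s *: v)) d <-> is_derive X v f d.
Proof.
have E : (fun h : R => h^-1 *: (((fun s : R => f (X + s *: v)) \o shift 0) (h *: 1)
    - f (X + (0 : R) *: v))) =
   (fun h : R => h^-1 *: ((f \o shift X) (h *: v) - f X)).
  apply/funext => h /=; rewrite scale0r !addr0; congr (_ *: (f _ - _)).
  by rewrite /= [h%:A]mulr1 addrC.
split=> -[d1 d2].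
  split; first by move: d1; rewrite /derivable E.
  by move: d2; rewrite /derive E.
split; first by rewrite /derivable E.
by rewrite /derive E.
Qed.

Lemma is_derive_comp1 (V : normedModType R) (f : V -> R) (g : R -> R) (X v : V) (a b : R) :
  is_derive X v f a -> is_derive (f X) 1 g b ->
  is_derive X v (fun Y => g (f Y)) (b * a).
Proof.
move=> /is_derive_lineP fa gb; apply/is_derive_lineP.
have gb' : is_derive (f (X + (0 : R) *: v)) 1 g b by rewrite scale0r addr0.
exact: (@is_derive1_comp _ g (fun s : R => f (X + s *: v)) 0 b a).
Qed.

Lemma is_derive_partial n (f : 'rV[R]_n -> R) X j d :
  is_derive X (delta_mx ord0 j) f d -> partial j f X = d.
Proof. by case. Qed.

Lemma C1_is_derive n (f : 'rV[R]_n -> R) X j : C1 f ->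
  is_derive X (delta_mx ord0 j) f (partial j f X).
Proof. by move=> [_ /(_ j)[df _]]; exact: derivableP. Qed.

Lemma C1_intro n (f : 'rV[R]_n -> R) (df : 'I_n -> 'rV[R]_n -> R) :
  continuous f -> (forall j X, is_derive X (delta_mx ord0 j) f (df j X)) ->
  (forall j, continuous (df j)) -> C1 f.
Proof.
move=> cf dfE cdf; split=> // j; split; first by move=> X; have [] := dfE j X.
rewrite (_ : partial j f = df j) //; apply/funext => X.
exact: is_derive_partial.
Qed.

Lemma C1_cst n (c : R) : C1 (fun _ : 'rV[R]_n => c).
Proof.
apply: (@C1_intro _ _ (fun _ _ => 0)) => [|j]; exact: cst_continuous.
Qed.

Lemma is_derive_coord n (k j : 'I_n) (X : 'rV[R]_n) :
  is_derive X (delta_mx ord0 j) (fun Y : 'rV[R]_n => Y ord0 k) (k == j)%:R.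
Proof.
apply/is_derive_lineP.
rewrite (_ : (fun s : R => _) = (fun s : R => X ord0 k + s * (k == j)%:R)); last first.
  by apply/funext => s; rewrite !mxE.
apply: is_derive_eq; rewrite ?scaler0 ?add0r.
by rewrite mul1r [_%:A]mulr1.
Qed.

Lemma C1_coord n (k : 'I_n) : C1 (fun Y : 'rV[R]_n => Y ord0 k).
Proof.
apply: (@C1_intro _ _ (fun j _ => (k == j)%:R)) => [|j X|j].
- exact: coord_continuous.
- exact: is_derive_coord.
- exact: cst_continuous.
Qed.

Lemma is_derive_add n (f g : 'rV[R]_n -> R) X v a b :
  is_derive X v f a -> is_derive X v g b ->
  is_derive X v (fun Y => f Y + g Y) (a + b).
Proof. by move=> fa gb; exact: (is_deriveD fa gb). Qed.

Lemma is_derive_mul n (f g : 'rV[R]_n -> R) X v a b :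
  is_derive X v f a -> is_derive X v g b ->
  is_derive X v (fun Y => f Y * g Y) (a * g X + f X * b).
Proof.
move=> fa gb; have := is_deriveM fa gb; move=> H.
rewrite (_ : a * g X + f X * b = f X *: b + g X *: a) //.
by rewrite addrC [_ *: b]/(_ * b) [_ *: a]/(_ * a) (mulrC a).
Qed.

Lemma contD (T : topologicalType) (f g : T -> R) : continuous f -> continuous g ->
  continuous (fun Y => f Y + g Y).
Proof. by move=> cf cg X; apply: continuousD; [exact: cf|exact: cg]. Qed.

Lemma contM (T : topologicalType) (f g : T -> R) : continuous f -> continuous g ->
  continuous (fun Y => f Y * g Y).
Proof. by move=> cf cg X; apply: continuousM; [exact: cf|exact: cg]. Qed.

Lemma contV (T : topologicalType) (f : T -> R) : continuous f -> (forall X, f X != 0) ->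
  continuous (fun Y => (f Y)^-1).
Proof. by move=> cf f0 X; apply: continuousV; [exact: f0|exact: cf]. Qed.

Lemma cont_sum (T : topologicalType) n (f : 'I_n -> T -> R) :
  (forall i, continuous (f i)) -> continuous (fun Y => \sum_i f i Y).
Proof. by move=> cf; apply: continuous_big => [|i _]; [exact: add_continuous|]. Qed.

Lemma cont_comp (T : topologicalType) (f : T -> R) (g : R -> R) :
  continuous f -> continuous g -> continuous (fun Y => g (f Y)).
Proof. by move=> cf cg X; apply: continuous_comp; [exact: cf|exact: cg]. Qed.

Lemma C1D n (f g : 'rV[R]_n -> R) : C1 f -> C1 g -> C1 (fun Y => f Y + g Y).
Proof.
move=> Cf Cg; apply: (@C1_intro _ _ (fun j X => partial j f X + partial j g X)).
- exact: contD Cf.1 Cg.1.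
- by move=> j X; apply: is_derive_add; exact: C1_is_derive.
- by move=> j; apply: contD; [exact: (Cf.2 j).2|exact: (Cg.2 j).2].
Qed.

Lemma C1M n (f g : 'rV[R]_n -> R) : C1 f -> C1 g -> C1 (fun Y => f Y * g Y).
Proof.
move=> Cf Cg.
apply: (@C1_intro _ _ (fun j X => partial j f X * g X + f X * partial j g X)).
- exact: contM Cf.1 Cg.1.
- by move=> j X; apply: is_derive_mul; exact: C1_is_derive.
- move=> j; apply: contD; apply: contM; first exact: (Cf.2 j).2.
  + exact: Cg.1.
  + exact: Cf.1.
  + exact: (Cg.2 j).2.
Qed.

Lemma C1_comp1 n (f : 'rV[R]_n -> R) (g dg : R -> R) : C1 f ->
  (forall t : R, is_derive t 1 g (dg t)) -> continuous dg -> C1 (fun Y => g (f Y)).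
Proof.
move=> Cf gE cdg; apply: (@C1_intro _ _ (fun j X => dg (f X) * partial j f X)).
- apply: cont_comp; first exact: Cf.1.
  move=> t; apply: differentiable_continuous; apply/derivable1_diffP.
  by have [] := gE t.
- by move=> j X; apply: is_derive_comp1 => //; exact: C1_is_derive.
- by move=> j; apply: contM; [apply: cont_comp => //; exact: Cf.1|exact: (Cf.2 j).2].
Qed.

Lemma is_derive_inv n (f : 'rV[R]_n -> R) X v a : f X != 0 ->
  is_derive X v f a -> is_derive X v (fun Y => (f Y)^-1) (- (f X) ^- 2 * a).
Proof.
move=> f0 fa; have [d1 d2] := fa; split; first exact: derivableV.
by rewrite deriveV // d2.
Qed.

Lemma C1V n (f : 'rV[R]_n -> R) : C1 f -> (forall X, f X != 0) ->
  C1 (fun Y => (f Y)^-1).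
Proof.
move=> Cf f0; apply: (@C1_intro _ _ (fun j X => - (f X) ^- 2 * partial j f X)).
- exact: contV Cf.1 f0.
- by move=> j X; apply: is_derive_inv => //; exact: C1_is_derive.
- move=> j; apply: contM; last exact: (Cf.2 j).2.
  move=> X; apply: (@continuousN _ _ _ (fun Y => f Y ^- 2)); apply: continuousV; first by rewrite expf_neq0.
  by apply: (@contM _ f f) => //; exact: Cf.1.
Qed.

Lemma cont_bounded n (f : 'rV[R]_n -> R) (r : R) : continuous f ->
  exists2 M : R, 0 <= M & forall X, `|X| <= r -> `|f X| <= M.
Proof.
move=> cf; have [r0|r0] := ltP r 0.
  by exists 0 => // X Xr; move: (le_lt_trans Xr r0); rewrite ltNge normr_ge0.
pose A := [set X : 'rV[R]_n | `|X| <= r].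
have cA : compact A.
  apply: bounded_closed_compact; first by exists r; split; [exact: num_real|move=> x rx X /= /le_trans; apply; exact: ltW].
  rewrite (_ : A = (fun X : 'rV[R]_n => `|X|) @^-1` [set x | x <= r]) //.
  by apply: closed_comp => [X _|]; [exact: norm_continuous|exact: closed_le].
have [||c _ cP] := @EVT_max_rV R n (fun X => `|f X|) A _ cA.
- by exists 0; rewrite /A /= normr0.
- apply: continuous_subspaceT => X; apply: continuous_comp; first exact: cf.
  exact: norm_continuous.
by exists `|f c| => // X Xr; apply: cP; rewrite inE.
Qed.

End directional.

(** * Translation invariance and Borel sets *)

Section translation.
Context {R : realType}.
Implicit Types n : nat.

Section measure_preserving.
Context d1 d2 (T1 : measurableType d1) (T2 : measurableType d2).
Context (mu1 : {measure set T1 -> \bar R}) (mu2 : {measure set T2 -> \bar R}).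
Variable phi : T1 -> T2.
Hypothesis mphi : measurable_fun setT phi.
Hypothesis muphi : forall A, measurable A -> mu1 (phi @^-1` A) = mu2 A.
Local Open Scope ereal_scope.

(** This change of variables serves three maps: translations, the identity from the completed to the
    Borel space, and the concatenation of rows. *)
Lemma ge0_integral_preserving (f : T2 -> \bar R) : measurable_fun setT f ->
  (forall x, 0 <= f x) -> \int[mu1]_x f (phi x) = \int[mu2]_x f x.
Proof.
move=> mf f0; transitivity (\int[mu1]_(x in phi @^-1` setT) (f \o phi) x).
  by rewrite preimage_setT.
rewrite -ge0_integral_pushforward //.
by apply: eq_measure_integral => A mA _; rewrite -muphi.
Qed.

Lemma integrable_preserving (f : T2 -> \bar R) : mu2.-integrable setT f ->
  mu1.-integrable setT (fun x => f (phi x)).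
Proof.
move=> /integrableP[mf fi]; apply/integrableP; split.
  exact: (measurableT_comp mf).
rewrite (ge0_integral_preserving (f := fun x => `|f x|)) //.
exact: measurableT_comp.
Qed.

(** Measurability of f is a hypothesis because that of its composite with phi does not imply it: a
    Lebesgue measurable function need not be Borel. *)
Lemma integrable_preservingP (f : T2 -> \bar R) : measurable_fun setT f ->
  mu1.-integrable setT (fun x => f (phi x)) -> mu2.-integrable setT f.
Proof.
move=> mf /integrableP[_ fi]; apply/integrableP; split => //.
rewrite -(ge0_integral_preserving (f := fun x => `|f x|)) //.
exact: measurableT_comp.
Qed.

Lemma integral_preserving (f : T2 -> \bar R) : mu2.-integrable setT f ->
  \int[mu1]_x f (phi x) = \int[mu2]_x f x.
Proof.
move=> fi; transitivity (\int[mu1]_(x in phi @^-1` setT) (f \o phi) x).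
  by rewrite preimage_setT.
rewrite -integral_pushforward //.
- by apply: eq_measure_integral => A mA _; rewrite -muphi.
- by have /integrableP[] := fi.
- by rewrite preimage_setT; exact: integrable_preserving.
Qed.

End measure_preserving.

Lemma measurable_addr (a : R) :
  measurable_fun [set: measurableTypeR R] ((fun x => x + a) : _ -> measurableTypeR R).
Proof. by apply: measurable_funD; [exact: measurable_id|exact: measurable_cst]. Qed.

Lemma lebesgue_measure_shift (a : R) (A : set (measurableTypeR R)) : measurable A ->
  lebesgue_measure ((fun x : measurableTypeR R => x + a) @^-1` A) = lebesgue_measure A.
Proof.
move=> mA; apply/esym.
pose pf := measure_function_pushforward__canonical__measure_function_Measure
  (@lebesgue_measure R) (measurable_addr a).
apply: (@lebesgue_measure_unique R pf) => // _ [[b c]] _ <- /=.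
rewrite /pushforward (_ : _ @^-1` _ = `](b - a), (c - a)]%classic).
  by rewrite !lebesgue_measure_itv /= !lte_fin ltrD2r -!EFinD; case: ifP => // _; congr (_%:E); ring.
by apply/seteqP; split => x /=; rewrite !in_itv /= ltrBlDr lerBrDr.
Qed.

Lemma ge0_integral_shift (f : measurableTypeR R -> \bar R) (a : R) :
  measurable_fun [set: measurableTypeR R] f -> (forall x, (0 <= f x)%E) ->
  (\int[@lebesgue_measure R]_x f ((x : R) + a)%R = \int[@lebesgue_measure R]_x f x)%E.
Proof.
exact: (ge0_integral_preserving (measurable_addr a) (lebesgue_measure_shift a)).
Qed.

Definition shift_rV n (v : 'rV[R]_n) (X : 'rV[R]_n) : 'rV[R]_n := X + v.

Lemma measurable_shift_rV n (v : 'rV[R]_n) : measurable_fun setT (shift_rV v).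
Proof.
apply: measurable_fun_rVP => i.
rewrite (_ : (fun t => _) = (fun x => x + v ord0 i) \o (fun X : 'rV[R]_n => X ord0 i)).
  by apply: measurableT_comp; [exact: measurable_addr|exact: measurable_coor].
by apply/funext => X; rewrite /shift_rV !mxE.
Qed.

(** Induction on the dimension: a section of the shifted set is a shifted section of the set, taken
    at the shifted first coordinate. *)
Lemma borel_lebesgue_shift n (v : 'rV[R]_n) (A : set 'rV[R]_n) : measurable A ->
  borel_lebesgue_rV n (shift_rV v @^-1` A) = borel_lebesgue_rV n A.
Proof.
elim: n v A => [|n IH] v A mA.
  congr (borel_lebesgue_rV 0 _); apply/seteqP; split => X; rewrite /shift_rV /=;
  by rewrite (_ : X + v = X) //; apply/rowP; case.
pose v' : 'rV[R]_n := \row_j v ord0 (lift ord0 j).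
have E (x : measurableTypeR R) : xsection (@cons_rV R n @^-1` (shift_rV v @^-1` A)) x =
    shift_rV v' @^-1` (xsection (@cons_rV R n @^-1` A) (x + v ord0 ord0)).
  apply/seteqP; split => y; rewrite /xsection /= !inE /=;
  rewrite (_ : cons_rV (x + v ord0 ord0, shift_rV v' y) = shift_rV v (cons_rV (x, y))) //;
  apply/rowP => j; rewrite [RHS]mxE; case: (unliftP ord0 j) => [k|] ->;
  by rewrite ?cons_rVS ?cons_rV0 // /shift_rV !mxE.
have mC : measurable (@cons_rV R n @^-1` A).
  by rewrite -[X in measurable X]setTI; exact: measurable_cons_rV.
rewrite /= /cons_measure /pushforward /product_measure1 /=.
rewrite -(@ge0_integral_shift (borel_lebesgue_rV n \o xsection (@cons_rV R n @^-1` A)) (v ord0 ord0)).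
- apply: eq_integral => x _ /=; rewrite E IH //.
  exact: measurable_xsection.
- exact: measurable_fun_xsection.
- by move=> x /=.
Qed.

Local Notation L n := (lebesgue_rV R n).

(** True for arbitrary sets, because the value is that of an outer measure, an infimum over Borel
    covers, and covers can be translated. One inequality for all shifts suffices, applied to v and
    to - v. *)
Lemma lebesgue_rV_shift n (v : 'rV[R]_n) (A : set 'rV[R]_n) :
  L n (shift_rV v @^-1` A) = L n A.
Proof.
have le w (C : set 'rV[R]_n) : (L n (shift_rV w @^-1` C) <= L n C)%E.
  apply: le_ereal_inf_tmp => _ [F [mF CF] <-]; apply: ereal_inf_lbound.
  exists (fun k => shift_rV w @^-1` F k).
    split => [k|X /= /CF [k _ FX]]; last by exists k.
    by rewrite -[X in measurable X]setTI; exact: measurable_shift_rV.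
  by apply: eq_eseriesr => k _; exact: borel_lebesgue_shift.
apply/eqP; rewrite eq_le le /=.
have := le (- v) (shift_rV v @^-1` A); congr (_ <= _)%E; congr (L n _).
by apply/seteqP; split => X; rewrite /shift_rV /= subrK.
Qed.

(** [shift_rV] retyped on the Lebesgue space, so that measurability refers to the completed
    sigma-algebra. *)
Definition shiftL n (v : 'rV[R]_n) : lebesgue_space R n -> lebesgue_space R n :=
  shift_rV v.

Lemma measurable_shift_lebesgue n (v : 'rV[R]_n) :
  measurable_fun [set: lebesgue_space R n] (shiftL v).
Proof.
move=> _ A mA; rewrite setTI.
have {}mA : caratheodory_measurable (L n) A := mA.
suff : caratheodory_measurable (L n) (shift_rV v @^-1` A : set 'rV[R]_n) by [].
move=> X; pose X' := shift_rV (- v) @^-1` X.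
have E (C : set 'rV[R]_n) : X `&` (shift_rV v @^-1` C) = shift_rV v @^-1` (X' `&` C).
  by apply/seteqP; split => Z; rewrite /X' /shift_rV /= addrK.
rewrite preimage_setC !E !lebesgue_rV_shift -(lebesgue_rV_shift (- v) X).
exact: mA.
Qed.

Lemma integrable_shift n (v : 'rV[R]_n) (f : lebesgue_space R n -> \bar R) :
  (L n).-integrable setT f -> (L n).-integrable setT (fun X => f (shiftL v X)).
Proof.
apply: (integrable_preserving (measurable_shift_lebesgue v)) => A _.
exact: lebesgue_rV_shift.
Qed.

Lemma integral_shift n (v : 'rV[R]_n) (f : lebesgue_space R n -> \bar R) :
  (L n).-integrable setT f ->
  (\int[L n]_X f (shiftL v X) = \int[L n]_X f X)%E.
Proof.
apply: (integral_preserving (measurable_shift_lebesgue v)) => A _.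
exact: lebesgue_rV_shift.
Qed.

Lemma measurable_forall_ord d (T : measurableType d) n (F : 'I_n -> set T) :
  (forall i, measurable (F i)) -> measurable [set x | forall i, F i x].
Proof.
move=> mF; rewrite (_ : [set x | _] = ~` (\bigcup_i ~` F i)).
  apply: measurableC; apply: countable_bigcupT_measurable.
    by apply: finite_set_countable; exact: finite_finset.
  by move=> i; exact: measurableC.
apply/seteqP; split=> [x Fx [i _]|x Fx i]; first exact.
by apply: contrapT => nF; apply: Fx; exists i.
Qed.

Lemma measurable_box n (c : 'rV[R]_n) (r : R) :
  measurable [set X : 'rV[R]_n | forall i, `|X ord0 i - c ord0 i| < r].
Proof.
apply: (measurable_forall_ord (F := fun i => [set X : 'rV[R]_n | `|X ord0 i - c ord0 i| < r])) => i.
rewrite (_ : [set X | _] =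
  (fun X : 'rV[R]_n => X ord0 i : measurableTypeR R) @^-1` (`]c ord0 i - r, c ord0 i + r[%classic)).
  by rewrite -[X in measurable X]setTI; apply: measurable_coor => //; exact: measurable_itv.
by apply/seteqP; split => X /=; rewrite in_itv /= ltr_distl.
Qed.

(** The sigma-algebra is generated by the coordinates and not by the topology, so an open set has to
    be exhibited as a countable union of boxes with rational centers and radii 1/(k+1). *)
Lemma open_measurable_rV n (U : set 'rV[R]_n) : open U -> measurable U.
Proof.
move=> oU.
pose box (qk : 'rV[rat]_n * nat) := [set X : 'rV[R]_n |
  forall i, `|X ord0 i - (map_mx (@ratr R) qk.1) ord0 i| < qk.2.+1%:R^-1].
rewrite (_ : U = \bigcup_qk (if `[< box qk `<=` U >] then box qk else set0)).
  apply: countable_bigcupT_measurable; first exact: countableP.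
  by move=> qk; case: ifP => _ //; exact: measurable_box.
apply/seteqP; split=> [X UX|X [qk _]]; last first.
  by case: ifPn => // /asboolP; apply.
have /nbhs_normP[e /= e0 eU] : nbhs X U by exact: open_nbhs_nbhs.
have [k ke] : exists k : nat, k.+1%:R^-1 < e / 2.
  have : 0 < e / 2 by rewrite divr_gt0.
  by move=> /ltr_add_invr[k]; rewrite add0r => ?; exists k.
have k0 : 0 < k.+1%:R^-1 :> R by rewrite invr_gt0.
have /choice[q qX] : forall i : 'I_n, exists q : rat, `|X ord0 i - ratr q| < k.+1%:R^-1.
  move=> i; have [|q] := @rat_in_itvoo R (X ord0 i - k.+1%:R^-1) (X ord0 i + k.+1%:R^-1).
    by rewrite ltrD2l gtrN.
  by rewrite in_itv /= => qI; exists q; rewrite distrC ltr_distl.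
have qXb : box (\row_i q i, k) X by move=> i; rewrite !mxE.
exists (\row_i q i, k) => //; rewrite ifT //; apply/asboolP => Y Yb.
apply: eU; rewrite /ball_ /=.
have XY : `|X - Y| <= k.+1%:R^-1 + k.+1%:R^-1.
  apply/row_normP => [|j]; first by rewrite addr_ge0 // ltW.
  rewrite !mxE -(subrKA (ratr (q j))); apply: (le_trans (ler_normD _ _)).
  apply: lerD; first exact: ltW.
  by have := Yb j; rewrite !mxE distrC => /ltW.
by apply: le_lt_trans XY _; rewrite (splitr e); apply: ltrD.
Qed.

Lemma continuous_measurable_rV n (f : 'rV[R]_n -> R) : continuous f ->
  measurable_fun setT f.
Proof.
move=> /continuousP cf; apply: (measurability _ (RGenOInfty.measurableE R)).
move=> _ [_ [a ->] <-]; rewrite setTI; apply: open_measurable_rV; apply: cf.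
exact: interval_open.
Qed.

Definition cube n (r : R) : set 'rV[R]_n := [set X | forall i, `|X ord0 i| < r].

Lemma measurable_cube n r : measurable (@cube n r).
Proof.
by have := measurable_box (0 : 'rV[R]_n) r; congr measurable; apply/seteqP;
split => X /= Xr i; have := Xr i; rewrite mxE subr0.
Qed.

Lemma borel_lebesgue_cube n r : 0 <= r ->
  borel_lebesgue_rV n (@cube n r) = ((2 * r) ^+ n)%:E.
Proof.
move=> r0; elim: n => [|n IH].
  by rewrite /= diracE expr0 (_ : _ \in _) // inE /cube /= => -[].
rewrite /= /cons_measure /pushforward.
rewrite (_ : _ @^-1` _ = (`](- r), r[%classic : set (measurableTypeR R)) `*` @cube n r).
  rewrite product_measure1E //; last exact: measurable_cube.
  rewrite -[borel_lebesgue_rV n _]/(borel_lebesgue_rV n (cube r)) IH.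
  have lI : lebesgue_measure (`](- r), r[%classic : set (measurableTypeR R)) =
    if - r < r then (r - - r)%:E else 0%E by rewrite lebesgue_measure_itv.
  rewrite [X in (X * _)%E]lI.
  have [rr|] := ltP (- r) r; first by rewrite -EFinM exprS; congr (_%:E); ring.
  move=> rr; have -> : r = 0 by apply/eqP; rewrite eq_le r0 andbT; lra.
  by rewrite mul0e mulr0 expr0n.
apply/seteqP; split=> [[x y] /= xy|[x y] /= [xr yr] i].
  split; first by have := xy ord0; rewrite cons_rV0 /= in_itv /= ltr_norml.
  by move=> i; have := xy (lift ord0 i); rewrite cons_rVS.
case: (unliftP ord0 i) => [j|] ->; rewrite ?cons_rVS ?cons_rV0 //=.
by move: xr; rewrite in_itv /= ltr_norml.
Qed.

(** The identity typed as a map from the completed to the Borel space: passing between the two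
    measures becomes an instance of the measure-preserving lemmas. *)
Definition idL n (X : lebesgue_space R n) : 'rV[R]_n := X.

Lemma measurable_idL n : measurable_fun setT (@idL n).
Proof.
move=> _ A mA; rewrite setTI.
exact: (@caratheodory_measurable_mu_ext _ _ _ (@borel_lebesgue_rV R n) A mA).
Qed.

Lemma lebesgue_idL n (A : set 'rV[R]_n) : measurable A ->
  L n (@idL n @^-1` A) = borel_lebesgue_rV n A.
Proof. exact: measurable_mu_extE. Qed.

Lemma borel_measurable_lebesgue n d (T : measurableType d) (f : 'rV[R]_n -> T) :
  measurable_fun setT f -> measurable_fun setT (f : lebesgue_space R n -> T).
Proof. by move=> mf; exact: (measurableT_comp mf (@measurable_idL n)). Qed.

Lemma continuous_measurable_lebesgue n (f : 'rV[R]_n -> R) : continuous f ->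
  measurable_fun setT (f : lebesgue_space R n -> R).
Proof.
by move=> cf; apply: borel_measurable_lebesgue; exact: continuous_measurable_rV.
Qed.

Lemma cube_norm n r (X : 'rV[R]_n) : 0 < r -> cube r X -> `|X| < r.
Proof.
move=> r0 Xr; rewrite [X in X < _]mx_normrE; apply/bigmax_ltP; split => // -[i j] _ /=.
by rewrite (ord1 i).
Qed.

Lemma ae_eq0_continuous n (f : 'rV[R]_n -> R) : continuous f ->
  {ae L n, forall X, f X = 0} -> forall X, f X = 0.
Proof.
move=> cf [A [mA A0 fA]] X; apply: contrapT => /eqP fX.
have e0 : 0 < `|f X| / 2 by rewrite divr_gt0 // normr_gt0.
have /cont_normP /(_ _ e0)[r r0 rP] := cf X.
have : (L n (shift_rV (- X) @^-1` (@cube n r)) <= L n A)%E.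
  apply: le_mu_ext => Y Yc; apply: fA => /= fY.
  have := rP Y; rewrite fY sub0r normrN => H.
  suff /H : `|Y - X| < r by rewrite ler_pdivlMr // ger_pMr ?normr_gt0 // lern1.
  exact: cube_norm.
have LC : L n (@cube n r) = ((2 * r) ^+ n)%:E.
  apply: etrans (borel_lebesgue_cube n (ltW r0)).
  exact: (lebesgue_idL (@measurable_cube n r)).
rewrite A0 lebesgue_rV_shift LC.
by rewrite lee_fin leNgt exprn_gt0 // mulr_gt0.
Qed.

End translation.

(** * Borel representatives and slices *)

Section representative.
Context d (T : measurableType d) (R : realType).
Variable mu : {sigma_finite_measure set T -> \bar R}.
Local Open Scope ereal_scope.
Local Notation mus := (mu^*)%mu.

(** B is the intersection over k of the unions of covers whose total measure exceeds the outer
    measure of E by less than 1/(k+1). *)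
Lemma measurable_hull (E : set T) : mus E < +oo ->
  exists B, [/\ measurable B, E `<=` B & mu B = mus E].
Proof.
move=> Eoo.
have fE : mus E \is a fin_num by rewrite ge0_fin_numE //; exact: mu_ext_ge0.
have /choice[A AP] : forall k : nat, exists A : (set T)^nat,
    [/\ forall i, measurable (A i), E `<=` \bigcup_i A i &
    \sum_(0 <= i <oo) mu (A i) < mus E + k.+1%:R^-1%:E].
  move=> k; have k0 : (0 < k.+1%:R^-1 :> R)%R by rewrite invr_gt0.
  have := lb_ereal_inf_adherent k0 fE.
  by move=> [_/= [A [mA EA] <-] lt]; exists A.
have mA k : measurable (\bigcup_i A k i).
  by apply: bigcupT_measurable => i; have [] := AP k.
exists (\bigcap_k \bigcup_i A k i); split.
- exact: bigcapT_measurable.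
- by apply: sub_bigcap => k _; have [] := AP k.
apply/eqP; rewrite eq_le; apply/andP; split; last first.
  rewrite -measurable_mu_extE; last exact: bigcapT_measurable.
  by apply: le_mu_ext; apply: sub_bigcap => k _; have [] := AP k.
apply/lee_addgt0Pr => e e0.
have [k ke] : exists k : nat, (k.+1%:R^-1 < e)%R.
  by move: e0 => /ltr_add_invr[k]; rewrite add0r => ?; exists k.
have [mAk _ lt] := AP k.
apply: (@le_trans _ _ (mu (\bigcup_i A k i))).
  by apply: le_measure; rewrite ?inE //; [exact: bigcapT_measurable|exact: bigcap_inf].
apply: (@le_trans _ _ (\sum_(0 <= i <oo) mu (A k i))).
  exact: measure_sigma_subadditive.
by apply: (le_trans (ltW lt)); apply: leeD => //; rewrite lee_fin ltW.
Qed.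

(** On each piece D k of finite measure take the measurable hull B of E; then B minus E is null and
    has itself a null hull, outside of which B and E agree. The countably many exceptional sets are
    united. *)
Lemma caratheodory_representative (E : set T) : caratheodory_measurable mus E ->
  exists B Z, [/\ measurable B, measurable Z, mu Z = 0 & E `&` ~` Z = B `&` ~` Z].
Proof.
move=> mE; have [D DT mD] := sigma_finiteT mu.
have /choice[BZ BZP] : forall k : nat, exists BZ : set T * set T,
    [/\ measurable BZ.1, measurable BZ.2, mu BZ.2 = 0 &
    (E `&` D k) `&` ~` BZ.2 = BZ.1 `&` ~` BZ.2].
  move=> k; have [mDk Dkoo] := mD k.
  have mEk : caratheodory_measurable mus (E `&` D k).
    apply: caratheodory_measurable_setI => //.
    exact: caratheodory_measurable_mu_ext.
  have Ekoo : mus (E `&` D k) < +oo.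
    apply: (@le_lt_trans _ _ (mus (D k))); first by apply: le_mu_ext; exact: subIsetr.
    by rewrite measurable_mu_extE.
  have [B [mB EB muB]] := measurable_hull Ekoo.
  have fE : mus (E `&` D k) \is a fin_num.
    by rewrite ge0_fin_numE //; exact: mu_ext_ge0.
  (* Splitting B by the Caratheodory set and cancelling a finite value leaves a null excess. *)
  have BE0 : mus (B `&` ~` (E `&` D k)) = 0.
    have mBE : mus B = mus (E `&` D k) := etrans (measurable_mu_extE _ mB) muB.
    have := mEk B; rewrite (setIidr EB) mBE; move=> /(congr1 (fun x => x - mus (E `&` D k))).
    by rewrite subee // addeAC subee // add0e.
  have [|Z [mZ BEZ Z0]] := @measurable_hull (B `&` ~` (E `&` D k)).
    by rewrite BE0.
  exists (B, Z); split => //=; first by rewrite Z0.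
  apply/seteqP; split => [x [Ex Zx]|x [Bx Zx]]; first by split => //; exact: EB.
  by split => //; apply: contrapT => nE; apply: Zx; exact: BEZ.
exists (\bigcup_k (BZ k).1), (\bigcup_k (BZ k).2).
have mB k : measurable (BZ k).1 by have [] := BZP k.
have mZ k : measurable (BZ k).2 by have [] := BZP k.
split; [exact: bigcupT_measurable|exact: bigcupT_measurable| |].
  apply/negligibleP; first exact: bigcupT_measurable.
  by apply: negligible_bigcup => k; apply/negligibleP => //; have [] := BZP k.
have sub k x : ~ (\bigcup_k (BZ k).2) x -> (E `&` D k) x <-> (BZ k).1 x.
  move=> Zx; have nZ : ~ (BZ k).2 x by move=> ?; apply: Zx; exists k.
  have [_ _ _ /seteqP[H1 H2]] := BZP k.
  by split=> H; [have [] := H1 x|have [] := H2 x].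
apply/seteqP; split => [x [Ex Zx]|x [[k _ Bx] Zx]]; split => //.
  have : setT x by []. rewrite DT => -[k _ Dx]; exists k => //.
  by apply/(sub _ _ Zx).
by have /(sub _ _ Zx)[] := Bx.
Qed.

(** The superlevel sets at rational levels are replaced by measurable ones, off countably many null
    sets. A real level a follows as the union over the rationals above a. *)
Lemma completed_representative (f : T -> R) :
  measurable_fun setT (f : caratheodory_type mus -> R) ->
  exists Z, [/\ measurable Z, mu Z = 0 & measurable_fun (~` Z) f].
Proof.
move=> mf.
have /choice[BZ BZP] : forall q : rat, exists BZ : set T * set T,
    [/\ measurable BZ.1, measurable BZ.2, mu BZ.2 = 0 &
    [set x | ratr q < f x]%R `&` ~` BZ.2 = BZ.1 `&` ~` BZ.2].
  move=> q; have mq : caratheodory_measurable mus [set x | ratr q < f x]%R.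
    rewrite (_ : [set x | _] = f @^-1` `]ratr q, +oo[%classic); last first.
      by apply/seteqP; split => x /=; rewrite in_itv /= andbT.
    have := mf measurableT _ (measurable_itv (Interval (BRight (ratr q : R)) +oo%O)).
    by rewrite setTI.
  by have [B [Z BZ]] := caratheodory_representative mq; exists (B, Z).
have mB q : measurable (BZ q).1 by have [] := BZP q.
have mZ q : measurable (BZ q).2 by have [] := BZP q.
exists (\bigcup_q (BZ q).2); split.
- exact: bigcupT_measurable_rat.
- have [e eP] : exists e : nat -> option rat, forall q, exists k, e k = Some q.
    by exists unpickle => q; exists (pickle q); rewrite pickleK.
  apply/negligibleP; first exact: bigcupT_measurable_rat.
  apply: (@negligibleS _ _ _ _ (\bigcup_k (if e k is Some q then (BZ q).2 else set0))).
    by move=> x [q _ Zx]; have [k ek] := eP q; exists k => //; rewrite ek.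
  apply: negligible_bigcup => k; case: (e k) => [q|]; last exact: negligible_set0.
  by apply/negligibleP => //; have [] := BZP q.
move=> mnZ; apply: (measurability _ (RGenOInfty.measurableE R)) => //.
move=> _ [_ [a ->] <-].
rewrite (_ : _ `&` _ = \bigcup_(q : rat) (if (a < ratr q)%R
    then (BZ q).1 `&` ~` (\bigcup_q (BZ q).2) else set0)).
  apply: bigcupT_measurable_rat => q; case: ifP => // _.
  by apply: measurableI => //; apply: measurableC; exact: bigcupT_measurable_rat.
have sub q x : ~ (\bigcup_q (BZ q).2) x -> (ratr q < f x)%R <-> (BZ q).1 x.
  move=> Zx; have nZ : ~ (BZ q).2 x by move=> ?; apply: Zx; exists q.
  have [_ _ _ /seteqP[H1 H2]] := BZP q.
  by split=> H; [have [] := H1 x|have [] := H2 x].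
apply/seteqP; split=> [x [Zx] /=|x [q _]].
  rewrite in_itv /= andbT => /rat_in_itvoo[q]; rewrite in_itv /= => /andP[aq qf].
  by exists q => //; rewrite aq; split => //; exact/sub.
case: ifP => // aq [Bx Zx]; split => //=; rewrite in_itv /= andbT.
by apply: lt_trans aq _; exact/sub.
Qed.

End representative.

(** * Integrals of real-valued functions *)

Section real_integral.
Context d (T : measurableType d) (R : realType) (mu : {measure set T -> \bar R}).
Implicit Types f g : T -> R.
Local Notation Int f := (mu.-integrable setT (EFin \o f)).
Local Notation I f := (Rintegral mu setT f).

Lemma integrable_measurable f : Int f -> measurable_fun setT f.
Proof. by move=> /integrableP[mf _]; exact/measurable_EFinP. Qed.

Lemma integrable_ae_le f g : Int g -> measurable_fun setT f ->
  {ae mu, forall x, `|f x| <= g x} -> Int f.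
Proof.
move=> /integrableP[mg gi] mf fg; apply/integrableP; split; first exact/measurable_EFinP.
apply: le_lt_trans gi; apply: ae_ge0_le_integral => //.
- by apply: measurableT_comp => //; exact/measurable_EFinP.
- exact: measurableT_comp.
- by apply: filterS fg => x fgx _ /=; rewrite lee_fin (le_trans fgx) // ler_norm.
Qed.

Lemma integrable_add f g : Int f -> Int g -> Int (fun x => f x + g x).
Proof.
move=> fi gi; rewrite (_ : _ \o _ = (EFin \o f) \+ (EFin \o g))%E //.
exact: integrableD.
Qed.

Lemma integral_add f g : Int f -> Int g -> I (fun x => f x + g x) = I f + I g.
Proof. by move=> fi gi; exact: RintegralD. Qed.

Lemma integrable_scale f c : Int f -> Int (fun x => c * f x).
Proof.
move=> fi; rewrite (_ : _ \o _ = fun x => (c%:E * (EFin \o f) x)%E) //.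
exact: integrableZl.
Qed.

Lemma integral_scale f c : Int f -> I (fun x => c * f x) = c * I f.
Proof. by move=> fi; exact: RintegralZl. Qed.

Lemma integrable_sum_ord n (f : 'I_n -> T -> R) : (forall i, Int (f i)) ->
  Int (fun x => \sum_i f i x) /\ I (fun x => \sum_i f i x) = \sum_i I (f i).
Proof.
elim: n f => [|n IH] f fi.
  rewrite (_ : (fun x => _) = cst 0); last by apply/funext => x; rewrite big_ord0.
  split; first exact: integrable0.
  by rewrite Rintegral_cst // mul0r big_ord0.
rewrite (_ : (fun x => _) = (fun x => f ord0 x + \sum_i f (lift ord0 i) x)); last first.
  by apply/funext => x; rewrite big_ord_recl.
have [i1 i2] := IH (fun i => f (lift ord0 i)) (fun i => fi _).
by split; [exact: integrable_add|rewrite integral_add // i2 big_ord_recl].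
Qed.

Lemma integral_ae_eq_real f g : Int f -> measurable_fun setT g ->
  {ae mu, forall x, f x = g x} -> I f = I g.
Proof.
move=> /integrable_measurable mf mg fg; congr fine.
apply: ae_eq_integral => //; try exact/measurable_EFinP.
by apply: filterS fg => x /= -> _.
Qed.

Lemma integral_ae_ge0 f : Int f -> {ae mu, forall x, 0 <= f x} -> 0 <= I f.
Proof.
move=> fi f0; have mf := integrable_measurable fi.
rewrite (@integral_ae_eq_real f (fun x => `|f x|)) //.
- exact: Rintegral_ge0.
- exact: measurableT_comp.
- by apply: filterS f0 => x f0; rewrite ger0_norm.
Qed.

Lemma integral_ae_le f g : Int f -> Int g -> {ae mu, forall x, f x <= g x} ->
  I f <= I g.
Proof.
move=> fi gi fg.
have : 0 <= I (fun x => g x + -1 * f x).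
  apply: integral_ae_ge0; first by apply: integrable_add => //; exact: integrable_scale.
  by apply: filterS fg => x; rewrite mulN1r subr_ge0.
rewrite integral_add //; last exact: integrable_scale.
by rewrite integral_scale // mulN1r subr_ge0.
Qed.

Lemma integral_ae_eq0 f : Int f -> {ae mu, forall x, 0 <= f x} -> I f = 0 ->
  {ae mu, forall x, f x = 0}.
Proof.
move=> fi f0 If; have mf := integrable_measurable fi.
have : (\int[mu]_x `|(f x)%:E| = 0)%E.
  have H : I (fun x => `|f x|) = 0.
    rewrite -If; apply: integral_ae_eq_real => //.
    - rewrite (_ : _ \o _ = abse \o (EFin \o f)) //; exact: integrable_abse.
    - by apply: filterS f0 => x f0; rewrite ger0_norm.
  have := congr1 EFin H; rewrite /Rintegral fineK //.
  apply: integrable_fin_num => //.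
  rewrite (_ : (fun x => _) = abse \o (EFin \o f)) //; exact: integrable_abse.
move=> /(ae_eq_integral_abs mu measurableT ((measurable_EFinP _ _).2 mf)).
by apply: filterS => x /(_ Logic.I) /= -[].
Qed.

Lemma integral_dominated_cvg (f_ : nat -> T -> R) f g :
  (forall k, measurable_fun setT (f_ k)) -> measurable_fun setT f ->
  {ae mu, forall x, f_ ^~ x @ \oo --> f x} -> Int g ->
  {ae mu, forall x, forall k, `|f_ k x| <= g x} ->
  Int f /\ (fun k => I (f_ k)) @ \oo --> I f.
Proof.
move=> mf_ mf f_f gi fg.
have fki k : Int (f_ k).
  by apply: (integrable_ae_le gi) => //; apply: filterS fg => x.
have [||||fi _ cv] := @dominated_convergence _ T R mu setT measurableT
  (fun k => EFin \o f_ k) (EFin \o f) (EFin \o g) _ _ _ gi.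
- by move=> k; exact/measurable_EFinP.
- exact/measurable_EFinP.
- by apply: filterS f_f => x H _; apply/fine_cvgP; split => //; exact: nearW.
- by apply: filterS fg => x H k _; rewrite /= lee_fin.
split => //; have : (fun k => fine (\int[mu]_x (f_ k x)%:E)%E) @ \oo -->
    fine (\int[mu]_x (f x)%:E)%E; last by [].
apply: fine_cvg; rewrite fineK //; exact: integrable_fin_num.
Qed.

End real_integral.

Lemma integrable_ae_eq d (T : measurableType d) (R : realType)
    (mu : {measure set T -> \bar R}) (f g : T -> \bar R) :
  mu.-integrable setT f -> measurable_fun setT g -> ae_eq mu setT f g ->
  mu.-integrable setT g.
Proof.
move=> /integrableP[mf fi] mg fg; apply/integrableP; split => //.
rewrite (_ : (\int[mu]_x `|g x|)%E = (\int[mu]_x `|f x|)%E) //.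
apply: ae_eq_integral => //; [exact: measurableT_comp|exact: measurableT_comp|].
by apply: filterS fg => x fgx /fgx ->.
Qed.

Lemma integral_ae_eq d (T : measurableType d) (R : realType)
    (mu : {measure set T -> \bar R}) (f g : T -> \bar R) :
  mu.-integrable setT f -> measurable_fun setT g -> ae_eq mu setT f g ->
  (\int[mu]_x f x = \int[mu]_x g x)%E.
Proof. by move=> /integrableP[mf _] mg fg; exact: ae_eq_integral. Qed.

Section slices.
Context {R : realType}.
Local Open Scope ereal_scope.
Local Notation L n := (lebesgue_rV R n).
Local Notation B n := (@borel_lebesgue_rV R n).

Definition cat_rV m p (xy : 'rV[R]_m * 'rV[R]_p) : 'rV[R]_(m + p) := row_mx xy.1 xy.2.

Lemma measurable_cat_rV m p : measurable_fun setT (@cat_rV m p).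
Proof.
apply: measurable_fun_rVP => i; case: (split_ordP i) => j ->.
- rewrite (_ : (fun t => _) = (fun v : 'rV[R]_m => v ord0 j) \o fst).
    apply: (@measurableT_comp _ _ _ _ _ (measurableTypeR R)) => //.
    exact: measurable_coor.
  by apply/funext => t; rewrite /cat_rV row_mxEl.
- rewrite (_ : (fun t => _) = (fun v : 'rV[R]_p => v ord0 j) \o snd).
    apply: (@measurableT_comp _ _ _ _ _ (measurableTypeR R)) => //.
    exact: measurable_coor.
  by apply/funext => t; rewrite /cat_rV row_mxEr.
Qed.

Lemma cat_rV0 p (y : 'rV[R]_p) : @cat_rV 0 p (0%R, y) = y.
Proof.
apply/rowP => j.
rewrite (_ : @cat_rV 0 p _ ord0 j = (@cat_rV 0 p (0%R, y)) ord0 (rshift 0 j)).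
  by rewrite /cat_rV row_mxEr.
by congr (_ ord0 _); apply/val_inj.
Qed.

Lemma cons_cat_rV m p s (x : 'rV[R]_m) (y : 'rV[R]_p) :
  cons_rV (s, cat_rV (x, y)) = cat_rV (cons_rV (s, x), y).
Proof.
apply/rowP => j; case: (unliftP ord0 j) => [k|] ->.
  rewrite cons_rVS; case: (split_ordP k) => l ->.
    rewrite (_ : lift ord0 (lshift p l) = lshift p (lift ord0 l)); last exact/val_inj.
    transitivity (x ord0 l); first by rewrite [LHS]row_mxEl.
    by rewrite [RHS]row_mxEl cons_rVS.
  rewrite (_ : lift ord0 (rshift m l) = rshift m.+1 l); last exact/val_inj.
  transitivity (y ord0 l); first by rewrite [LHS]row_mxEr.
  by rewrite [RHS]row_mxEr.
rewrite cons_rV0 (_ : ord0 = lshift p (@ord0 m)); last exact/val_inj.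
by rewrite [RHS]row_mxEl cons_rV0.
Qed.

(** Induction on m: Tonelli peels off the first coordinate of x, and prepending a coordinate
    commutes with concatenation. *)
Lemma borel_lebesgue_cat m p (A : set 'rV[R]_(m + p)) : measurable A ->
  (B m \x B p) (@cat_rV m p @^-1` A) = B (m + p)%N A.
Proof.
elim: m A => [|m IH] A mA.
  rewrite /product_measure1 /= integral_dirac //=; last first.
    apply: measurable_fun_xsection; rewrite -[X in measurable X]setTI.
    exact: measurable_cat_rV.
  rewrite diracT mul1e; congr (borel_lebesgue_rV p _).
  by apply/seteqP; split => y; rewrite /xsection /= inE /= cat_rV0.
have mC : measurable (@cons_rV R (m + p) @^-1` A).
  by rewrite -[X in measurable X]setTI; exact: measurable_cons_rV.
have mcA : measurable (@cat_rV m.+1 p @^-1` A).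
  by rewrite -[X in measurable X]setTI; exact: measurable_cat_rV.
transitivity (\int[lebesgue_measure]_s
    (B m \x B p) (@cat_rV m p @^-1` xsection (@cons_rV R (m + p) @^-1` A) s)).
  pose h (x : 'rV[R]_m.+1) := B p (xsection (@cat_rV m.+1 p @^-1` A) x).
  rewrite -[LHS]/(\int[B m.+1]_x h x).
  have mh : measurable_fun setT h by exact: measurable_fun_xsection.
  rewrite -(@ge0_integral_preserving _ _ _ _ _
    (lebesgue_measure \x B m) (B m.+1) (@cons_rV R m)) //.
  - rewrite (@fubini_tonelli1 _ _ _ _ R lebesgue_measure (B m) _
      (measurableT_comp mh (@measurable_cons_rV R m)) (fun=> measure_ge0 _ _)).
    apply: eq_integral => s _; apply: eq_integral => x _; rewrite /h /=.
    have E y := cons_cat_rV s x y.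
    congr (B p _); apply/seteqP; split => y /xsectionP /= H; apply/xsectionP.
      by apply/xsectionP; rewrite /= E.
    by move/xsectionP : H; rewrite /= E.
  - exact: measurable_cons_rV.
by apply: eq_integral => s _; rewrite IH //; exact: measurable_xsection.
Qed.

(** q integrates the slices of a Borel representative g of f, and agrees with the slice integrals of
    f only for almost every x. Measurability of the slices of f is a hypothesis because Lebesgue
    measurability of f does not yield it. *)
Lemma fubini_slices m p (f : 'rV[R]_(m + p) -> R) :
  (L (m + p)).-integrable setT (EFin \o (f : lebesgue_space R _ -> R)) ->
  (forall x, measurable_fun setT (fun y : 'rV[R]_p => f (cat_rV (x, y)))) ->
  exists q : 'rV[R]_m -> \bar R, [/\ (B m).-integrable setT q,
    {ae B m, forall x, q x = \int[B p]_y (f (cat_rV (x, y)))%:E} &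
    \int[L (m + p)]_X (f X)%:E = \int[B m]_x q x].
Proof.
move=> fi fm.
have mf : measurable_fun setT (f : lebesgue_space R _ -> R).
  by apply/measurable_EFinP; have /integrableP[] := fi.
have [Z [mZ Z0 mfZ]] := completed_representative mf.
pose g := f \_ (~` Z).
have mg : measurable_fun setT g.
  by apply/(measurable_restrictT f) => //; exact: measurableC.
have mgL : measurable_fun setT (g : lebesgue_space R _ -> R).
  exact: borel_measurable_lebesgue.
have fg : ae_eq (L (m + p)) setT (EFin \o f) (EFin \o g).
  exists (@idL R (m + p) @^-1` Z); split.
  - by rewrite -[X in measurable X]setTI; exact: measurable_idL.
  - by apply: etrans Z0; exact: lebesgue_idL.
  - move=> X /= H; apply: contrapT => nZ; apply: H => _.
    by rewrite /g patchE mem_set.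
have giL : (L (m + p)).-integrable setT (EFin \o (g : lebesgue_space R _ -> R)).
  apply: (integrable_ae_eq fi _ fg); exact/measurable_EFinP.
have giB : (B (m + p)).-integrable setT (EFin \o g).
  apply: (integrable_preservingP (@measurable_idL R (m + p)) (@lebesgue_idL R (m + p))) => //.
  exact/measurable_EFinP.
have giP : (B m \x B p).-integrable setT (fun z => (EFin \o g) (cat_rV z)).
  exact: (integrable_preserving (@measurable_cat_rV m p) (@borel_lebesgue_cat m p)).
exists (fun x => \int[B p]_y (g (cat_rV (x, y)))%:E); split.
- exact: (integrable_fubini_F giP).
- have mC : measurable (@cat_rV m p @^-1` Z).
    by rewrite -[X in measurable X]setTI; exact: measurable_cat_rV.
  (* Tonelli for the null set Z: almost every slice of Z is null. *)
  have : ae_eq (B m) setT (B p \o xsection (@cat_rV m p @^-1` Z)) (cst 0).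
    apply/ae_eq_integral_abs => //; first exact: measurable_fun_xsection.
    under eq_integral do rewrite gee0_abs ?measure_ge0 //.
    by apply: etrans Z0; exact: borel_lebesgue_cat.
  apply: filterS => x /(_ Logic.I) /= x0.
  apply: ae_eq_integral => //.
  + apply/measurable_EFinP; apply: (measurableT_comp mg).
    by apply: (measurableT_comp (@measurable_cat_rV m p)); exact: pair1_measurable.
  + by apply/measurable_EFinP; exact: fm.
  + exists (xsection (@cat_rV m p @^-1` Z) x); split => //; first exact: measurable_xsection.
    move=> y /= H; apply/xsectionP; apply: contrapT => nZ; apply: H => _.
    by rewrite /g patchE mem_set.
- have -> : \int[L (m + p)]_X (f X)%:E = \int[L (m + p)]_X (g X)%:E.
    by apply: (integral_ae_eq fi _ fg); exact/measurable_EFinP.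
  rewrite (integral_preserving (@measurable_idL R (m + p)) (@lebesgue_idL R (m + p)) giB).
  rewrite -(integral_preserving (@measurable_cat_rV m p) (@borel_lebesgue_cat m p) giB).
  exact: (esym (integral12_prod_meas1 giP)).
Qed.

Lemma slices_ge0 m p (f : 'rV[R]_(m + p) -> R) :
  (L (m + p)).-integrable setT (EFin \o (f : lebesgue_space R _ -> R)) ->
  (forall x, measurable_fun setT (fun y : 'rV[R]_p => f (cat_rV (x, y)))) ->
  (forall x, 0 <= \int[B p]_y (f (cat_rV (x, y)))%:E) ->
  0 <= \int[L (m + p)]_X (f X)%:E /\ (\int[L (m + p)]_X (f X)%:E = 0 ->
    {ae B m, forall x, \int[B p]_y (f (cat_rV (x, y)))%:E = 0}).
Proof.
move=> fi fm f0; have [q [qi qE ->]] := fubini_slices fi fm.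
have mq : measurable_fun setT q by have /integrableP[] := qi.
have E : \int[B m]_x q x = \int[B m]_x `|q x|.
  apply: ae_eq_integral => //; first exact: measurableT_comp.
  by apply: filterS qE => x -> _; rewrite gee0_abs.
split; first by rewrite E; exact: integral_ge0.
rewrite E => /ae_eq_integral_abs -/(_ measurableT mq).
by apply: filterS2 qE => x -> /(_ Logic.I).
Qed.

End slices.

Section ae.
Context d (T : measurableType d) (R : realType) (mu : {measure set T -> \bar R}).
Implicit Types P Q S : T -> Prop.

Lemma ae_all P : (forall x, P x) -> {ae mu, forall x, P x}.
Proof. by move=> H; exact: aeW. Qed.

Lemma ae_sub P Q : (forall x, P x -> Q x) ->
  {ae mu, forall x, P x} -> {ae mu, forall x, Q x}.
Proof. by move=> PQ; exact: filterS. Qed.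

Lemma ae_sub2 P Q S : (forall x, P x -> Q x -> S x) ->
  {ae mu, forall x, P x} -> {ae mu, forall x, Q x} -> {ae mu, forall x, S x}.
Proof. by move=> PQ; exact: filterS2. Qed.

Lemma integrable_indic_scale (A : set T) (M : R) : measurable A -> (mu A < +oo)%E ->
  mu.-integrable setT (EFin \o (fun x => M * \1_A x)).
Proof.
move=> mA Aoo; apply: integrable_scale; apply/integrableP; split.
  by apply/measurable_EFinP.
under eq_integral do rewrite /= ger0_norm // ?indicE ?ler0n //.
by rewrite -[X in (X < _)%E]/(\int[mu]_x (\1_A x)%:E)%E integral_indic // setIT.
Qed.

End ae.

(** * Real Lebesgue integrals on R^n *)

Section lebesgue_real.
Context {R : realType}.
Implicit Types n : nat.

(* Lebesgue measurability, integrability, integral and almost everywhere on R^n;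
   hiding [lebesgue_space] keeps unification from unfolding its sigma-algebra. *)
Definition Lm n (f : 'rV[R]_n -> R) : Prop :=
  measurable_fun setT (f : lebesgue_space R n -> R).
Definition Li n (f : 'rV[R]_n -> R) : Prop :=
  (lebesgue_rV R n).-integrable setT (EFin \o (f : lebesgue_space R n -> R)).
Definition LI n (f : 'rV[R]_n -> R) : R :=
  Rintegral (lebesgue_rV R n) setT (f : lebesgue_space R n -> R).
Definition Lae n (P : 'rV[R]_n -> Prop) : Prop :=
  {ae lebesgue_rV R n, forall X, P X}.

Lemma LaeW n (P : 'rV[R]_n -> Prop) : (forall X, P X) -> Lae P.
Proof. exact: (@ae_all _ _ _ (lebesgue_rV R n) P). Qed.

Lemma LaeS n (P Q : 'rV[R]_n -> Prop) : (forall X, P X -> Q X) -> Lae P -> Lae Q.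
Proof. exact: (@ae_sub _ _ _ (lebesgue_rV R n) P Q). Qed.

Lemma LaeS2 n (P Q S : 'rV[R]_n -> Prop) :
  (forall X, P X -> Q X -> S X) -> Lae P -> Lae Q -> Lae S.
Proof. exact: (@ae_sub2 _ _ _ (lebesgue_rV R n) P Q S). Qed.

Lemma Lae_forall (I : finType) n (P : I -> 'rV[R]_n -> Prop) :
  (forall i, Lae (P i)) -> Lae (fun X => forall i, P i X).
Proof. by move=> Pi; exact: filter_forall. Qed.

Lemma Lae_countable n (P : nat -> 'rV[R]_n -> Prop) :
  (forall i, Lae (P i)) -> Lae (fun X => forall i, P i X).
Proof. exact: ae_foralln. Qed.

Lemma Lae_shift n (v : 'rV[R]_n) (P : 'rV[R]_n -> Prop) :
  Lae P -> Lae (fun X => P (X + v)).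
Proof.
move=> [A [mA A0 PA]]; exists (shiftL v @^-1` A); split.
- by rewrite -[X in measurable X]setTI; exact: measurable_shift_lebesgue.
- by rewrite -A0; exact: lebesgue_rV_shift.
- by move=> X /= nP; apply: PA.
Qed.

Lemma Lm_cont n (f : 'rV[R]_n -> R) : continuous f -> Lm f.
Proof. exact: continuous_measurable_lebesgue. Qed.

Lemma LmD n (f g : 'rV[R]_n -> R) : Lm f -> Lm g -> Lm (fun X => f X + g X).
Proof. exact: measurable_funD. Qed.

Lemma LmM n (f g : 'rV[R]_n -> R) : Lm f -> Lm g -> Lm (fun X => f X * g X).
Proof. exact: measurable_funM. Qed.

Lemma Lm_sum n k (f : 'I_k -> 'rV[R]_n -> R) : (forall i, Lm (f i)) ->
  Lm (fun X => \sum_i f i X).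
Proof. by move=> mf; exact: measurable_sum. Qed.

Lemma Lm_cst n (c : R) : Lm (fun _ : 'rV[R]_n => c).
Proof. exact: measurable_cst. Qed.

Lemma Lm_shift n (v : 'rV[R]_n) f : Lm f -> Lm (fun X => f (X + v)).
Proof. by move=> mf; exact: (measurableT_comp mf (measurable_shift_lebesgue v)). Qed.

Lemma Lm_cvg n (f_ : nat -> 'rV[R]_n -> R) f : (forall k, Lm (f_ k)) ->
  (forall X, f_ ^~ X @ \oo --> f X) -> Lm f.
Proof. by move=> mf cv; apply: (measurable_fun_cvg mf) => X _; exact: cv. Qed.

Lemma Li_Lm n (f : 'rV[R]_n -> R) : Li f -> Lm f.
Proof. exact: integrable_measurable. Qed.

Lemma Li_le n (f g : 'rV[R]_n -> R) : Li g -> Lm f ->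
  Lae (fun X => `|f X| <= g X) -> Li f.
Proof. exact: integrable_ae_le. Qed.

Lemma LiD n (f g : 'rV[R]_n -> R) : Li f -> Li g -> Li (fun X => f X + g X).
Proof. exact: integrable_add. Qed.

Lemma LID n (f g : 'rV[R]_n -> R) : Li f -> Li g ->
  LI (fun X => f X + g X) = LI f + LI g.
Proof. exact: integral_add. Qed.

Lemma LiZ n (f : 'rV[R]_n -> R) c : Li f -> Li (fun X => c * f X).
Proof. exact: integrable_scale. Qed.

Lemma LIZ n (f : 'rV[R]_n -> R) c : Li f -> LI (fun X => c * f X) = c * LI f.
Proof. exact: integral_scale. Qed.

Lemma LiB n (f g : 'rV[R]_n -> R) : Li f -> Li g -> Li (fun X => f X - g X).
Proof.
move=> fi gi; rewrite (_ : (fun X => _) = (fun X => f X + -1 * g X)).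
  by apply: LiD => //; exact: LiZ.
by apply/funext => X; rewrite mulN1r.
Qed.

Lemma LIB n (f g : 'rV[R]_n -> R) : Li f -> Li g ->
  LI (fun X => f X - g X) = LI f - LI g.
Proof.
move=> fi gi; rewrite (_ : (fun X => _) = (fun X => f X + -1 * g X)).
  by rewrite LID ?LIZ ?mulN1r //; exact: LiZ.
by apply/funext => X; rewrite mulN1r.
Qed.

Lemma Li_sum n k (f : 'I_k -> 'rV[R]_n -> R) : (forall i, Li (f i)) ->
  Li (fun X => \sum_i f i X).
Proof. by move=> fi; exact: (integrable_sum_ord fi).1. Qed.

Lemma LI_sum n k (f : 'I_k -> 'rV[R]_n -> R) : (forall i, Li (f i)) ->
  LI (fun X => \sum_i f i X) = \sum_i LI (f i).
Proof. by move=> fi; exact: (integrable_sum_ord fi).2. Qed.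

Lemma LI_ge0 n (f : 'rV[R]_n -> R) : Li f -> Lae (fun X => 0 <= f X) -> 0 <= LI f.
Proof. exact: integral_ae_ge0. Qed.

Lemma LI_le n (f g : 'rV[R]_n -> R) : Li f -> Li g ->
  Lae (fun X => f X <= g X) -> LI f <= LI g.
Proof. exact: integral_ae_le. Qed.

Lemma LI_eq0 n (f : 'rV[R]_n -> R) : Li f -> Lae (fun X => 0 <= f X) ->
  LI f = 0 -> Lae (fun X => f X = 0).
Proof. exact: integral_ae_eq0. Qed.

Lemma LI_dct n (f_ : nat -> 'rV[R]_n -> R) f g :
  (forall k, Lm (f_ k)) -> Lm f -> Lae (fun X => f_ ^~ X @ \oo --> f X) -> Li g ->
  Lae (fun X => forall k, `|f_ k X| <= g X) ->
  Li f /\ (fun k => LI (f_ k)) @ \oo --> LI f.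
Proof. exact: integral_dominated_cvg. Qed.

Lemma Li_shift n (v : 'rV[R]_n) f : Li f -> Li (fun X => f (X + v)).
Proof. exact: integrable_shift. Qed.

Lemma LI_shift n (v : 'rV[R]_n) f : Li f -> LI (fun X => f (X + v)) = LI f.
Proof. by move=> fi; congr fine; exact: (integral_shift v fi). Qed.

Lemma LI_EFin n (f : 'rV[R]_n -> R) : Li f ->
  (\int[lebesgue_rV R n]_X (f X)%:E = (LI f)%:E)%E.
Proof. by move=> fi; rewrite /LI /Rintegral fineK //; exact: integrable_fin_num. Qed.

Lemma cvg_const_eq (u : nat -> R) (a b : R) :
  (forall k, u k = a) -> u @ \oo --> b -> a = b.
Proof.
move=> ua; rewrite (_ : u = fun=> a); last exact/funext.
by move=> cv; apply: (cvg_unique (@norm_hausdorff _ R^o) _ cv); exact: cvg_cst.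
Qed.

Definition bsupp n (f : 'rV[R]_n -> R) := exists r : R, forall X, r < `|X| -> f X = 0.

Lemma Li_cube n (r M : R) : 0 <= r -> Li (fun X : 'rV[R]_n => M * \1_(@cube R n r) X).
Proof.
move=> r0; apply: integrable_indic_scale.
- by apply: caratheodory_measurable_mu_ext; exact: measurable_cube.
- have LC : lebesgue_rV R n (@cube R n r) = ((2 * r) ^+ n)%:E.
    apply: etrans (borel_lebesgue_cube n r0).
    exact: (lebesgue_idL (@measurable_cube R n r)).
  by rewrite LC ltry.
Qed.

Lemma norm_cube n (r : R) (X : 'rV[R]_n) : `|X| < r -> cube r X.
Proof. by move=> Xr i; apply: le_lt_trans Xr; exact: row_norm_coord. Qed.

Lemma dominated_cube n (r M : R) (X : 'rV[R]_n) (y : R) : 0 <= r ->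
  (`|X| <= r -> `|y| <= M) -> (r < `|X| -> y = 0) ->
  0 <= M -> `|y| <= M * \1_(@cube R n (r + 1)) X.
Proof.
move=> r0 H1 H2 M0; have [Xr|Xr] := leP `|X| r.
  rewrite indicE mem_set ?mulr1; first exact: H1.
  by apply: norm_cube; rewrite (le_lt_trans Xr) // ltrDl.
by rewrite H2 // normr0 mulr_ge0 // indicE ler0n.
Qed.

Lemma Li_bounded n (f : 'rV[R]_n -> R) (r M : R) : Lm f -> 0 <= M ->
  Lae (fun X => `|X| <= r -> `|f X| <= M) -> (forall X, r < `|X| -> f X = 0) -> Li f.
Proof.
move=> mf M0 fM fr; pose r' := Num.max r 0.
have r'0 : 0 <= r' by rewrite le_max lexx orbT.
apply: (@Li_le _ _ (fun X => M * \1_(@cube R n (r' + 1)) X)) => //.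
  by apply: Li_cube; rewrite addr_ge0.
apply: LaeS fM => X fX; apply: dominated_cube => //; last first.
  by rewrite gt_max => /andP[/fr].
move=> _; have [/fX //|/fr ->] := leP `|X| r; by rewrite normr0.
Qed.

Lemma Li_cont n (f : 'rV[R]_n -> R) : continuous f -> bsupp f -> Li f.
Proof.
move=> cf [r fr]; have [M M0 fM] := cont_bounded r cf.
apply: (@Li_bounded _ _ r M) => //; first exact: Lm_cont.
exact: LaeW.
Qed.

Lemma LiM_cont n (f g : 'rV[R]_n -> R) (r : R) : Li f -> continuous g ->
  (forall X, r < `|X| -> f X = 0) -> Li (fun X => f X * g X).
Proof.
move=> fi cg fr; have [M M0 gM] := cont_bounded r cg.
apply: (@Li_le _ _ (fun X => M * `|f X|)).
- by apply: LiZ; exact: integrable_norm.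
- by apply: LmM; [exact: Li_Lm|exact: Lm_cont].
- apply: LaeW => X; rewrite normrM mulrC; have [Xr|/fr ->] := leP `|X| r.
    by apply: ler_wpM2r => //; exact: gM.
  by rewrite normr0 !mulr0.
Qed.

(** A derivative as a limit along 1/(k+1), the form in which dominated convergence for sequences can
    be applied. *)
Lemma seq_derive (V : normedModType R) (f : V -> R) (X v : V) : derivable f X v ->
  (fun k : nat => k.+1%:R * (f (X + k.+1%:R^-1 *: v) - f X)) @ \oo --> 'D_v f X.
Proof.
move=> df; have H : h^-1 *: ((f \o shift X) (h *: v) - f X) @[h --> (0 : R)^'] --> 'D_v f X by exact: df.
have c0 : (fun k : nat => k.+1%:R^-1 : R) @ \oo --> (0 : R)^'.
  move=> A [e /= e0 Ae].
  suff : \forall k \near \oo, A (k.+1%:R^-1) by [].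
  near=> k.
  have k0 : k.+1%:R^-1 != 0 :> R by rewrite invr_neq0.
  apply: Ae => //=; rewrite sub0r normrN ger0_norm ?invr_ge0 //; near: k.
  exact: near_infty_natSinv_lt (PosNum e0).
have -> : (fun k : nat => k.+1%:R * (f (X + k.+1%:R^-1 *: v) - f X)) =
    (fun h : R => h^-1 *: ((f \o shift X) (h *: v) - f X)) \o (fun k : nat => k.+1%:R^-1).
  by apply/funext => k /=; rewrite invrK [X + _]addrC.
exact: (cvg_comp _ _ c0 H).
Unshelve. all: by end_near. Qed.

Lemma bsupp_partial n (f : 'rV[R]_n -> R) (r : R) (j : 'I_n) :
  (forall X, r < `|X| -> f X = 0) -> forall X, r < `|X| -> partial j f X = 0.
Proof.
move=> fr X Xr; apply: is_derive_partial.
apply: (@near_eq_is_derive _ _ _ (cst 0) f).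
have : \forall Y \near X, r < `|Y|.
  have := @norm_continuous _ 'rV[R]_n X.
  by move=> /(_ [set x | r < x]); apply; apply: open_nbhs_nbhs; split => //; exact: open_gt.
by apply: filterS => Y /fr ->.
Qed.

(** Difference quotients integrate to 0 by translation invariance, and they converge to the
    derivative under a common bound. *)
Lemma LI_partial0 n (f : 'rV[R]_n -> R) (j : 'I_n) :
  continuous f -> (forall X, derivable f X (delta_mx ord0 j)) ->
  continuous (partial j f) -> bsupp f -> LI (partial j f) = 0.
Proof.
move=> cf df cdf [r0 fr0]; pose r := Num.max r0 0.
have r_ge0 : 0 <= r by rewrite le_max lexx orbT.
have fr X : r < `|X| -> f X = 0 by rewrite gt_max => /andP[/fr0].
(* The quotients vanish beyond r + 1, and their mean value points lie within distance 1 of X, hence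
   within r + 2. *)
have [M M0 dfM] := cont_bounded (r + 2) cdf.
pose q (k : nat) X := k.+1%:R * (f (X + k.+1%:R^-1 *: delta_mx ord0 j) - f X).
have fi : Li f by apply: Li_cont => //; exists r.
have qi k : Li (q k) by apply: LiZ; apply: LiB => //; exact: Li_shift.
have q0 k : LI (q k) = 0.
  by rewrite LIZ ?LIB ?LI_shift ?subrr ?mulr0 //; [exact: Li_shift|apply: LiB => //; exact: Li_shift].
have k1 (k : nat) : k.+1%:R^-1 <= 1 :> R by rewrite invf_le1 // ler1n.
apply/esym/(cvg_const_eq q0).
apply: (@LI_dct _ _ _ (fun X => M * \1_(@cube R n (r + 1 + 1)) X) _ _ _ _ _).2 => //.
- by move=> k; exact: Li_Lm.
- exact: Lm_cont.
- by apply: LaeW => X; exact: seq_derive.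
- by apply: Li_cube; rewrite !addr_ge0.
apply: LaeW => X k; apply: dominated_cube => //; first by rewrite addr_ge0.
- move=> Xr; have [t tk E] := @line_MVT _ _ f X (delta_mx ord0 j) k.+1%:R^-1 (fun t => df _).
  rewrite /q E mulrA mulfV // mul1r; apply: dfM.
  apply: (le_trans (ler_normD _ _)); rewrite (_ : r + 2 = r + 1 + 1); last by ring.
  apply: lerD => //; apply: (le_trans (norm_e _ _)); apply: (le_trans tk).
  by rewrite ger0_norm ?invr_ge0.
- move=> Xr; rewrite /q !fr ?subrr ?mulr0 //; first by apply: lt_trans Xr; rewrite ltrDl.
  rewrite -(ltrD2r 1); apply: (lt_le_trans Xr).
  rewrite -{1}(addrK (k.+1%:R^-1 *: delta_mx ord0 j) X) addrC.
  apply: (le_trans (ler_normD _ _)); rewrite normrN addrC lerD2l.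
  by apply: (le_trans (norm_e _ _)); rewrite ger0_norm ?invr_ge0.
Qed.

End lebesgue_real.

(** * Test functions *)

Section flat.
Context {R : realType}.

(** The exponent a makes the family closed under differentiation up to linear combinations (see
    [is_derive_flat]), so that smoothness is one induction over all a. *)
Definition flat (a : nat) (t : R) : R :=
  if 0 < t then t ^- a * expR (- t^-1) else 0.

Lemma flat_ge0 a t : 0 <= flat a t.
Proof.
rewrite /flat; case: ifP => // t0.
by rewrite mulr_ge0 ?expR_ge0 // invr_ge0 exprn_ge0 // ltW.
Qed.

Lemma flat_gt0 a t : (0 < flat a t) = (0 < t).
Proof.
rewrite /flat; case: ifP => t0; last by rewrite ltxx.
by rewrite mulr_gt0 ?expR_gt0 // invr_gt0 exprn_gt0.
Qed.

(** Comes from exp s >= s^(a+2) / (a+2)! at s = 1/t. The square on the right makes the derivative at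
    0 vanish. *)
Lemma flat_le a t : flat a t <= (a.+2)`!%:R * t ^+ 2.
Proof.
rewrite /flat; case: ifP => t0; last by rewrite mulr_ge0 ?ler0n // sqr_ge0.
have s0 : 0 <= t^-1 by rewrite invr_ge0 ltW.
have f0 : 0 < (a.+2)`!%:R :> R by rewrite ltr0n fact_gt0.
have tn0 : t != 0 by rewrite gt_eqF.
have H : expR (- t^-1) <= (a.+2)`!%:R * t ^+ a.+2.
  rewrite expRN -[leRHS]invrK lef_pV2 ?posrE ?expR_gt0 //; last first.
    by rewrite invr_gt0 mulr_gt0 // exprn_gt0.
  apply: le_trans (expR_ge1Dxn a.+1 s0).
  by rewrite invfM -exprVn mulrC lerDr.
apply: (le_trans (ler_wpM2l _ H)); first by rewrite invr_ge0 exprn_ge0 // ltW.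
rewrite mulrCA ler_wpM2l ?ler0n // -(addn2 a) exprD mulrA mulVf ?mul1r //.
by rewrite expf_neq0.
Qed.

Lemma is_derive_quadratic (f : R -> R) (C : R) : f 0 = 0 ->
  (forall h, `|f h| <= C * h ^+ 2) -> is_derive (0 : R) 1 f 0.
Proof.
move=> f0 fC.
have H : h^-1 *: ((f \o shift 0) (h *: 1) - f 0) @[h --> (0 : R)^'] --> (0 : R).
  apply/cvgrPdist_le => e e0; near=> h.
  rewrite sub0r normrN /= f0 subr0 addr0 [h%:A]mulr1 [_ *: _]/(_ * _) normrM.
  have h0 : h != 0 by near: h; exact: nbhs_dnbhs_neq.
  rewrite normfV ler_pdivrMl ?normr_gt0 //; apply: (le_trans (fC h)).
  apply: (@le_trans _ _ ((`|C| + 1) * `|h| * `|h|)).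
    by rewrite -mulrA -expr2 real_normK ?num_real // ler_wpM2r ?sqr_ge0 // (le_trans (ler_norm C)) // lerDl.
  rewrite mulrC ler_wpM2l // -ler_pdivlMl ?ltr_wpDl //.
  near: h; apply: dnbhs0_le; by rewrite mulr_gt0 // invr_gt0 ltr_wpDl.
by split; [apply/cvg_ex; eexists; exact: H|exact/cvg_lim].
Unshelve. all: by end_near. Qed.

Lemma is_derive_flat a (t : R) :
  is_derive t 1 (flat a) (flat a.+2 t - a%:R * flat a.+1 t).
Proof.
have [t0|t0|->] := ltgtP t 0.
- have -> : flat a.+2 t - a%:R * flat a.+1 t = 0.
    by rewrite /flat ltNge (ltW t0) /= mulr0 subr0.
  apply: (@near_eq_is_derive _ _ _ (cst 0) (flat a)).
  near=> s; rewrite /flat ltNge (_ : s <= 0) //.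
  by apply: ltW; near: s; exact: lt_nbhsl.
- have -> : flat a.+2 t - a%:R * flat a.+1 t =
     (a%:R * (t^-1) ^+ a.-1 * expR (- t^-1) + (t^-1) ^+ a * (expR (- t^-1) * -1)) * (- t ^- 2).
    rewrite /flat t0; have tn0 : t != 0 by rewrite gt_eqF.
    by case: a => [|a]; rewrite ?mul0r -!exprVn /= !exprS ?expr0; ring.
  pose g (s : R) := s ^+ a * expR (- s).
  apply: (@near_eq_is_derive _ _ _ (fun s : R => g s^-1) (flat a)).
    near=> s; rewrite /flat /g exprVn ifT //.
    by near: s; exact: lt_nbhsr.
  apply: (@is_derive1_comp _ g (fun s => s^-1)); last first.
    have := @is_deriveV _ id t 1 1; rewrite /= => H.
    have tn0 : t != 0 by rewrite gt_eqF.
    by have := H tn0 _; rewrite [_ *: 1]mulr1; apply.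
  have dN : is_derive t^-1 1 (fun s : R => expR (- s)) (expR (- t^-1) * -1).
    exact: is_derive1_comp.
  have dX : is_derive t^-1 1 (fun s : R => s ^+ a) (a%:R * t^-1 ^+ a.-1).
    split; first exact: exprn_derivable.
    by rewrite exp_derive [_ *: 1]mulr1.
  have := is_deriveM dX dN; rewrite [_ *: _]/(_ * _) [X in _ + X]/(_ * _) => H.
  rewrite addrC mulrC in H.
  by apply: is_derive_eq; rewrite addrC mulrC [X in X + _]mulrC.
- have -> : flat a.+2 0 - a%:R * flat a.+1 0 = 0 by rewrite /flat ltxx mulr0 subr0.
  apply: (@is_derive_quadratic _ (a.+2)`!%:R) => [|h]; first by rewrite /flat ltxx.
  by rewrite ger0_norm ?flat_ge0 // flat_le.
Unshelve. all: by end_near. Qed.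

End flat.

Section smooth.
Context {R : realType}.
Implicit Types n k : nat.

Definition smooth n (f : 'rV[R]_n -> R) := forall k, Ck k setT f.

Lemma Ck_cont k n (f : 'rV[R]_n -> R) : Ck k setT f -> continuous f.
Proof. by case: k => [|k] [cf _] X; exact: cf. Qed.

Lemma CkS k n (f : 'rV[R]_n -> R) : Ck k.+1 setT f <-> C1 f /\ forall j, Ck k setT (partial j f).
Proof.
split=> [[cf df]|[Cf df]].
  split; last by move=> j; exact: (df j).2.
  split; first by move=> X; exact: cf.
  move=> j; split; first by move=> X; exact: (df j).1.
  exact: (Ck_cont (df j).2).
split; first by move=> X _; exact: Cf.1.
by move=> j; split=> // X _; exact: (Cf.2 j).1.
Qed.

Lemma Ck_le k n (f : 'rV[R]_n -> R) : Ck k.+1 setT f -> Ck k setT f.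
Proof.
elim: k f => [|k IH] f; first by move=> [cf _]; split.
by move=> /CkS[Cf df]; apply/CkS; split => // j; apply: IH; exact: df.
Qed.

Lemma CkD k n (f g : 'rV[R]_n -> R) : Ck k setT f -> Ck k setT g ->
  Ck k setT (fun X => f X + g X).
Proof.
elim: k f g => [|k IH] f g.
  by move=> /Ck_cont cf /Ck_cont cg; split => // X _; exact: contD.
move=> /CkS[Cf df] /CkS[Cg dg]; apply/CkS; split; first exact: C1D.
move=> j; rewrite (_ : partial j _ = fun X => partial j f X + partial j g X); first exact: IH.
by apply/funext => X; apply: is_derive_partial; apply: is_derive_add; exact: C1_is_derive.
Qed.

Lemma CkM k n (f g : 'rV[R]_n -> R) : Ck k setT f -> Ck k setT g ->
  Ck k setT (fun X => f X * g X).
Proof.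
elim: k f g => [|k IH] f g.
  by move=> /Ck_cont cf /Ck_cont cg; split => // X _; exact: contM.
move=> fk gk; have [Cf df] := (CkS _ _).1 fk; have [Cg dg] := (CkS _ _).1 gk.
apply/CkS; split; first exact: C1M.
move=> j; rewrite (_ : partial j _ = fun X => partial j f X * g X + f X * partial j g X).
  by apply: CkD; apply: IH => //; exact: Ck_le.
by apply/funext => X; apply: is_derive_partial; apply: is_derive_mul; exact: C1_is_derive.
Qed.

Lemma smooth_cst n (c : R) : smooth (fun _ : 'rV[R]_n => c).
Proof.
move=> k; elim: k c => [|k IH] c; first by split => // X _; exact: cst_continuous.
apply/CkS; split; first exact: C1_cst.
move=> j; rewrite (_ : partial j _ = fun=> 0) //; apply/funext => X.
by apply: is_derive_partial; exact: is_derive_cst.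
Qed.

Lemma smooth_coord n (i : 'I_n) : smooth (fun X : 'rV[R]_n => X ord0 i).
Proof.
case=> [|k]; first by split => // X _; exact: (C1_coord i).1.
apply/CkS; split; first exact: C1_coord.
move=> j; rewrite (_ : partial j _ = fun=> (i == j)%:R); first exact: smooth_cst.
by apply/funext => X; apply: is_derive_partial; exact: is_derive_coord.
Qed.

Lemma smooth_sum n m (f : 'I_m -> 'rV[R]_n -> R) : (forall i, smooth (f i)) ->
  smooth (fun X => \sum_i f i X).
Proof.
elim: m f => [|m IH] f sf k.
  rewrite (_ : (fun X => _) = fun=> 0); first exact: smooth_cst.
  by apply/funext => X; rewrite big_ord0.
rewrite (_ : (fun X => _) = fun X => f ord0 X + \sum_i f (lift ord0 i) X).
  by apply: CkD; [exact: sf|apply: IH => i; exact: sf].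
by apply/funext => X; rewrite big_ord_recl.
Qed.

Lemma smooth_flat n (q : 'rV[R]_n -> R) (a : nat) : smooth q -> smooth (fun X => flat a (q X)).
Proof.
move=> sq k; elim: k a => [|k IH] a.
  split => // X _; apply: (@cont_comp _ _ q (flat a)); first exact: (Ck_cont (sq 0)).
  move=> t; apply: differentiable_continuous; apply/derivable1_diffP.
  by have [] := is_derive_flat a t.
have Cq : C1 q := ((CkS _ _).1 (sq 1)).1.
apply/CkS; split.
  apply: (C1_comp1 Cq (is_derive_flat a)) => t.
  have cfl b : {for t, continuous (@flat R b)}.
    apply: differentiable_continuous; apply/derivable1_diffP.
    by have [] := is_derive_flat b t.
  apply: (@continuousB _ _ _ (@flat R a.+2) (fun t => a%:R * flat a.+1 t)); first exact: cfl.
  by apply: (@continuousM _ _ (fun=> a%:R) (@flat R a.+1)); [exact: cst_continuous|exact: cfl].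
move=> j; rewrite (_ : partial j _ = fun X => (flat a.+2 (q X) + - a%:R * flat a.+1 (q X)) * partial j q X).
  apply: CkM; last by have [_] := (CkS _ _).1 (sq k.+1); exact.
  by apply: CkD; [exact: IH|apply: CkM; [exact: smooth_cst|exact: IH]].
apply/funext => X; apply: is_derive_partial; rewrite mulNr.
by apply: is_derive_comp1; [exact: C1_is_derive|exact: is_derive_flat].
Qed.

Lemma smooth_C1 n (f : 'rV[R]_n -> R) : smooth f -> C1 f.
Proof. by move=> /(_ 1)/CkS[]. Qed.

Lemma smooth_partial n (f : 'rV[R]_n -> R) j : smooth f -> smooth (partial j f).
Proof. by move=> sf k; have /CkS[_] := sf k.+1; exact. Qed.

Lemma test_functionP n (f : 'rV[R]_n -> R) : test_function f <-> smooth f /\ bsupp f.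
Proof.
split=> -[sf].
  move=> /compact_bounded[M [_ MP]]; split => //; exists (M + 1) => X Xr.
  apply: contrapT => /eqP fX; have /= := MP (M + 1) _ X (@subset_closure _ [set X | f X != 0] X fX).
  by rewrite ltrDl ltr01 => /(_ isT); rewrite leNgt Xr.
move=> [r fr]; split => //.
have sub : closure [set X | f X != 0] `<=` [set X : 'rV[R]_n | `|X| <= r].
  have cl : closed [set X : 'rV[R]_n | `|X| <= r].
    rewrite (_ : [set X | _] = (fun X : 'rV[R]_n => `|X|) @^-1` [set x | x <= r]) //.
    by apply: closed_comp => [X _|]; [exact: norm_continuous|exact: closed_le].
  rewrite closureE; apply: bigcap_inf; split => // X /= fX.
  by rewrite leNgt; apply: contra fX => /fr ->.
apply: bounded_closed_compact; last exact: closed_closure.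
exists r; split; first exact: num_real.
by move=> x rx X /sub /= /le_trans; apply; exact: ltW.
Qed.

Definition sqnorm n (X : 'rV[R]_n) : R := dotv X X.

Lemma smooth_sqnorm n : smooth (@sqnorm n).
Proof. by apply: smooth_sum => j k; apply: CkM; exact: smooth_coord. Qed.

Lemma sqnorm_ge n (X : 'rV[R]_n) : `|X| ^+ 2 <= sqnorm X.
Proof.
have [->|X0] := eqVneq X 0.
  by rewrite normr0 expr0n /=; apply: sumr_ge0 => i _; rewrite -expr2 sqr_ge0.
have nX0 : mx_norm X != 0 by apply: contra_neq X0; exact: mx_norm_eq0.
have [[i j] /=] := mx_norm_neq0 nX0; rewrite (ord1 i) -[mx_norm X]/(`|X|) => ->.
rewrite real_normK ?num_real // /sqnorm /dotv (bigD1 j) //= -expr2 lerDl.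
by apply: sumr_ge0 => k _; rewrite -expr2 sqr_ge0.
Qed.

Lemma sqnorm_le n (X : 'rV[R]_n) : sqnorm X <= n%:R * `|X| ^+ 2.
Proof.
have -> : n%:R * `|X| ^+ 2 = \sum_(j < n) `|X| ^+ 2.
  by rewrite sumr_const card_ord mulr_natl.
apply: ler_sum => j _; rewrite -expr2 -real_normK ?num_real // ler_pXn2r ?nnegrE //.
exact: row_norm_coord.
Qed.

Definition bump n (r : R) (X : 'rV[R]_n) : R := flat 0 (r ^+ 2 - sqnorm X).

Lemma smooth_bump n r : smooth (@bump n r).
Proof.
apply: (@smooth_flat n (fun X => r ^+ 2 - sqnorm X) 0) => k.
rewrite (_ : (fun X => _) = fun X => r ^+ 2 + -1 * sqnorm X).
  apply: CkD; first exact: smooth_cst.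
  by apply: CkM; [exact: smooth_cst|exact: smooth_sqnorm].
by apply/funext => X; rewrite mulN1r.
Qed.

Lemma bump_supp n r (X : 'rV[R]_n) : 0 <= r -> r < `|X| -> bump r X = 0.
Proof.
move=> r0 Xr; rewrite /bump /flat ltNge (_ : _ <= 0) // subr_le0.
apply: le_trans (sqnorm_ge X).
by rewrite ler_pXn2r ?nnegrE // ltW.
Qed.

Lemma bump_gt0 n r (X : 'rV[R]_n) : 0 <= r -> n%:R * `|X| ^+ 2 < r ^+ 2 -> 0 < bump r X.
Proof.
move=> r0 Xr; rewrite /bump flat_gt0 subr_gt0.
exact: le_lt_trans (sqnorm_le X) Xr.
Qed.

Lemma bump_ge0 n r (X : 'rV[R]_n) : 0 <= bump r X.
Proof. exact: flat_ge0. Qed.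

Lemma test_bump n r : 0 <= r -> test_function (@bump n r).
Proof.
move=> r0; apply/test_functionP; split; first exact: smooth_bump.
by exists r => X; exact: bump_supp.
Qed.

End smooth.

(** * Mollification *)

Section mollifier.
Context {R : realType}.
Implicit Types n : nat.

Lemma is_derive_translate (V : normedModType R) (f : V -> R) (a X v : V) d :
  is_derive (X + a) v f d -> is_derive X v (fun Y => f (Y + a)) d.
Proof.
have E : (fun k : R => k^-1 *: (((fun Y => f (Y + a)) \o shift X) (k *: v) - f (X + a))) =
  (fun k : R => k^-1 *: ((f \o shift (X + a)) (k *: v) - f (X + a))).
  by apply/funext => k /=; rewrite addrA.
move=> [d1 d2]; split; first by rewrite /derivable E.
by rewrite /derive E.
Qed.

Lemma cont_translate n (f : 'rV[R]_n -> R) (a : 'rV[R]_n) : continuous f ->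
  continuous (fun Y : 'rV[R]_n => f (Y + a)).
Proof.
move=> cf X; apply/cont_normP => e e0.
have /cont_normP /(_ e e0)[d d0 dP] := cf (X + a); exists d => // Z ZX; apply: dP.
by rewrite (_ : Z + a - (X + a) = Z - X) //; apply/rowP => l; rewrite !mxE; ring.
Qed.

Lemma partial_translate n (f : 'rV[R]_n -> R) a j X : C1 f ->
  partial j (fun Y => f (Y + a)) X = partial j f (X + a).
Proof.
by move=> Cf; apply: is_derive_partial; apply: is_derive_translate; exact: C1_is_derive.
Qed.

Lemma C1_translate n (f : 'rV[R]_n -> R) a : C1 f -> C1 (fun Y => f (Y + a)).
Proof.
move=> Cf; apply: (@C1_intro _ _ _ (fun j X => partial j f (X + a))).
- exact: cont_translate Cf.1.
- by move=> j X; apply: is_derive_translate; exact: C1_is_derive.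
- by move=> j; apply: cont_translate; exact: (Cf.2 j).2.
Qed.

Lemma LI_abs_le n (f g : 'rV[R]_n -> R) : Li f -> Li g ->
  (forall X, `|f X| <= g X) -> `|LI f| <= LI g.
Proof.
move=> fi gi fg; rewrite ler_norml; apply/andP; split.
  rewrite -mulN1r -LIZ //; apply: LI_le => //; first exact: LiZ.
  by apply: LaeW => X; have := fg X; rewrite ler_norml mulN1r => /andP[].
by apply: LI_le => //; apply: LaeW => X; have := fg X; rewrite ler_norml => /andP[].
Qed.

Lemma lipschitz_cont n (f : 'rV[R]_n -> R) (M : R) :
  (forall (k : 'I_n) X, derivable f X (delta_mx ord0 k)) ->
  (forall (k : 'I_n) X, `|partial k f X| <= M) -> continuous f.
Proof.
move=> df fM X; apply/cont_normP => e e0.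
pose C := \sum_(k < n) `|M|.
have C0 : 0 <= C by apply: sumr_ge0.
exists (e / (C + 1)); first by rewrite divr_gt0 // ltr_wpDl.
move=> Z ZX; have [c [_ cE]] := @telescope_MVT _ _ f X (Z - X) (fun k _ => df k).
rewrite (_ : X + (Z - X) = Z) in cE; last by apply/rowP => l; rewrite !mxE; ring.
rewrite cE; apply: (le_trans (ler_norm_sum _ _ _)).
apply: (@le_trans _ _ (`|Z - X| * (C + 1))); last by rewrite -ler_pdivlMr ?ltr_wpDl // ltW.
apply: (@le_trans _ _ (`|Z - X| * C)); last by rewrite ler_wpM2l // lerDl.
rewrite /C mulr_sumr; apply: ler_sum => k _; rewrite normrM; apply: ler_pM => //.
  exact: row_norm_coord.
exact: le_trans (fM _ _) (ler_norm M).
Qed.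

Lemma bsupp_bounded n (f : 'rV[R]_n -> R) : continuous f -> bsupp f ->
  exists2 M : R, 0 <= M & forall X, `|f X| <= M.
Proof.
move=> cf [r fr]; have [M M0 fM] := cont_bounded r cf; exists M => // X.
by have [/fM //|/fr ->] := leP `|X| r; rewrite normr0.
Qed.

Lemma bsupp_Mr n (f g : 'rV[R]_n -> R) : bsupp f -> bsupp (fun X => f X * g X).
Proof. by move=> [r fr]; exists r => X /fr ->; rewrite mul0r. Qed.

Lemma bsupp_Ml n (f g : 'rV[R]_n -> R) : bsupp g -> bsupp (fun X => f X * g X).
Proof. by move=> [r fr]; exists r => X /fr ->; rewrite mulr0. Qed.

(** A correlation: the kernel takes Y - X, so it is a translate of rho in Y. This causes the minus
    sign in [is_derive_conv]. *)
Definition conv n (rho chi : 'rV[R]_n -> R) (X : 'rV[R]_n) : R :=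
  LI (fun Y => chi Y * rho (Y - X)).

Lemma Li_conv n (rho chi : 'rV[R]_n -> R) X : continuous chi -> bsupp chi ->
  continuous rho -> Li (fun Y => chi Y * rho (Y - X)).
Proof.
move=> cchi bchi crho; apply: Li_cont; last exact: bsupp_Mr.
by apply: contM => //; exact: cont_translate.
Qed.

Lemma is_derive_conv n (rho chi : 'rV[R]_n -> R) (j : 'I_n) X :
  continuous chi -> bsupp chi -> C1 rho -> bsupp rho ->
  is_derive X (delta_mx ord0 j) (conv rho chi) (- conv (partial j rho) chi X).
Proof.
move=> cchi bchi Crho brho; have [r rr] := brho.
have cdr : continuous (partial j rho) by exact: (Crho.2 j).2.
have [M M0 rM] := bsupp_bounded cdr (ex_intro _ r (bsupp_partial j rr)).
apply/is_derive_lineP.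
pose f (s : R) (Y : lebesgue_space R n) : R := chi Y * rho ((Y : 'rV[R]_n) - (X + s *: delta_mx ord0 j)).
have df (s : R) (Y : 'rV[R]_n) : is_derive s 1 (f^~ Y)
    (chi Y * (- partial j rho (Y - (X + s *: delta_mx ord0 j)))).
  have E : (fun s : R => rho (Y - (X + s *: delta_mx ord0 j))) =
      (fun t : R => rho ((Y - X) + t *: delta_mx ord0 j)) \o -%R.
    by apply/funext => t /=; congr rho; apply/rowP => l; rewrite !mxE; ring.
  have D : is_derive s 1 (fun s : R => rho (Y - (X + s *: delta_mx ord0 j)))
      (partial j rho (Y - (X + s *: delta_mx ord0 j)) * -1).
    rewrite E; apply: is_derive1_comp.
    rewrite (_ : Y - (X + s *: delta_mx ord0 j) = Y - X + (- s) *: delta_mx ord0 j); last first.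
      by apply/rowP => l; rewrite !mxE; ring.
    by apply: is_derive_line; exact: (Crho.2 j).1.
  rewrite -mulrN1; exact: (is_deriveZ (chi Y) D).
have intf s : (lebesgue_rV R n).-integrable setT (EFin \o f s).
  exact: (Li_conv (X + s *: delta_mx ord0 j) cchi bchi Crho.1).
have intG : (lebesgue_rV R n).-integrable setT
    (EFin \o (fun Y : lebesgue_space R n => M * `|chi Y|)).
  by apply: LiZ; apply: integrable_norm; exact: Li_cont.
have I0 : `](-1 : R), 1[%classic 0 by rewrite /= in_itv /= ltrN10 ltr01.
have G0 (Y : lebesgue_space R n) : 0 <= M * `|chi Y| by rewrite mulr_ge0.
have Gub (s : R) (Y : lebesgue_space R n) : `](-1 : R), 1[%classic s -> setT Y ->
    `|partial1of2 f s Y| <= M * `|chi Y|.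
  move=> _ _; rewrite /partial1of2 derive1E (@derive_val _ _ _ _ _ _ _ (df s Y)).
  by rewrite normrM normrN mulrC ler_wpM2r.
have der (s : R) (Y : lebesgue_space R n) : `](-1 : R), 1[%classic s -> setT Y ->
  derivable (f ^~ Y) s 1 by move=> _ _; have [] := df s Y.
have i1 (s : R) : `](-1 : R), 1[%classic s ->
  (lebesgue_rV R n).-integrable setT (EFin \o f s) by move=> _; exact: intf.
have H1 := @derivable_under_integral R _ _ (lebesgue_rV R n) f setT measurableT 0 (-1) 1
  I0 i1 der _ G0 intG Gub.
have H2 := @differentiation_under_integral R _ _ (lebesgue_rV R n) f setT measurableT 0 (-1) 1
  I0 i1 der _ G0 intG Gub.
split; first exact: H1.
apply: etrans (etrans (esym (derive1E _ _)) H2) _.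
rewrite /conv -mulN1r -LIZ; last exact: Li_conv.
congr (LI _); apply/funext => Y.
rewrite /partial1of2 derive1E (@derive_val _ _ _ _ _ _ _ (df 0 Y)) scale0r addr0.
by rewrite mulN1r mulrN.
Qed.

Lemma cont_conv n (rho chi : 'rV[R]_n -> R) :
  continuous chi -> bsupp chi -> C1 rho -> bsupp rho -> continuous (conv rho chi).
Proof.
move=> cchi bchi Crho brho; have [r rr] := brho.
have ichi : Li (fun Y => `|chi Y|) by apply: integrable_norm; exact: Li_cont.
have /choice[M MP] : forall j : 'I_n, exists M : R, forall X, `|partial j rho X| <= M.
  move=> j; have [M _ MP] := bsupp_bounded (Crho.2 j).2 (ex_intro _ r (bsupp_partial j rr)).
  by exists M.
apply: (@lipschitz_cont _ _ (\sum_j `|M j| * LI (fun Y => `|chi Y|))).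
  by move=> k X; have [] := is_derive_conv k X cchi bchi Crho brho.
move=> k X; rewrite (is_derive_partial (is_derive_conv k X cchi bchi Crho brho)) normrN.
have I0 : 0 <= LI (fun Y => `|chi Y|) by apply: LI_ge0 => //; exact: LaeW.
apply: (@le_trans _ _ (`|M k| * LI (fun Y => `|chi Y|))); last first.
  by rewrite (bigD1 k) //= lerDl; apply: sumr_ge0 => l _; rewrite mulr_ge0.
rewrite -LIZ //; apply: LI_abs_le; [exact: Li_conv (Crho.2 k).2|exact: LiZ|].
move=> Y; rewrite normrM mulrC ler_wpM2r //.
exact: le_trans (MP _ _) (ler_norm _).
Qed.

Lemma smooth_conv n (rho chi : 'rV[R]_n -> R) :
  continuous chi -> bsupp chi -> smooth rho -> bsupp rho -> smooth (conv rho chi).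
Proof.
move=> cchi bchi srho brho k; elim: k rho srho brho => [|k IH] rho srho brho.
  split => // X _; exact: (cont_conv cchi bchi (smooth_C1 srho) brho).
have D j X := is_derive_conv j X cchi bchi (smooth_C1 srho) brho.
have bp j : bsupp (partial j rho).
  by have [r rr] := brho; exists r; exact: bsupp_partial.
have sp j := smooth_partial j srho.
apply/CkS; split.
  apply: (C1_intro _ D).
    exact: cont_conv (smooth_C1 srho) brho.
  move=> j X; apply: (@continuousN _ _ _ (conv (partial j rho) chi)).
  exact: (cont_conv cchi bchi (smooth_C1 (sp j)) (bp j)).
move=> j; rewrite (_ : partial j _ = fun X => -1 * conv (partial j rho) chi X).
  by apply: CkM; [exact: smooth_cst|exact: IH].
by apply/funext => X; rewrite mulN1r; exact: is_derive_partial.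
Qed.

(** The derivative of chi Y * rho (Y - X) in Y integrates to 0, which moves the derivative onto chi.
    The sign then cancels that of [is_derive_conv], so that mollification commutes with
    derivatives. *)
Lemma conv_partial n (rho chi : 'rV[R]_n -> R) (j : 'I_n) X :
  C1 chi -> bsupp chi -> C1 rho ->
  conv (partial j rho) chi X = - conv rho (partial j chi) X.
Proof.
move=> Cchi bchi Crho.
have Cr := C1_translate (- X) Crho.
have bp : bsupp (partial j chi).
  by have [r rr] := bchi; exists r; exact: bsupp_partial.
have Cp : C1 (fun Y => chi Y * rho (Y - X)) by exact: C1M.
have := @LI_partial0 _ _ (fun Y => chi Y * rho (Y - X)) j Cp.1 (Cp.2 j).1 (Cp.2 j).2
  (bsupp_Mr _ bchi).
rewrite (_ : partial j _ = fun Y => partial j chi Y * rho (Y - X) + chi Y * partial j rho (Y - X)).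
  rewrite LID; [|exact: Li_conv (Cchi.2 j).2 bp Crho.1|exact: Li_conv Cchi.1 bchi (Crho.2 j).2].
  by rewrite -/(conv rho (partial j chi) X) -/(conv (partial j rho) chi X)
    addrC => /eqP; rewrite addr_eq0 => /eqP.
apply/funext => Y; apply: is_derive_partial; apply: is_derive_mul; first exact: C1_is_derive.
by apply: is_derive_translate; exact: C1_is_derive.
Qed.

Lemma partial_conv n (rho chi : 'rV[R]_n -> R) (j : 'I_n) X :
  C1 chi -> bsupp chi -> C1 rho -> bsupp rho ->
  partial j (conv rho chi) X = conv rho (partial j chi) X.
Proof.
move=> Cchi bchi Crho brho.
rewrite (is_derive_partial (is_derive_conv j X Cchi.1 bchi Crho brho)).
by rewrite conv_partial // opprK.
Qed.

Lemma LI0 n : LI (fun _ : 'rV[R]_n => 0) = 0.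
Proof. by rewrite /LI /Rintegral integral0. Qed.

Lemma conv_supp n (rho chi : 'rV[R]_n -> R) (r r' : R) :
  (forall X, r < `|X| -> chi X = 0) -> (forall X, r' < `|X| -> rho X = 0) ->
  forall X, r + r' < `|X| -> conv rho chi X = 0.
Proof.
move=> chir rhor X Xr; rewrite /conv -(LI0 n); congr (LI _); apply/funext => Y.
have [Yr|/chir ->] := leP `|Y| r; last by rewrite mul0r.
rewrite rhor ?mulr0 // -(ltrD2l r); apply: (lt_le_trans Xr).
have : `|Y + (X - Y)| <= `|Y| + `|X - Y| by exact: ler_normD.
rewrite (_ : Y + (X - Y) = X); last by apply/rowP => l; rewrite !mxE; ring.
by move=> /le_trans; apply; rewrite distrC lerD2r.
Qed.

Definition mollifier n (k : nat) (X : 'rV[R]_n) : R :=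
  (LI (@bump R n k.+1%:R^-1))^-1 * bump k.+1%:R^-1 X.

Lemma LI_bump_gt0 n (r : R) : 0 < r -> 0 < LI (@bump R n r).
Proof.
move=> r0; have /test_functionP[sb bb] := @test_bump R n r (ltW r0).
have ib : Li (@bump R n r) by apply: Li_cont => //; exact: (smooth_C1 sb).1.
rewrite lt_def LI_ge0 ?andbT //; last by apply: LaeW => X; exact: bump_ge0.
apply/eqP => b0; have := LI_eq0 ib (LaeW (@bump_ge0 R n r)) b0.
move=> /(ae_eq0_continuous (smooth_C1 sb).1)/(_ 0) H.
have := @bump_gt0 R n r 0 (ltW r0).
by rewrite H ltxx normr0 expr0n mulr0 exprn_gt0 // => /(_ isT).
Qed.

Lemma mollifierP n k : [/\ smooth (@mollifier n k),
  (forall X, k.+1%:R^-1 < `|X| -> @mollifier n k X = 0),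
  (forall X, 0 <= @mollifier n k X) & forall X, LI (fun Y => @mollifier n k (Y - X)) = 1].
Proof.
have k0 : 0 < k.+1%:R^-1 :> R by rewrite invr_gt0.
have /test_functionP[sb bb] := @test_bump R n _ (ltW k0).
have ib : Li (@bump R n k.+1%:R^-1) by apply: Li_cont => //; exact: (smooth_C1 sb).1.
have b0 := @LI_bump_gt0 n _ k0.
have sm : smooth (@mollifier n k) by move=> l; apply: CkM; [exact: smooth_cst|exact: sb].
split => // [X Xk|X|X].
- by rewrite /mollifier bump_supp ?mulr0 // ltW.
- by rewrite mulr_ge0 ?bump_ge0 // invr_ge0 ltW.
- rewrite (@LI_shift R n (- X) (@mollifier n k)); last exact: LiZ.
  by rewrite /mollifier LIZ // mulVf // gt_eqF.
Qed.

Lemma conv_mollifier_bound n k (chi : 'rV[R]_n -> R) (M : R) X :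
  continuous chi -> bsupp chi -> (forall Y, `|chi Y| <= M) ->
  `|conv (@mollifier n k) chi X| <= M.
Proof.
move=> cchi bchi chiM; have [sm mk m0 m1] := mollifierP n k.
have im : Li (fun Y => @mollifier n k (Y - X)).
  by apply: Li_shift; apply: Li_cont; [exact: (smooth_C1 sm).1|exists k.+1%:R^-1].
rewrite -[M]mulr1 -(m1 X) -LIZ //; apply: LI_abs_le.
- exact: Li_conv (smooth_C1 sm).1.
- exact: LiZ.
- by move=> Y; rewrite normrM (ger0_norm (m0 _)) ler_wpM2r.
Qed.

Lemma conv_mollifier_cvg n (chi : 'rV[R]_n -> R) X : continuous chi -> bsupp chi ->
  (fun k => conv (@mollifier n k) chi X) @ \oo --> chi X.
Proof.
move=> cchi bchi; apply/cvgrPdist_le => e e0.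
have /cont_normP /(_ _ e0)[d d0 dP] := cchi X.
near=> k; have [sm mk m0 m1] := mollifierP n k.
have im : Li (fun Y => @mollifier n k (Y - X)).
  by apply: Li_shift; apply: Li_cont; [exact: (smooth_C1 sm).1|exists k.+1%:R^-1].
have ic : Li (fun Y => chi Y * @mollifier n k (Y - X)).
  exact: Li_conv (smooth_C1 sm).1.
rewrite distrC -[chi X]mulr1 -(m1 X) -LIZ // -LIB //; last exact: LiZ.
rewrite -[e]mulr1 -(m1 X) -LIZ //; apply: LI_abs_le.
- by apply: LiB => //; exact: LiZ.
- exact: LiZ.
move=> Y; rewrite -mulrBl normrM (ger0_norm (m0 _)).
have [kY|kY] := leP `|Y - X| k.+1%:R^-1; last by rewrite mk ?mulr0.
rewrite ler_wpM2r //; apply: dP; apply: (le_lt_trans kY).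
by near: k; exact: near_infty_natSinv_lt (PosNum d0).
Unshelve. all: by end_near. Qed.

(** Provides what dominated convergence needs in [weak_div_C1]: test functions with a common
    support, one bound for all values and first derivatives, and pointwise convergence of both. *)
Lemma mollify n (chi : 'rV[R]_n -> R) (r : R) : C1 chi ->
  (forall X, r < `|X| -> chi X = 0) ->
  exists (c : nat -> 'rV[R]_n -> R) (M : R), 0 <= M /\ forall k,
    [/\ test_function (c k), (forall X, r + 1 < `|X| -> c k X = 0),
      (forall X, `|c k X| <= M), (forall j X, `|partial j (c k) X| <= M) &
      (forall X, c ^~ X @ \oo --> chi X) /\
      (forall j X, (fun k => partial j (c k) X) @ \oo --> partial j chi X)].
Proof.
move=> Cchi chir; have bchi : bsupp chi by exists r.
have bp j : bsupp (partial j chi) by exists r; exact: bsupp_partial.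
have [M0 M00 M0P] := bsupp_bounded Cchi.1 bchi.
have /choice[M MP] : forall j : 'I_n, exists M : R, 0 <= M /\ forall X, `|partial j chi X| <= M.
  by move=> j; have [M ? ?] := bsupp_bounded (Cchi.2 j).2 (bp j); exists M.
have sM0 : 0 <= \sum_j M j by apply: sumr_ge0 => j _; exact: (MP j).1.
exists (fun k => conv (@mollifier n k) chi), (M0 + \sum_j M j).
split; first by rewrite addr_ge0.
move=> k; have [sm mk m0 m1] := mollifierP n k.
have bm : bsupp (@mollifier n k) by exists k.+1%:R^-1.
have pc j l X : partial j (conv (@mollifier n l) chi) X = conv (@mollifier n l) (partial j chi) X.
  have [sm' mk' _ _] := mollifierP n l.
  by apply: partial_conv => //; [exact: smooth_C1|exists l.+1%:R^-1].
have sup X : r + 1 < `|X| -> conv (@mollifier n k) chi X = 0.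
  apply: conv_supp => // Y Yk; apply: mk; apply: le_lt_trans Yk.
  by rewrite invf_le1 // ler1n.
split => //.
- apply/test_functionP; split; last by exists (r + 1).
  by apply: smooth_conv => //; exact: Cchi.1.
- move=> X; apply: (@le_trans _ _ M0); last by rewrite lerDl.
  by apply: conv_mollifier_bound => //; exact: Cchi.1.
- move=> j X; rewrite pc; apply: (@le_trans _ _ (M j)).
    by apply: conv_mollifier_bound => //; [exact: (Cchi.2 j).2|exact: (MP j).2].
  rewrite (bigD1 j) //= addrCA lerDl addr_ge0 //.
  by apply: sumr_ge0 => i _; exact: (MP i).1.
- split => [X|j X]; first by apply: conv_mollifier_cvg => //; exact: Cchi.1.
  rewrite (_ : (fun k => _) = fun k => conv (@mollifier n k) (partial j chi) X).
    by apply: conv_mollifier_cvg => //; exact: (Cchi.2 j).2.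
  by apply/funext => l; rewrite pc.
Qed.

End mollifier.

(** * Quadratic forms *)

Section quadratic_forms.
Context {R : realType}.
Implicit Types n : nat.

Lemma dotvC n (v w : 'rV[R]_n) : dotv v w = dotv w v.
Proof. by apply: eq_bigr => j _; rewrite mulrC. Qed.

Lemma dotvDl n (v1 v2 w : 'rV[R]_n) : dotv (v1 + v2) w = dotv v1 w + dotv v2 w.
Proof. by rewrite -big_split; apply: eq_bigr => j _; rewrite mxE mulrDl. Qed.

Lemma dotvZl n (v w : 'rV[R]_n) c : dotv (c *: v) w = c * dotv v w.
Proof. by rewrite mulr_sumr; apply: eq_bigr => j _; rewrite mxE mulrA. Qed.

Lemma dotvDr n (v1 v2 w : 'rV[R]_n) : dotv w (v1 + v2) = dotv w v1 + dotv w v2.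
Proof. by rewrite dotvC dotvDl !(dotvC w). Qed.

Lemma dotvZr n (v w : 'rV[R]_n) c : dotv w (c *: v) = c * dotv w v.
Proof. by rewrite dotvC dotvZl dotvC. Qed.

Lemma dotv_ge0 n (v : 'rV[R]_n) : 0 <= dotv v v.
Proof. by apply: sumr_ge0 => j _; rewrite -expr2 sqr_ge0. Qed.

Lemma dotv_eq0 n (v : 'rV[R]_n) : dotv v v = 0 -> v = 0.
Proof.
move=> v0; apply/eqP; rewrite -normr_eq0; apply/eqP.
have := sqnorm_ge v; rewrite /sqnorm v0 => H.
by apply/eqP; rewrite -sqrf_eq0 eq_le H sqr_ge0.
Qed.

Lemma dotv_gt0 n (v : 'rV[R]_n) : v != 0 -> 0 < dotv v v.
Proof.
by move=> v0; rewrite lt_def dotv_ge0 andbT; apply: contra v0 => /eqP/dotv_eq0 ->.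
Qed.

Lemma dotv_mxE n (v w : 'rV[R]_n) : dotv v w = (v *m w^T) ord0 ord0.
Proof. by rewrite mxE; apply: eq_bigr => j _; rewrite mxE. Qed.

Lemma dotv_sym n (M : 'M[R]_n) (v w : 'rV[R]_n) : M^T = M ->
  dotv (v *m M) w = dotv (w *m M) v.
Proof.
move=> MT; rewrite !dotv_mxE.
transitivity ((v *m M *m w^T)^T ord0 ord0); first by rewrite [RHS]mxE.
by rewrite !trmx_mul trmxK MT mulmxA.
Qed.

Definition quad n (M : 'M[R]_n) (v w : 'rV[R]_n) := dotv (v *m M) w.

Lemma quadDl n (M : 'M[R]_n) v1 v2 w : quad M (v1 + v2) w = quad M v1 w + quad M v2 w.
Proof. by rewrite /quad mulmxDl dotvDl. Qed.

Lemma quadZl n (M : 'M[R]_n) c v w : quad M (c *: v) w = c * quad M v w.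
Proof. by rewrite /quad -scalemxAl dotvZl. Qed.

Lemma quadDr n (M : 'M[R]_n) v1 v2 w : quad M w (v1 + v2) = quad M w v1 + quad M w v2.
Proof. exact: dotvDr. Qed.

Lemma quadZr n (M : 'M[R]_n) c v w : quad M w (c *: v) = c * quad M w v.
Proof. exact: dotvZr. Qed.

Lemma quad_young n (M : 'M[R]_n) (v w : 'rV[R]_n) (d : R) : M^T = M ->
  (forall z, 0 <= quad M z z) -> 0 < d ->
  - (2 * quad M v w) <= d^-1 * quad M v v + d * quad M w w.
Proof.
move=> MT M0 d0; have := M0 (v + d *: w).
rewrite quadDl !quadDr !quadZl !quadZr (_ : quad M w v = quad M v w) => [H|]; last exact: dotv_sym.
have dn0 : d != 0 by rewrite gt_eqF.
rewrite -subr_ge0 (_ : _ - _ = d^-1 * (quad M v v + d * quad M v w + (d * quad M v w + d * (d * quad M w w)))).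
  by rewrite mulr_ge0 // invr_ge0 ltW.
by field.
Qed.

Lemma continuous_quad n (M : 'M[R]_n) : continuous (fun v => quad M v v).
Proof.
apply: cont_sum => j; apply: contM; last exact: coord_continuous.
rewrite (_ : (fun Y : 'rV_n => (Y *m M) ord0 j) = fun Y => \sum_i Y ord0 i * M i j).
  by apply: cont_sum => i; apply: contM; [exact: coord_continuous|exact: cst_continuous].
by apply/funext => Y; rewrite mxE.
Qed.

(** The maximum l of the form on the unit sphere, attained at some c by compactness, is an
    eigenvalue. It also bounds every eigenvalue, so the supremum is taken over a bounded set and
    dominates l. *)
Lemma quad_le_max_eigenvalue n (M : 'M[R]_n) (v : 'rV[R]_n) : M^T = M ->
  quad M v v <= max_eigenvalue M * dotv v v.
Proof.
move=> MT; have [->|v0] := eqVneq v 0.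
  by rewrite /quad mul0mx /dotv !big1 ?mulr0 // => j _; rewrite !mxE mul0r.
have normalize (w : 'rV[R]_n) : w != 0 -> dotv ((Num.sqrt (dotv w w))^-1 *: w)
    ((Num.sqrt (dotv w w))^-1 *: w) = 1.
  move=> w0; rewrite dotvZl dotvZr mulrA -expr2 exprVn sqr_sqrtr ?dotv_ge0 //.
  by rewrite mulVf // gt_eqF // dotv_gt0.
pose S := [set w : 'rV[R]_n | dotv w w = 1].
have cdot : continuous (fun w : 'rV[R]_n => dotv w w).
  by apply: cont_sum => j; apply: contM; exact: coord_continuous.
have cS : compact S.
  apply: bounded_closed_compact.
    exists 1; split; first exact: num_real.
    move=> x x1 w /= w1; apply: le_trans (ltW x1).
    by rewrite -(ler_pXn2r (ltn0Sn 1)) ?nnegrE // expr1n -w1; exact: sqnorm_ge.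
  rewrite (_ : S = (fun w : 'rV[R]_n => dotv w w) @^-1` [set 1]) //.
  by apply: closed_comp => [X _|]; [exact: cdot|exact: closed_eq].
have [||c] := @EVT_max_rV R n (fun w => quad M w w) S _ cS.
- by exists ((Num.sqrt (dotv v v))^-1 *: v); exact: normalize.
- by apply: continuous_subspaceT; exact: continuous_quad.
rewrite inE /= => c1 cmax; pose l := quad M c c.
have le w : quad M w w <= l * dotv w w.
  have [->|w0] := eqVneq w 0.
    by rewrite /quad mul0mx /dotv !big1 ?mulr0 // => j _; rewrite !mxE mul0r.
  have := cmax ((Num.sqrt (dotv w w))^-1 *: w); rewrite inE => /(_ (normalize w w0)).
  rewrite quadZl quadZr mulrA -expr2 exprVn sqr_sqrtr ?dotv_ge0 //.
  by rewrite mulrC ler_pdivrMr // dotv_gt0.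
have eig : c *m M = l *: c.
  (* The residual must vanish: along c + s w the quantity l |.|^2 - M(., .) equals 2 s b + s^2 q,
     and s = - b / (q + 1) would make it negative, against [le]. The + 1 covers q = 0. *)
  pose w := l *: c - c *m M.
  have wE z : dotv w z = l * dotv c z - quad M c z.
    by rewrite /w dotvDl dotvZl -scaleN1r dotvZl mulN1r.
  pose q := l * dotv w w - quad M w w.
  have q0 : 0 <= q by rewrite subr_ge0.
  pose b := dotv w w.
  have bE : b = l * dotv c w - quad M c w by exact: wE.
  suff b0 : b = 0.
    by have /eqP := dotv_eq0 b0; rewrite /w subr_eq0 => /eqP.
  apply: contrapT => /eqP b0; have := le (c + (- b / (q + 1)) *: w).
  rewrite -subr_ge0 quadDl !quadDr !quadZl !quadZr dotvDl !dotvDr !dotvZl !dotvZr.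
  rewrite (dotvC w c) (_ : quad M w c = quad M c w); last exact: dotv_sym.
  rewrite c1 -/l => H.
  have q1 : q + 1 != 0 by rewrite gt_eqF // ltr_wpDl.
  have E : l * (1 + - b / (q + 1) * dotv c w +
      (- b / (q + 1) * dotv c w + - b / (q + 1) * (- b / (q + 1) * dotv w w))) -
      (l + - b / (q + 1) * quad M c w + (- b / (q + 1) * quad M c w +
        - b / (q + 1) * (- b / (q + 1) * quad M w w))) =
      - (b ^+ 2 * ((q + 1)^-1) ^+ 2 * (q + 2)).
    transitivity (2 * (- b / (q + 1)) * (l * dotv c w - quad M c w) +
       (- b / (q + 1)) ^+ 2 * (l * dotv w w - quad M w w)); first by ring.
    by rewrite -bE -/q; field.
  move: H; rewrite E oppr_ge0 leNgt mulr_gt0 //; last by rewrite ltr_wpDl.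
  by rewrite mulr_gt0 // exprn_even_gt0 //= invr_neq0.
have c0 : c != 0.
  apply/eqP => c0; move: c1; rewrite /S /= c0 /dotv big1; first by move=> /esym/eqP; rewrite oner_eq0.
  by move=> j _; rewrite mxE mul0r.
apply: (le_trans (le v)); rewrite ler_wpM2r ?dotv_ge0 //.
apply: ub_le_sup; last by apply/eigenvalueP; exists c.
exists l => k /eigenvalueP[w wk w0]; have := le w.
by rewrite /quad wk dotvZl ler_pM2r // dotv_gt0.
Qed.

End quadratic_forms.

(** * Continuous cutoffs and local integrability *)

Section directional_extra.
Context {R : realType}.

Lemma is_derive_opp_dir (V : normedModType R) (f : V -> R) (X v : V) d :
  is_derive X v f d -> is_derive X (- v) f (- d).
Proof.
move=> /is_derive_lineP H; apply/is_derive_lineP.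
rewrite (_ : (fun s : R => f (X + s *: - v)) = (fun s : R => f (X + s *: v)) \o -%R); last first.
  by apply/funext => s /=; rewrite scalerN scaleNr.
rewrite -mulrN1; apply: is_derive1_comp; rewrite oppr0; exact: H.
Qed.

Lemma cont_max (V : normedModType R) (f g : V -> R) : continuous f -> continuous g ->
  continuous (fun X => Num.max (f X) (g X)).
Proof.
move=> cf cg.
rewrite (_ : (fun X => _) = fun X => (f X + g X + `|f X + -1 * g X|) * 2^-1); last first.
  by apply/funext => X; rewrite maxr_absE mulN1r.
have cN : continuous (fun X => f X + -1 * g X).
  by apply: contD => //; apply: contM => // X; exact: cst_continuous.
apply: contM; last by move=> X; exact: cst_continuous.
apply: contD; first exact: contD.
by move=> X; apply: (@continuous_comp _ _ _ (fun X => f X + -1 * g X) Num.norm); [exact: cN|exact: norm_continuous].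
Qed.

(** The clamp of r + 1 - |X| to [0, 1]. Continuity is all that local integrability asks of a
    cutoff. *)
Definition plateau n (r : R) (X : 'rV[R]_n) : R := 1 - Num.max 0 (1 - Num.max 0 (r + 1 - `|X|)).

Lemma continuous_plateau n r : continuous (@plateau n r).
Proof.
have cB (g : 'rV[R]_n -> R) (c : R) : continuous g -> continuous (fun X => c - g X).
  by move=> cg X; apply: (@continuousB _ _ _ (fun=> c)); [exact: cst_continuous|exact: cg].
apply: (cB _ 1); apply: cont_max; first by move=> X; exact: cst_continuous.
apply: (cB _ 1); apply: cont_max; first by move=> X; exact: cst_continuous.
by apply: cB => X; exact: norm_continuous.
Qed.

Lemma plateau1 n r (X : 'rV[R]_n) : `|X| <= r -> plateau r X = 1.
Proof.
move=> Xr; rewrite /plateau; have H : 1 <= r + 1 - `|X| by rewrite lerBrDr addrC lerD2r.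
by rewrite (max_r (le_trans ler01 H)) max_l ?subr0 // subr_le0.
Qed.

Lemma plateau0 n r (X : 'rV[R]_n) : r + 1 < `|X| -> plateau r X = 0.
Proof.
move=> Xr; rewrite /plateau (max_l (y := _ - `|X|)) ?subr_le0 ?ltW //.
by rewrite subr0 max_r // subrr.
Qed.

Lemma plateau_ge0 n r (X : 'rV[R]_n) : 0 <= plateau r X.
Proof.
by rewrite /plateau subr_ge0 ge_max ler01 /= lerBlDr lerDl le_max lexx.
Qed.

(** Local integrability, phrased as pairing with continuous functions of bounded support because it
    is always used under a cutoff. *)
Definition Lloc n (f : 'rV[R]_n -> R) := forall h, continuous h -> bsupp h ->
  Li (fun X => f X * h X).

Lemma Lloc_Lm n (f : 'rV[R]_n -> R) : Lloc f -> Lm f.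
Proof.
move=> fl; apply: (@Lm_cvg _ _ (fun k X => f X * plateau k%:R X)).
  move=> k; apply: Li_Lm; apply: fl; first exact: continuous_plateau.
  by exists (k%:R + 1) => X; exact: plateau0.
move=> X; apply: cvg_near_cst; near=> k; rewrite plateau1 ?mulr1 //.
by near: k; exact: nbhs_infty_ger.
Unshelve. all: by end_near. Qed.

Lemma Lloc_M n (f g : 'rV[R]_n -> R) : Lloc f -> continuous g -> Lloc (fun X => f X * g X).
Proof.
move=> fl cg h ch bh; rewrite (_ : (fun X => _) = fun X => f X * (g X * h X)).
  by apply: fl; [exact: contM|exact: bsupp_Ml].
by apply/funext => X; rewrite mulrA.
Qed.

Lemma Lloc_sum n k (f : 'I_k -> 'rV[R]_n -> R) : (forall i, Lloc (f i)) ->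
  Lloc (fun X => \sum_i f i X).
Proof.
move=> fl h ch bh; rewrite (_ : (fun X => _) = fun X => \sum_i f i X * h X).
  by apply: Li_sum => i; exact: fl.
by apply/funext => X; rewrite mulr_suml.
Qed.

Lemma Lloc_bounded n (f : 'rV[R]_n -> R) : Lm f ->
  (forall r : R, exists2 M : R, 0 <= M & Lae (fun X => `|X| <= r -> `|f X| <= M)) -> Lloc f.
Proof.
move=> mf fb h ch [r hr]; have [M M0 fM] := fb r; have [K K0 hK] := cont_bounded r ch.
apply: (@Li_bounded _ _ _ r (M * K)); first by apply: LmM => //; exact: Lm_cont.
- by rewrite mulr_ge0.
- apply: LaeS fM => X fX Xr; rewrite normrM; apply: ler_pM => //; [exact: fX|exact: hK].
- by move=> X /hr ->; rewrite mulr0.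
Qed.

(** One positive function eta per ball is enough: f h = (f eta) (h / eta) where h lives. The
    denominator D equals eta on that ball and is positive everywhere, so that h / D is
    continuous. *)
Lemma Lloc_test n (f : 'rV[R]_n -> R) :
  (forall r : R, 0 <= r -> exists (eta : 'rV[R]_n -> R) , [/\ continuous eta,
     (forall X, `|X| <= r -> 0 < eta X), (forall X, 0 <= eta X), bsupp eta & Li (fun X => f X * eta X)]) ->
  Lloc f.
Proof.
move=> fe h ch [r0 hr0]; pose r := Num.max r0 0.
have r_ge0 : 0 <= r by rewrite le_max lexx orbT.
have hr X : r < `|X| -> h X = 0 by rewrite gt_max => /andP[/hr0].
have [eta [ce ep e0 [r' er'] ei]] := fe r r_ge0.
pose D X := eta X + Num.max 0 (`|X| - r).
have D0 X : D X != 0.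
  rewrite gt_eqF // /D; have [Xr|Xr] := leP `|X| r.
    by rewrite ltr_pwDl ?ep // le_max lexx.
  by rewrite ltr_wpDl // lt_max subr_gt0 Xr orbT.
have cD : continuous D.
  apply: contD => //; apply: cont_max => X; first exact: cst_continuous.
  by apply: (@continuousB _ _ _ (fun X : 'rV[R]_n => `|X|)); [exact: norm_continuous|exact: cst_continuous].
rewrite (_ : (fun X => _) = fun X => (f X * eta X) * (h X * (D X)^-1)).
  apply: (@LiM_cont _ _ _ _ r') => //; first by apply: contM => //; exact: contV.
  by move=> X /er' ->; rewrite mulr0.
apply/funext => X; have [Xr|Xr] := leP `|X| r; last by rewrite hr // mul0r !mulr0.
have := D0 X; rewrite /D max_l ?subr_le0 // addr0 => eX.
by field.
Qed.

Lemma bump_locally_pos n (r : R) : 0 <= r -> exists2 rho, 0 <= rho &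
  forall X : 'rV[R]_n, `|X| <= r -> 0 < bump rho X.
Proof.
(* The sup-norm ball of radius r lies in the Euclidean ball of radius sqrt n * r, hence strictly
   inside that of radius n * r + 1. *)
move=> r0; exists (n%:R * r + 1); first by rewrite addr_ge0 // mulr_ge0.
move=> X Xr; apply: bump_gt0; first by rewrite addr_ge0 // mulr_ge0.
apply: (@le_lt_trans _ _ (n%:R * r ^+ 2)).
  by rewrite ler_wpM2l // ler_pXn2r ?nnegrE.
have nn : n%:R <= n%:R ^+ 2 :> R.
  by rewrite -natrX ler_nat; case: n {X Xr} => // n; rewrite expnS expn1 leq_pmulr.
have : 0 <= n%:R * r by rewrite mulr_ge0.
have : n%:R * r ^+ 2 <= (n%:R * r) ^+ 2 by rewrite exprMn ler_wpM2r // sqr_ge0.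
set c := n%:R * r; rewrite -/c; nra.
Qed.

End directional_extra.

(** * Equations in divergence form *)

Section divergence_form.
Context {R : realType}.
Implicit Types n : nat.

Lemma Li_norm n (f : 'rV[R]_n -> R) : Li f -> Li (fun X => `|f X|).
Proof. exact: integrable_norm. Qed.

Lemma Lloc_norm n (f : 'rV[R]_n -> R) : Lloc f -> Lloc (fun X => `|f X|).
Proof.
move=> fl h ch bh; have H := Li_norm (fl h ch bh); apply: (Li_le H).
  apply: LmM; last exact: Lm_cont.
  by have := Lloc_Lm fl; exact: measurableT_comp.
by apply: LaeW => X; rewrite !normrM normr_id.
Qed.

Lemma cvg_sum_ord k (f : 'I_k -> nat -> R) (l : 'I_k -> R) :
  (forall i, f i @ \oo --> l i) -> (fun j => \sum_i f i j) @ \oo --> \sum_i l i.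
Proof.
elim: k f l => [|k IH] f l fl.
  rewrite (_ : (fun j => _) = fun=> 0) ?big_ord0; first exact: cvg_cst.
  by apply/funext => j; rewrite big_ord0.
rewrite (_ : (fun j => _) = fun j => f ord0 j + \sum_i f (lift ord0 i) j).
  by rewrite big_ord_recl; apply: cvgD; [exact: fl|apply: (IH (fun i => f (lift ord0 i))) => i; exact: fl].
by apply/funext => j; rewrite big_ord_recl.
Qed.

(* [- div V = G] in the sense of distributions. *)
Definition weak_div n (V : 'I_n -> 'rV[R]_n -> R) (G : 'rV[R]_n -> R) : Prop :=
  forall psi : 'rV[R]_n -> R, test_function psi ->
  [/\ Li (fun X => \sum_l V l X * partial l psi X), Li (fun X => G X * psi X) &
    LI (fun X => \sum_l V l X * partial l psi X) = LI (fun X => G X * psi X)].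

Lemma weak_div_Lloc_rhs n (V : 'I_n -> 'rV[R]_n -> R) (G : 'rV[R]_n -> R) :
  weak_div V G -> Lloc G.
Proof.
move=> W; apply: Lloc_test => r r0; have [rho rho0 bp] := bump_locally_pos n r0.
have [_ Gb _] := W _ (test_bump _ rho0).
exists (bump rho); split => //; first exact: (Ck_cont (smooth_bump n rho 0)).
- exact: bump_ge0.
- by exists rho => X; exact: bump_supp.
Qed.

(** The weak form asserts integrability only of the whole sum over l. Testing with x_l times a bump,
    and subtracting x_l times the pairing with the bump, isolates V_l times the bump. *)
Lemma weak_div_Lloc_field n (V : 'I_n -> 'rV[R]_n -> R) (G : 'rV[R]_n -> R) l :
  weak_div V G -> Lloc (V l).
Proof.
move=> W; apply: Lloc_test => r r0; have [rho rho0 bp] := bump_locally_pos n r0.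
have cb : continuous (@bump R n rho) by exact: (Ck_cont (smooth_bump n rho 0)).
exists (bump rho); split => //; first exact: bump_ge0.
  by exists rho => X; exact: bump_supp.
have tx : test_function (fun X : 'rV[R]_n => X ord0 l * bump rho X).
  apply/test_functionP; split.
    by move=> k; apply: CkM; [exact: smooth_coord|exact: smooth_bump].
  by exists rho => X Xr; rewrite bump_supp // mulr0.
have [H1 _ _] := W _ tx; have [H2 _ _] := W _ (test_bump n rho0).
have supp X : rho < `|X| -> \sum_j V j X * partial j (bump rho) X = 0.
  move=> Xr; apply: big1 => j _; rewrite (@bsupp_partial _ _ (bump rho) rho j) ?mulr0 //.
  by move=> Y; exact: bump_supp.
have cx : continuous (fun X : 'rV[R]_n => X ord0 l) by exact: (C1_coord l).1.
have := LiB H1 (LiM_cont H2 cx supp); congr Li; apply/funext => X.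
rewrite mulr_suml -sumrB (bigD1 l) //= [X in _ + X]big1 ?addr0 => [|j jl].
  rewrite (is_derive_partial (is_derive_mul (is_derive_coord l l X)
    (C1_is_derive X l (smooth_C1 (smooth_bump n rho))))) eqxx.
  by rewrite mul1r; ring.
rewrite (is_derive_partial (is_derive_mul (is_derive_coord l j X)
    (C1_is_derive X j (smooth_C1 (smooth_bump n rho))))) eq_sym (negbTE jl).
by rewrite mul0r; ring.
Qed.

(** The test functions of the main argument are built from first derivatives of C^2 functions and
    are only C^1; mollification extends the equation to them. *)
Lemma weak_div_C1 n (V : 'I_n -> 'rV[R]_n -> R) (G chi : 'rV[R]_n -> R) :
  weak_div V G -> C1 chi -> bsupp chi ->
  [/\ Li (fun X => \sum_l V l X * partial l chi X), Li (fun X => G X * chi X) &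
    LI (fun X => \sum_l V l X * partial l chi X) = LI (fun X => G X * chi X)].
Proof.
move=> W Cc [r cr]; have [c [M [M0 Hc]]] := mollify Cc cr.
have Vl l : Lloc (V l) by exact: weak_div_Lloc_field W.
have Gl : Lloc G by exact: weak_div_Lloc_rhs W.
have cp := @continuous_plateau R n (r + 1).
have bp : bsupp (@plateau R n (r + 1)) by exists (r + 1 + 1) => X; exact: plateau0.
have LV l : Lm (V l) by exact: Lloc_Lm.
have LG : Lm G by exact: Lloc_Lm.
have dom (y z : R) X : `|z| <= M -> (r + 1 < `|X| -> z = 0) ->
    `|y * z| <= M * (`|y| * plateau (r + 1) X).
  move=> zM z0; have [Xr|Xr] := leP `|X| (r + 1).
    by rewrite plateau1 // mulr1 normrM mulrC ler_wpM2r.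
  by rewrite z0 // mulr0 normr0 !mulr_ge0 // plateau_ge0.
have c0 k j X : r + 1 < `|X| -> partial j (c k) X = 0.
  by have [_ c0 _ _ _] := Hc k; exact: bsupp_partial.
have [H1 H2] : Li (fun X => \sum_l V l X * partial l chi X) /\
  (fun k => LI (fun X => \sum_l V l X * partial l (c k) X)) @ \oo -->
    LI (fun X => \sum_l V l X * partial l chi X).
  apply: (@LI_dct _ _ _ _ (fun X => \sum_l M * (`|V l X| * plateau (r + 1) X))).
  - move=> k; have [tc _ _ _ _] := Hc k; apply: Lm_sum => l; apply: LmM => //.
    by apply: Lm_cont; move/test_functionP: tc => [/smooth_C1 [_ /(_ l) []]].
  - by apply: Lm_sum => l; apply: LmM => //; apply: Lm_cont; exact: (Cc.2 l).2.
  - apply: LaeW => X; apply: (cvg_sum_ord (f := fun l k => V l X * partial l (c k) X)) => l; apply: cvgM; first exact: cvg_cst.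
    by have [_ _ _ _ [_ H]] := Hc 0%N; exact: H.
  - by apply: Li_sum => l; apply: LiZ; exact: Lloc_norm.
  apply: LaeW => X k; apply: (le_trans (ler_norm_sum _ _ _)); apply: ler_sum => l _.
  by apply: dom; [have [_ _ _ H _] := Hc k; exact: H|exact: c0].
have [H3 H4] : Li (fun X => G X * chi X) /\
  (fun k => LI (fun X => G X * c k X)) @ \oo --> LI (fun X => G X * chi X).
  apply: (@LI_dct _ _ _ _ (fun X => M * (`|G X| * plateau (r + 1) X))).
  - move=> k; have [tc _ _ _ _] := Hc k; apply: LmM => //.
    by apply: Lm_cont; move/test_functionP: tc => [/smooth_C1 []].
  - by apply: LmM => //; apply: Lm_cont; exact: Cc.1.
  - apply: LaeW => X; apply: cvgM; first exact: cvg_cst.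
    by have [_ _ _ _ [H _]] := Hc 0%N; exact: H.
  - by apply: LiZ; exact: Lloc_norm.
  apply: LaeW => X k.
  by apply: dom; [have [_ _ H _ _] := Hc k; exact: H|have [_ H _ _ _] := Hc k; exact: H].
split => //; rewrite -(cvg_lim (@Rhausdorff R) H2) -(cvg_lim (@Rhausdorff R) H4).
by congr (lim (_ @ \oo)); apply/funext => k; have [tc _ _ _ _] := Hc k; have [_ _] := W _ tc.
Qed.

(* The bound holds at all rational translates of almost every point. *)
Lemma ae_bound_along n (f : 'rV[R]_n -> R) (e : 'rV[R]_n) :
  (forall X, continuous (fun t : R => f (X + t *: e))) -> `|e| <= 1 ->
  (forall r : R, exists2 M : R, 0 <= M & Lae (fun X => `|X| <= r -> `|f X| <= M)) ->
  forall r : R, exists2 M : R, 0 <= M & Lae (fun X => `|X| <= r -> forall t : R, `|t| <= 1 ->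
    `|f (X + t *: e)| <= M).
Proof.
(* The rational parameter is taken within 1 of t, so its modulus is at most 2 and the translated
   point stays within r + 2. *)
move=> cf e1 fb r; have [M M0 fM] := fb (r + 2); exists M => //.
pose q k : R := if unpickle k is Some s then @ratr R s else 0.
have H := Lae_countable (fun k => Lae_shift (q k *: e) fM).
apply: LaeS H => X HX Xr t t1; rewrite leNgt; apply/negP => fX.
have /cont_normP /(_ ((`|f (X + t *: e)| - M) / 2)) := cf X t.
rewrite divr_gt0 ?subr_gt0 // => /(_ isT) [d d0 fd].
have : t < t + Num.min d 1 by rewrite ltrDl lt_min d0 ltr01.
move=> /rat_in_itvoo [s]; rewrite in_itv /= => /andP[ts].
rewrite -ltrBlDl lt_min => /andP[sd s1].
have st : `|ratr s - t| = ratr s - t by rewrite ger0_norm // subr_ge0 ltW.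
have := HX (pickle s); rewrite /q pickleK.
have -> : `|X + ratr s *: e| <= r + 2.
  apply: (le_trans (ler_normD _ _)); apply: lerD => //.
  rewrite normrZ; apply: (@le_trans _ _ (2 * 1)); last by rewrite mulr1.
  apply: ler_pM => //; rewrite -[X in `|X|](subrK t); apply: (le_trans (ler_normD _ _)).
  rewrite st (natrD _ 1 1); apply: lerD => //; exact: ltW.
move=> /(_ isT) fs; have := fd (ratr s); rewrite st => /(_ sd).
have := ler_normB (f (X + ratr s *: e)) (f (X + ratr s *: e) - f (X + t *: e)).
rewrite opprB addrC subrK; lra.
Qed.

Lemma invr_seq_bound (j : nat) : [/\ 0 < j.+1%:R^-1 :> R, j.+1%:R^-1 <= 1 :> R,
  `|j.+1%:R^-1 : R| <= 1 & j.+1%:R * j.+1%:R^-1 = 1 :> R].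
Proof.
have H : 0 < j.+1%:R^-1 :> R by rewrite invr_gt0 ltr0Sn.
have H1 : j.+1%:R^-1 <= 1 :> R by rewrite invf_le1 ?ltr0Sn // ler1n.
by split=> //; [rewrite ger0_norm // ltW|rewrite mulfV ?pnatr_eq0].
Qed.

Lemma quotient_bound (V : normedModType R) (f : V -> R) (X v : V) (M : R) (j : nat) :
  (forall Y, derivable f Y v) ->
  (forall t : R, `|t| <= 1 -> `|'D_v f (X + t *: v)| <= M) ->
  `|j.+1%:R * (f (X + j.+1%:R^-1 *: v) - f X)| <= M.
Proof.
move=> df fM; have [h0 h1 hn hj] := invr_seq_bound j.
have [t th ->] := @line_MVT R V f X v j.+1%:R^-1 (fun t => df _).
by rewrite mulrA hj mul1r; apply: fM; exact: (le_trans th).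
Qed.

Lemma LIZB n (f g : 'rV[R]_n -> R) c : Li f -> Li g ->
  LI (fun X => c * (f X - g X)) = c * (LI f - LI g).
Proof. by move=> fi gi; rewrite -LIB // -LIZ //; exact: LiB. Qed.

(** V is differentiable in the single direction k, and G is merely locally integrable, so on the
    right the derivative stays on chi. The bound on D is required along a whole segment through
    almost every X, because quotients are estimated at mean value points. *)
Lemma weak_div_partial n (V : 'I_n -> 'rV[R]_n -> R) (G : 'rV[R]_n -> R)
    (D : 'I_n -> 'rV[R]_n -> R) (k : 'I_n) (chi : 'rV[R]_n -> R) :
  weak_div V G ->
  (forall l X, is_derive X (delta_mx ord0 k) (V l) (D l X)) ->
  (forall l (r : R), exists2 M : R, 0 <= M & Lae (fun X => `|X| <= r ->
     forall t : R, `|t| <= 1 -> `|D l (X + t *: delta_mx ord0 k)| <= M)) ->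
  C1 chi -> bsupp chi ->
  [/\ Li (fun X => \sum_l D l X * partial l chi X), Li (fun X => G X * partial k chi X) &
    LI (fun X => \sum_l D l X * partial l chi X) = - LI (fun X => G X * partial k chi X)].
Proof.
set e := delta_mx ord0 k; move=> W VD DM Cc [r cr].
pose h (j : nat) : R := j.+1%:R^-1.
pose chij (j : nat) (X : 'rV[R]_n) := chi (X + h j *: - e).
have e1 : `|e| <= 1 by have := @norm_e R n 1 k; rewrite scale1r normr1.
have Cj j : C1 (chij j) by exact: C1_translate.
have bj j X : r + 1 < `|X| -> chij j X = 0.
  move=> Xr; apply: cr; have [h0 h1 hn hj] := invr_seq_bound j.
  have : `|X| <= `|X + h j *: - e| + `|h j *: e|.
    by rewrite -{1}[X](addrK (h j *: - e)) (le_trans (ler_normB _ _)) // scalerN normrN.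
  have : `|h j *: e| <= 1 by rewrite normrZ mulr_ile1.
  by lra.
have dV l X : derivable (V l) X e by have [] := VD l X.
have eD l X : 'D_e (V l) X = D l X by have [_ ->] := VD l X.
have LV l : Lm (V l) by exact: Lloc_Lm (weak_div_Lloc_field l W).
have Gl : Lloc G by exact: weak_div_Lloc_rhs W.
have [i0 i1 E0] := weak_div_C1 W Cc (ex_intro _ r cr).
(* Test with chi and with its translate, shift the variable back, subtract and divide by the step:
   the difference quotient falls on V on the left and on chi on the right. *)
have Eq j : LI (fun X => \sum_l (j.+1%:R * (V l (X + h j *: e) - V l X)) * partial l chi X) =
    LI (fun X => G X * (j.+1%:R * (chi (X + h j *: - e) - chi X))).
  have [i2 i3 E1] := weak_div_C1 W (Cj j) (ex_intro _ _ (bj j)).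
  have sh (X : 'rV[R]_n) : X + h j *: e + h j *: - e = X by rewrite scalerN addrK.
  have i4 := Li_shift (h j *: e) i2; have E2 := LI_shift (h j *: e) i2.
  have E3 : (fun X => \sum_l V l (X + h j *: e) * partial l (chij j) (X + h j *: e)) =
      (fun X => \sum_l V l (X + h j *: e) * partial l chi X).
    apply/funext => X; apply: eq_bigr => l _; congr (_ * _).
    by rewrite [LHS](partial_translate (h j *: - e) l _ Cc) sh.
  rewrite E3 in i4 E2.
  rewrite (_ : (fun X => \sum_l _) = fun X => j.+1%:R *
     (\sum_l V l (X + h j *: e) * partial l chi X - \sum_l V l X * partial l chi X)); last first.
    apply/funext => X; rewrite -sumrB mulr_sumr; apply: eq_bigr => l _; ring.
  rewrite (_ : (fun X => G X * _) = fun X => j.+1%:R * (G X * chij j X - G X * chi X)); last first.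
    by apply/funext => X; rewrite /chij; ring.
  apply: (etrans (LIZB _ i4 i0)); apply: (etrans _ (esym (LIZB _ i3 i1))).
  by rewrite E2 E1 E0.
have /choice [M HM] : forall l, exists M : R, 0 <= M /\ Lae (fun X => `|X| <= r ->
     forall t : R, `|t| <= 1 -> `|D l (X + t *: e)| <= M).
  by move=> l; have [M M0 H] := DM l r; exists M.
have [H1 H2] : Li (fun X => \sum_l D l X * partial l chi X) /\
  (fun j => LI (fun X => \sum_l (j.+1%:R * (V l (X + h j *: e) - V l X)) * partial l chi X))
    @ \oo --> LI (fun X => \sum_l D l X * partial l chi X).
  apply: (@LI_dct _ _ _ _ (fun X => \sum_l M l * `|partial l chi X|)).
  - move=> j; apply: Lm_sum => l; apply: LmM; last by apply: Lm_cont; exact: (Cc.2 l).2.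
    apply: LmM; first exact: Lm_cst.
    rewrite (_ : (fun X => _) = fun X => V l (X + h j *: e) + -1 * V l X).
      by apply: LmD; [exact: Lm_shift|apply: LmM => //; exact: Lm_cst].
    by apply/funext => X; rewrite mulN1r.
  - apply: Lm_sum => l; apply: LmM; last by apply: Lm_cont; exact: (Cc.2 l).2.
    apply: (@Lm_cvg _ _ (fun j X => j.+1%:R * (V l (X + h j *: e) - V l X))).
      move=> j; apply: LmM; first exact: Lm_cst.
      rewrite (_ : (fun X => _) = fun X => V l (X + h j *: e) + -1 * V l X).
        by apply: LmD; [exact: Lm_shift|apply: LmM => //; exact: Lm_cst].
      by apply/funext => X; rewrite mulN1r.
    by move=> X; rewrite -eD; exact: seq_derive.
  - apply: LaeW => X.
    apply: (cvg_sum_ord (f := fun l j => j.+1%:R * (V l (X + h j *: e) - V l X) * partial l chi X)) => l.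
    by apply: cvgM; [rewrite -eD; exact: seq_derive|exact: cvg_cst].
  - apply: Li_sum => l; apply: LiZ; apply: Li_norm; apply: Li_cont; first exact: (Cc.2 l).2.
    by exists r; exact: bsupp_partial.
  have H : Lae (fun X => forall l, `|X| <= r -> forall t : R, `|t| <= 1 -> `|D l (X + t *: e)| <= M l).
    by apply: Lae_forall => l; have [] := HM l.
  apply: LaeS H => X HX j; apply: (le_trans (ler_norm_sum _ _ _)); apply: ler_sum => l _.
  rewrite normrM; have [Xr|Xr] := leP `|X| r; last first.
    by rewrite (bsupp_partial l cr Xr) normr0 !mulr0.
  apply: ler_wpM2r => //; apply: quotient_bound => // t t1; rewrite eD; exact: HX.
have cd : continuous (partial k chi) by exact: (Cc.2 k).2.
have dm Y : is_derive Y (- e) chi (- partial k chi Y).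
  by apply: is_derive_opp_dir; exact: C1_is_derive.
have [K K0 HK] := bsupp_bounded cd (ex_intro _ r (bsupp_partial k cr)).
have [H3 H4] : Li (fun X => G X * - partial k chi X) /\
  (fun j => LI (fun X => G X * (j.+1%:R * (chi (X + h j *: - e) - chi X))))
    @ \oo --> LI (fun X => G X * - partial k chi X).
  apply: (@LI_dct _ _ _ _ (fun X => K * (`|G X| * plateau (r + 1) X))).
  - move=> j; apply: LmM; first exact: Lloc_Lm; apply: LmM; first exact: Lm_cst.
    rewrite (_ : (fun X => _) = fun X => chij j X + -1 * chi X).
      apply: Lm_cont; apply: contD; first exact: (Cj j).1.
      by apply: contM; [move=> X; exact: cst_continuous|exact: Cc.1].
    by apply/funext => X; rewrite mulN1r.
  - apply: LmM; first exact: Lloc_Lm.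
    rewrite (_ : (fun X => _) = fun X => -1 * partial k chi X).
      by apply: LmM; [exact: Lm_cst|exact: Lm_cont].
    by apply/funext => X; rewrite mulN1r.
  - apply: LaeW => X; apply: cvgM; first exact: cvg_cst.
    have [d1 d2] := dm X; rewrite -d2; exact: seq_derive.
  - apply: LiZ; apply: Lloc_norm => //; first exact: continuous_plateau.
    by exists (r + 1 + 1) => X; exact: plateau0.
  apply: LaeW => X j; have [Xr|Xr] := leP `|X| (r + 1); last first.
    by rewrite [chi (X + _)](bj j) // cr ?subrr ?mulr0 ?normr0 ?mulr_ge0 ?plateau_ge0 //; lra.
  rewrite plateau1 // mulr1 normrM mulrC; apply: ler_wpM2r => //.
  apply: quotient_bound => [Y|t _]; first by have [] := dm Y.
  by have [_ ->] := dm (X + t *: - e); rewrite normrN.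
split => //.
  rewrite (_ : (fun X => _) = fun X => -1 * (G X * - partial k chi X)); first exact: LiZ.
  by apply/funext => X; ring.
rewrite -(cvg_lim (@Rhausdorff R) H2).
rewrite (_ : - LI _ = LI (fun X => G X * - partial k chi X)).
  by rewrite -(cvg_lim (@Rhausdorff R) H4); congr (lim (_ @ \oo)); apply/funext => j; exact: Eq.
rewrite (_ : (fun X => G X * - _) = fun X => -1 * (G X * partial k chi X)).
  rewrite LIZ ?mulN1r //.
  rewrite (_ : (fun X => _) = fun X => -1 * (G X * - partial k chi X)); first exact: LiZ.
  by apply/funext => X; ring.
by apply/funext => X; ring.
Qed.

End divergence_form.

Lemma Lfun_pinfty_bound d (T : measurableType d) (R : realType)
    (mu : {measure set T -> \bar R}) (f : T -> R) : f \in Lfun mu +oo%E ->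
  measurable_fun setT f /\ exists2 M : R, 0 <= M & {ae mu, forall x, `|f x| <= M}.
Proof.
move=> /andP[fm ff]; split; first by move: fm; rewrite inE /=.
move: ff; rewrite inE /finite_norm unlock /=.
(* If the whole space is null, every bound holds almost everywhere. *)
have [m0|m0 _] := ltP 0%E (mu setT); last first.
  exists 0 => //; exists setT; split => //.
  by apply/eqP; rewrite eq_le m0 measure_ge0.
move=> H; have [M HM] := @ess_supr_bounded _ _ _ mu (fun x => `|f x|) H.
exists (Num.max M 0); first by rewrite le_max lexx orbT.
by apply: filterS HM => x /= fx; rewrite le_max fx.
Qed.

(** * The differentiated equation *)

Section equation.
Context {R : realType}.
Implicit Types n : nat.

Lemma Linfty_bound n (O : set 'rV[R]_n) (f : 'rV[R]_n -> R) : Linfty O f ->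
  Lm (f \_ O) /\ exists2 M : R, 0 <= M & Lae (fun X => O X -> `|f X| <= M).
Proof.
move=> /Lfun_pinfty_bound [mf [M M0 H]]; split => //; exists M => //.
by apply: LaeS H => X + OX; rewrite patchE mem_set.
Qed.

Lemma enorm_ge0 n (v : 'rV[R]_n) : 0 <= enorm v.
Proof. exact: sqrtr_ge0. Qed.

Lemma enorm_gt0 n (v : 'rV[R]_n) : v != 0 -> 0 < enorm v.
Proof. by move=> v0; rewrite sqrtr_gt0 dotv_gt0. Qed.

Lemma enorm_sqr n (v : 'rV[R]_n) : enorm v ^+ 2 = dotv v v.
Proof. by rewrite sqr_sqrtr // dotv_ge0. Qed.

Lemma is_derive_sum n k (f : 'I_k -> 'rV[R]_n -> R) (d : 'I_k -> R) X v :
  (forall i, is_derive X v (f i) (d i)) ->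
  is_derive X v (fun Y => \sum_i f i Y) (\sum_i d i).
Proof.
elim: k f d => [|k IH] f d fd.
  rewrite (_ : (fun Y => _) = fun=> 0) ?big_ord0; first exact: is_derive_cst.
  by apply/funext => Y; rewrite big_ord0.
rewrite (_ : (fun Y => _) = fun Y => f ord0 Y + \sum_i f (lift ord0 i) Y).
  rewrite big_ord_recl.
  apply: (@is_derive_add _ _ (f ord0) (fun Y => \sum_i f (lift ord0 i) Y) X v (d ord0)).
  by apply: (IH (fun i => f (lift ord0 i))) => i; exact: fd.
by apply/funext => Y; rewrite big_ord_recl.
Qed.

Lemma is_derive_enorm_grad n (u : 'rV[R]_n -> R) (X e : 'rV[R]_n) (d : 'I_n -> R) :
  grad u X != 0 -> (forall j, is_derive X e (partial j u) (d j)) ->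
  is_derive X e (fun Y => enorm (grad u Y))
    ((enorm (grad u X))^-1 * \sum_j partial j u X * d j).
Proof.
move=> g0 ud; have gp := enorm_gt0 g0.
have H := is_derive_sum (fun j => is_derive_mul (ud j) (ud j)).
have E : (fun Y => \sum_j partial j u Y * partial j u Y) = fun Y => dotv (grad u Y) (grad u Y).
  by apply/funext => Y; apply: eq_bigr => j _; rewrite !mxE.
rewrite E in H.
have S := @is_derive1_sqrt R _ (dotv_gt0 g0).
have := is_derive_comp1 H S; congr is_derive.
rewrite -/(enorm _) invfM -mulrA mulrCA; congr (_ * _).
rewrite mulr_sumr; apply: eq_bigr => j _; by field.
Qed.

Lemma cont_enorm_grad n (u : 'rV[R]_n -> R) :
  (forall j, continuous (partial j u)) -> continuous (fun Y => enorm (grad u Y)).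
Proof.
move=> cu; apply: (cont_comp (g := Num.sqrt)); last exact: sqrt_continuous.
rewrite (_ : (fun X => _) = fun Y => \sum_j partial j u Y * partial j u Y).
  by apply: cont_sum => j; exact: contM.
by apply/funext => Y; apply: eq_bigr => j _; rewrite !mxE.
Qed.

Lemma continuous_derivable1 (g : R -> R) (t : R) : derivable g t 1 -> {for t, continuous g}.
Proof. by move=> /derivable1_diffP /differentiable_continuous. Qed.

(* [b] is [a x] with x frozen: x does not change in the direction [e]. *)
Lemma is_derive_flux n (b : R -> R) (u : 'rV[R]_n -> R) (l : 'I_n) (X e : 'rV[R]_n) (d : 'I_n -> R) :
  grad u X != 0 -> derivable b (enorm (grad u X)) 1 ->
  (forall j, is_derive X e (partial j u) (d j)) ->
  is_derive X e (fun Y => b (enorm (grad u Y)) * partial l u Y)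
    (\sum_j d j * (b (enorm (grad u X)) * (j == l)%:R +
        derive1 b (enorm (grad u X)) * (grad u X ord0 j * grad u X ord0 l / enorm (grad u X)))).
Proof.
move=> g0 db ud; have gp := enorm_gt0 g0.
have H1 := is_derive_enorm_grad g0 ud.
have Db : is_derive (enorm (grad u X)) 1 b (derive1 b (enorm (grad u X))).
  by rewrite derive1E; exact: DeriveDef.
have := is_derive_mul (is_derive_comp1 H1 Db) (ud l); congr is_derive.
under [RHS]eq_bigr do rewrite mulrDr.
rewrite big_split /= [X in _ = X + _](bigD1 l) //= eqxx mulr1 [X in _ = _ + X + _]big1 ?addr0; last first.
  by move=> j /negbTE ->; rewrite !mulr0.
rewrite addrC; congr (_ + _); first by rewrite mulrC.
rewrite mulrA mulr_sumr mulr_suml; apply: eq_bigr => j _; rewrite !mxE.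
field; exact: lt0r_neq0.
Qed.

Lemma continuous_line (V : normedModType R) (f : V -> R) (X v : V) :
  continuous f -> continuous (fun t : R => f (X + t *: v)).
Proof.
move=> cf t; apply: (@continuous_comp _ _ _ (fun t : R => X + t *: v) f); last exact: cf.
by apply: cvgD; [exact: cvg_cst|apply: cvgZr_tmp].
Qed.

Lemma cont_comp_at (T : topologicalType) (f : T -> R) (g : R -> R) :
  continuous f -> (forall X, {for f X, continuous g}) -> continuous (fun Y => g (f Y)).
Proof. by move=> cf cg X; apply: continuous_comp; [exact: cf|exact: cg]. Qed.

Lemma C2_partial_comm n (f : 'rV[R]_n -> R) : C1 f -> (forall j, C1 (partial j f)) ->
  forall i j, partial j (partial i f) = partial i (partial j f).
Proof.
move=> f1 f2 i j; apply: partial_comm.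
- exact: (f1.2 i).1.
- exact: (f1.2 j).1.
- exact: ((f2 i).2 j).1.
- exact: ((f2 j).2 i).1.
- exact: ((f2 i).2 j).2.
- exact: ((f2 j).2 i).2.
Qed.

Section single.
Variables m p : nat.
Notation N := (m + p.+1)%N.
Implicit Types (a : 'rV[R]_m -> R -> R) (u G : 'rV[R]_N -> R).

(* The form the hypotheses take on one equation: u is C^2 since its gradient never vanishes. *)
Definition nondegenerate a u : Prop :=
  [/\ forall X, partial (y_last m p) u X != 0, C1 u, forall j, C1 (partial j u),
    forall x t, 0 < t -> derivable (a x) t 1 /\ {for t, continuous (derive1 (a x))} &
    forall k l, Lm (fun X => Agrad a u X k l) /\ forall r : R, exists2 M : R, 0 <= M &
      Lae (fun X => `|X| <= r -> `|Agrad a u X k l| <= M)].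

Lemma grad_neq0 u X : partial (y_last m p) u X != 0 -> grad u X != 0.
Proof.
apply: contra_neq => /rowP /(_ (y_last m p)); by rewrite !mxE.
Qed.

Lemma enorm_lt_norm n (r : R) (X : 'rV[R]_n) : `|X| <= r -> eball n (n.+1%:R * (r + 1)) X.
Proof.
move=> Xr; have r0 : 0 <= r by exact: le_trans Xr.
rewrite /eball /= -(ltr_pXn2r (n := 2)) ?nnegrE ?enorm_ge0 ?mulr_ge0 ?addr_ge0 //.
rewrite enorm_sqr; apply: (le_lt_trans (sqnorm_le X)).
have : `|X| ^+ 2 <= r ^+ 2 by rewrite ler_pXn2r ?nnegrE.
have : 0 <= n%:R :> R by [].
rewrite -(natr1 n); set c := n%:R; set y := `|X| ^+ 2; nra.
Qed.

Lemma nondegenerateP a u : admissible_coefficient a -> regular u -> condition_B a u ->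
  (forall X, partial (y_last m p) u X != 0) -> nondegenerate a u.
Proof.
move=> [_ _ aC] [/Ck1P uC1 uC2 _ _ _] uB u0.
have gT : [set X | grad u X != 0] = setT.
  by apply/seteqP; split => X //= _; exact: grad_neq0.
rewrite gT in uC2; move/CkS: uC2 => [_ uC2].
split => // [j|k l]; first by apply/Ck1P; exact: uC2.
have HB r : 0 < r -> Lm ((fun X => Agrad a u X k l) \_ (eball N r)) /\
  exists2 M : R, 0 <= M & Lae (fun X => eball N r X -> `|Agrad a u X k l| <= M).
  by move=> r0; have := Linfty_bound (uB r r0 k l); rewrite gT setTI.
split; last first.
  move=> r; have r0 : 0 < N.+1%:R * (`|r| + 1) by rewrite mulr_gt0 // ltr_wpDl.
  have [_ [M M0 H]] := HB _ r0.
  exists M => //; apply: LaeS H => X HX Xr; apply: HX; apply: enorm_lt_norm.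
  exact: (le_trans Xr (ler_norm r)).
(* Condition (B) yields measurability ball by ball; the truncations converge pointwise. *)
apply: (@Lm_cvg _ _ (fun j => (fun X => Agrad a u X k l) \_ (eball N j.+1%:R))).
  by move=> j; have [] := HB j.+1%:R (ltr0Sn _ _).
move=> X; apply: cvg_near_cst; near=> j; rewrite patchE mem_set //.
rewrite /eball /=; apply: (@le_lt_trans _ _ j%:R); last by rewrite ltr_nat.
by near: j; exact: nbhs_infty_ger.
Unshelve. all: by end_near. Qed.

Definition flux a u (l : 'I_N) (X : 'rV[R]_N) : R :=
  a (lsubmx X) (enorm (grad u X)) * partial l u X.

(** The y_k-derivative of the flux: [Agrad] is the Jacobian of eta -> a(x, |eta|) eta at grad u, so
    the chain rule gives the row grad (d_k u) times this matrix. *)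
Definition dflux a u (k : 'I_p.+1) (l : 'I_N) (X : 'rV[R]_N) : R :=
  \sum_j partial j (partial (rshift m k) u) X * Agrad a u X j l.

Lemma lsubmx_line (X : 'rV[R]_N) (s : R) (k : 'I_p.+1) :
  lsubmx (X + s *: delta_mx ord0 (rshift m k)) = lsubmx X.
Proof.
by apply/rowP => j; rewrite !mxE eq_lrshift andbF mulr0 addr0.
Qed.

Lemma is_derive_dflux a u k l X : nondegenerate a u ->
  is_derive X (delta_mx ord0 (rshift m k)) (flux a u l) (dflux a u k l X).
Proof.
move=> [u0 uC1 uC2 aC _]; have g0 := grad_neq0 (u0 X).
apply/is_derive_lineP.
rewrite (_ : (fun s : R => _) = fun s : R =>
  (fun Y => a (lsubmx X) (enorm (grad u Y)) * partial l u Y) (X + s *: delta_mx ord0 (rshift m k))); last first.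
  by apply/funext => s; rewrite /flux lsubmx_line.
apply: (is_derive_lineP (fun Y => a (lsubmx X) (enorm (grad u Y)) * partial l u Y) X _ _).2.
have H j : is_derive X (delta_mx ord0 (rshift m k)) (partial j u) (partial j (partial (rshift m k) u) X).
  apply: is_derive_eq (C1_is_derive X (rshift m k) (uC2 j)) _.
  exact: (congr1 (@^~ X) (esym (C2_partial_comm uC1 uC2 (rshift m k) j))).
have [da _] := aC (lsubmx X) _ (enorm_gt0 g0).
have := is_derive_flux l g0 da H; congr is_derive.
by apply: eq_bigr => j _; rewrite !mxE.
Qed.

(** Continuity holds along y-lines, where x is frozen; a may be discontinuous in x. This is the
    input of [ae_bound_along]. *)
Lemma continuous_dflux a u k l X : nondegenerate a u ->
  continuous (fun t : R => dflux a u k l (X + t *: delta_mx ord0 (rshift m k))).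
Proof.
move=> [u0 uC1 uC2 aC _].
pose g Y := enorm (grad u Y).
have gp Y : 0 < g Y by exact: enorm_gt0 (grad_neq0 (u0 Y)).
have g0 Y : g Y != 0 by exact: lt0r_neq0.
have ag Y := aC (lsubmx X) (g Y) (gp Y).
have cg : continuous g by apply: cont_enorm_grad => j; exact: (uC1.2 j).2.
have cu j : continuous (partial j u) by exact: (uC1.2 j).2.
have cc (c : R) : continuous (fun _ : 'rV[R]_N => c) by move=> Y; exact: cst_continuous.
pose H Y := \sum_j partial j (partial (rshift m k) u) Y *
  (a (lsubmx X) (g Y) * (j == l)%:R + derive1 (a (lsubmx X)) (g Y) *
     ((partial j u Y * partial l u Y) * (g Y)^-1)).
rewrite (_ : (fun t : R => _) = fun t : R => H (X + t *: delta_mx ord0 (rshift m k))).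
  apply: continuous_line; apply: cont_sum => j; apply: contM; first exact: ((uC2 _).2 _).2.
  apply: contD; apply: contM => //.
  - apply: (cont_comp_at (g := a (lsubmx X))) => // Y; exact: (continuous_derivable1 (ag Y).1).
  - apply: (cont_comp_at (g := derive1 (a (lsubmx X)))) => // Y; exact: (ag Y).2.
  - by apply: contM; [exact: contM|exact: contV].
apply/funext => t; apply: eq_bigr => j _; rewrite !mxE lsubmx_line //.
Qed.

Lemma dflux_bound a u k l : nondegenerate a u ->
  forall r : R, exists2 M : R, 0 <= M & Lae (fun X => `|X| <= r -> `|dflux a u k l X| <= M).
Proof.
move=> [u0 uC1 uC2 aC Ab] r.
have /choice [M HM] : forall j, exists M : R, 0 <= M /\ Lae (fun X => `|X| <= r ->
     `|Agrad a u X j l| <= M).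
  by move=> j; have [_ /(_ r) [M M0 H]] := Ab j l; exists M.
have /choice [K HK] : forall j, exists K : R, 0 <= K /\ forall X, `|X| <= r ->
     `|partial j (partial (rshift m k) u) X| <= K.
  move=> j; have cw : continuous (partial j (partial (rshift m k) u)) by exact: ((uC2 _).2 _).2.
  by have [K K0 H] := cont_bounded r cw; exists K.
exists (\sum_j K j * M j).
  by apply: sumr_ge0 => j _; rewrite mulr_ge0 //; [have [] := HK j|have [] := HM j].
have H : Lae (fun X => forall j, `|X| <= r -> `|Agrad a u X j l| <= M j).
  by apply: Lae_forall => j; have [] := HM j.
apply: LaeS H => X HX Xr; apply: (le_trans (ler_norm_sum _ _ _)); apply: ler_sum => j _.
by rewrite normrM; apply: ler_pM => //; [have [_] := HK j; exact|exact: HX].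
Qed.

Lemma weak_div_dflux a u G (k : 'I_p.+1) (chi : 'rV[R]_N -> R) :
  nondegenerate a u -> weak_div (flux a u) G -> C1 chi -> bsupp chi ->
  [/\ Li (fun X => \sum_l dflux a u k l X * partial l chi X),
      Li (fun X => G X * partial (rshift m k) chi X) &
    LI (fun X => \sum_l dflux a u k l X * partial l chi X) =
      - LI (fun X => G X * partial (rshift m k) chi X)].
Proof.
move=> nu W; apply: (weak_div_partial W) => [l X|l r]; first exact: is_derive_dflux.
apply: ae_bound_along => [X||]; first exact: continuous_dflux.
  by have := @norm_e R N 1 (rshift m k); rewrite scale1r normr1.
exact: dflux_bound.
Qed.

End single.

End equation.

(** * The coupling identity on a slice *)

Section slice.
Context {R : realType}.
Implicit Types n d : nat.

(* The pure second derivatives need not be jointly continuous, so [partial i f]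
   need not be C^1. *)
Definition sepC2 n (f : 'rV[R]_n -> R) : Prop :=
  (forall i xi, C2 (fun t => f (xi + t *: delta_mx ord0 i))) /\
  forall i j : 'I_n, i != j -> (forall xi, derivable (partial i f) xi (delta_mx ord0 j)) /\
    continuous (partial j (partial i f)).

Lemma sepC2_is_derive n (f : 'rV[R]_n -> R) i X : sepC2 f ->
  is_derive X (delta_mx ord0 i) f (partial i f X).
Proof.
move=> [f1 _]; have [/(_ 0) [H _] _] := f1 i X.
have /is_derive_lineP := DeriveDef H erefl => H1.
by have [H2 H3] := H1; split.
Qed.

Lemma sepC2_continuous_line n (f : 'rV[R]_n -> R) i X : sepC2 f ->
  {for 0, continuous (fun t : R => partial i f (X + t *: delta_mx ord0 i))}.
Proof.
move=> sf; have [/(_ 0) [_ H] _] := sf.1 i X.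
rewrite (_ : (fun t : R => _) = derive1 (fun t : R => f (X + t *: delta_mx ord0 i))).
  exact: continuous_derivable1.
apply/funext => t; rewrite derive1E.
have D : derivable f (X + t *: delta_mx ord0 i) (delta_mx ord0 i).
  by have [] := sepC2_is_derive i (X + t *: delta_mx ord0 i) sf.
by have [_ ->] := is_derive_line D.
Qed.

(** Each partial j f has continuous partials in the other directions and is differentiable, hence
    continuous, along its own. By [continuous_partials] it is jointly continuous, although its own
    j-th partial need not be. *)
Lemma sepC2_C1 n (f : 'rV[R]_n -> R) : sepC2 f -> C1 f.
Proof.
move=> sf.
have df j X : derivable f X (delta_mx ord0 j) by have [] := sepC2_is_derive j X sf.
have cf j : continuous (partial j f).
  apply: (@continuous_partials _ _ _ j) => [k kj|X]; last exact: sepC2_continuous_line.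
  by apply: sf.2; rewrite eq_sym.
split=> // ; case: n f sf df cf => [|n] f sf df cf.
  move=> X; rewrite (_ : f = fun=> f X); first exact: cst_continuous.
  by apply/funext => Y; congr f; apply/rowP => -[].
apply: (@continuous_partials _ _ _ ord0) => [k _|X]; first by split.
have [/(_ 0) [H _] _] := sf.1 ord0 X; exact: continuous_derivable1.
Qed.

Lemma sepC2_comm n (f : 'rV[R]_n -> R) (i j : 'I_n) : sepC2 f ->
  partial j (partial i f) = partial i (partial j f).
Proof.
move=> sf; have [->//|ij] := eqVneq i j.
have ji : j != i by rewrite eq_sym.
have [d1 c1] := sf.2 _ _ ij; have [d2 c2] := sf.2 _ _ ji.
apply: partial_comm => //.
- exact: ((sepC2_C1 sf).2 i).1.
- exact: ((sepC2_C1 sf).2 j).1.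
Qed.

(* Replaces [partial i f], which cannot be integrated by parts, by a C^1 function. *)
Definition diffq n (f : 'rV[R]_n -> R) (i : 'I_n) (q : nat) (X : 'rV[R]_n) : R :=
  q.+1%:R * (f (X + q.+1%:R^-1 *: delta_mx ord0 i) - f X).

Lemma cont_cst (T : topologicalType) (c : R) : continuous (fun _ : T => c).
Proof. by move=> X; exact: cst_continuous. Qed.

Lemma contB (T : topologicalType) (f g : T -> R) : continuous f -> continuous g ->
  continuous (fun Y => f Y - g Y).
Proof. by move=> cf cg X; apply: continuousB; [exact: cf|exact: cg]. Qed.

Lemma C1_diffq n (f : 'rV[R]_n -> R) i q : C1 f -> C1 (diffq f i q).
Proof.
move=> Cf; rewrite (_ : diffq f i q = fun X => q.+1%:R * (f (X + q.+1%:R^-1 *: delta_mx ord0 i) + -1 * f X)).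
  apply: C1M; first exact: C1_cst; apply: C1D; first exact: C1_translate.
  by apply: C1M => //; exact: C1_cst.
by apply/funext => X; rewrite /diffq mulN1r.
Qed.

Lemma partial_diffq n (f : 'rV[R]_n -> R) i q j X : C1 f ->
  partial j (diffq f i q) X = diffq (partial j f) i q X.
Proof.
move=> Cf; rewrite (_ : diffq f i q = fun X => q.+1%:R * (f (X + q.+1%:R^-1 *: delta_mx ord0 i) + -1 * f X)).
  apply: is_derive_partial.
  have H1 := is_derive_translate (C1_is_derive (X + q.+1%:R^-1 *: delta_mx ord0 i) j Cf).
  have H2 := @is_derive_mul R n (fun=> -1) f X _ _ _ (is_derive_cst _ _ _) (C1_is_derive X j Cf).
  have H3 := @is_derive_mul R n (fun=> q.+1%:R) _ X _ _ _ (is_derive_cst _ _ _) (is_derive_add H1 H2).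
  by apply: (is_derive_eq H3); rewrite /diffq; ring.
by apply/funext => Y; rewrite /diffq mulN1r.
Qed.

Lemma diffq_bound n (f : 'rV[R]_n -> R) i : (forall X, derivable f X (delta_mx ord0 i)) ->
  continuous (partial i f) -> forall r : R, exists2 M : R, 0 <= M &
    forall q X, `|X| <= r -> `|diffq f i q X| <= M.
Proof.
move=> df cf r; have [M M0 HM] := cont_bounded (r + 1) cf; exists M => // q X Xr.
apply: quotient_bound => // t t1; apply: HM.
apply: (le_trans (ler_normD _ _)); apply: lerD => //.
exact: (le_trans (norm_e t i)).
Qed.

Lemma continuous_diffq n (f : 'rV[R]_n -> R) i q : continuous f -> continuous (diffq f i q).
Proof.
move=> cf; rewrite (_ : diffq f i q = fun X => q.+1%:R * (f (X + q.+1%:R^-1 *: delta_mx ord0 i) + -1 * f X)).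
  apply: contM; first exact: cont_cst; apply: contD; first exact: cont_translate.
  by apply: contM => //; exact: cont_cst.
by apply/funext => X; rewrite /diffq mulN1r.
Qed.

Lemma diffq_cvg n (f : 'rV[R]_n -> R) i X : derivable f X (delta_mx ord0 i) ->
  (fun q => diffq f i q X) @ \oo --> partial i f X.
Proof. exact: seq_derive. Qed.

Definition vals n d (U : 'I_n -> 'rV[R]_d -> R) (y : 'rV[R]_d) : 'rV[R]_n := \row_i U i y.

Lemma vals_bounded n d (U : 'I_n -> 'rV[R]_d -> R) (r : R) : (forall i, continuous (U i)) ->
  exists2 K : R, 0 <= K & forall y, `|y| <= r -> `|vals U y| <= K.
Proof.
move=> cU; have /choice [K HK] : forall i, exists K : R, 0 <= K /\ forall y, `|y| <= r -> `|U i y| <= K.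
  by move=> i; have [K K0 H] := cont_bounded r (cU i); exists K.
exists (\sum_i K i); first by apply: sumr_ge0 => i _; have [] := HK i.
move=> y yr; apply/row_normP; first by apply: sumr_ge0 => i _; have [] := HK i.
move=> i; rewrite mxE (bigD1 i) //=; have [_ /(_ y yr) H] := HK i.
by rewrite ler_wpDr // sumr_ge0 // => j _; have [] := HK j.
Qed.

Lemma continuous_vals n d (U : 'I_n -> 'rV[R]_d -> R) (g : 'rV[R]_n -> R) :
  (forall i, continuous (U i)) -> continuous g -> continuous (fun y => g (vals U y)).
Proof.
move=> cU cg y; apply/cont_normP => e e0.
have /cont_normP /(_ e e0) [del del0 H] := cg (vals U y).
have /choice [dd Hd] : forall i, exists del' : R, 0 < del' /\
    forall z : 'rV[R]_d, `|z - y| < del' -> `|U i z - U i y| <= del / 2.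
  move=> i; have [] := (cont_normP (U i) y).1 (cU i y) (del / 2).
    by rewrite divr_gt0.
  by move=> d' d'0 H'; exists d'.
exists (\big[Num.min/1]_i dd i); first by apply: lt_bigmin => // i _; have [] := Hd i.
move=> z /bigmin_gtP [_ zd]; apply: H.
apply: (@le_lt_trans _ _ (del / 2)); last by rewrite ltr_pdivrMr // ltr_pMr // ltr1n.
apply/row_normP; first by rewrite divr_ge0 // ltW.
by move=> i; have := (Hd i).2 z (zd i isT); rewrite !mxE.
Qed.

Lemma C1_vals n d (U : 'I_n -> 'rV[R]_d -> R) (f : 'rV[R]_n -> R) :
  C1 f -> (forall i, C1 (U i)) -> C1 (fun y => f (vals U y)) /\
  forall k y, partial k (fun y => f (vals U y)) y = \sum_j partial k (U j) y * partial j f (vals U y).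
Proof.
move=> Cf CU.
have E i : (fun z => vals U z ord0 i) = U i by apply/funext => z; rewrite mxE.
have D k y : is_derive y (delta_mx ord0 k) (fun y => f (vals U y))
    (\sum_j partial k (U j) y * partial j f (vals U y)).
  have := @chain_rule R _ n (vals U) f y (delta_mx ord0 k) Cf.
  under eq_bigr do rewrite E.
  by apply => j; rewrite E; exact: ((CU j).2 k).1.
split; last by move=> k y; exact: is_derive_partial.
apply: (C1_intro (df := fun k y => \sum_j partial k (U j) y * partial j f (vals U y))) => //.
  by apply: continuous_vals => [i|]; [exact: (CU i).1|exact: Cf.1].
move=> k; apply: cont_sum => j; apply: contM; first exact: ((CU j).2 k).2.
by apply: continuous_vals => [i|]; [exact: (CU i).1|exact: (Cf.2 j).2].
Qed.

Lemma LI_by_parts d (g phi : 'rV[R]_d -> R) (k : 'I_d) : C1 g -> C1 phi -> bsupp phi ->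
  LI (fun y => g y * partial k phi y) = - LI (fun y => partial k g y * phi y).
Proof.
move=> Cg Cp [r pr]; have Cgp := C1M Cg Cp.
have bgp : bsupp (fun y => g y * phi y) by exists r => y /pr ->; rewrite mulr0.
have E : partial k (fun y => g y * phi y) = fun y => partial k g y * phi y + g y * partial k phi y.
  apply/funext => y; apply: is_derive_partial.
  by apply: is_derive_mul; exact: C1_is_derive.
have := LI_partial0 Cgp.1 (Cgp.2 k).1 (Cgp.2 k).2 bgp; rewrite E LID.
- by move/eqP; rewrite addrC addr_eq0 => /eqP.
- apply: Li_cont; first by apply: contM; [exact: (Cg.2 k).2|exact: Cp.1].
  by exists r => y /pr ->; rewrite mulr0.
- apply: Li_cont; first by apply: contM; [exact: Cg.1|exact: (Cp.2 k).2].
  by exists r => y yr; rewrite (bsupp_partial k pr yr) mulr0.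
Qed.

(** The diagonal is set to 0 so that sums over all pairs contain no pure second derivative. *)
Definition mixed n (f : 'rV[R]_n -> R) (i j : 'I_n) (xi : 'rV[R]_n) : R :=
  if j == i then 0 else partial i (partial j f) xi.

Lemma mixedC n (f : 'rV[R]_n -> R) i j xi : sepC2 f -> mixed f i j xi = mixed f j i xi.
Proof. by move=> sf; rewrite /mixed eq_sym (sepC2_comm i j sf). Qed.

Lemma continuous_mixed n (f : 'rV[R]_n -> R) i j : sepC2 f -> continuous (mixed f i j).
Proof.
move=> sf; rewrite /mixed; have [_|ji] := eqVneq j i; first exact: cont_cst.
exact: (sf.2 _ _ ji).2.
Qed.

Lemma LI_dominated_bsupp n k (A_ : nat -> 'I_k -> 'rV[R]_n -> R) (A T : 'I_k -> 'rV[R]_n -> R) :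
  (forall q j, continuous (A_ q j)) -> (forall j, continuous (A j)) ->
  (forall j, continuous (T j)) -> (forall j, bsupp (T j)) ->
  (forall j y, (fun q => A_ q j y) @ \oo --> A j y) ->
  (forall j (r : R), exists2 M : R, 0 <= M & forall q y, `|y| <= r -> `|A_ q j y| <= M) ->
  (fun q => LI (fun y => \sum_j A_ q j y * T j y)) @ \oo --> LI (fun y => \sum_j A j y * T j y).
Proof.
move=> cA_ cA cT bT Acvg AM.
have /choice [M HM] : forall j, exists M : R, 0 <= M /\ forall q y, `|A_ q j y * T j y| <= M * `|T j y|.
  move=> j; have [r Tr] := bT j; have [M M0 H] := AM j r; exists M; split => // q y.
  rewrite normrM; have [yr|yr] := leP `|y| r; last by rewrite Tr // normr0 !mulr0.
  by apply: ler_wpM2r => //; exact: H.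
apply: (proj2 (@LI_dct _ _ _ _ (fun y => \sum_j M j * `|T j y|) _ _ _ _ _)).
- by move=> q; apply: Lm_sum => j; apply: Lm_cont; exact: contM.
- by apply: Lm_sum => j; apply: Lm_cont; exact: contM.
- apply: LaeW => y; apply: (cvg_sum_ord (f := fun j q => A_ q j y * T j y)) => j.
  by apply: cvgM; [exact: Acvg|exact: cvg_cst].
- by apply: Li_sum => j; apply: LiZ; apply: Li_norm; apply: Li_cont.
apply: LaeW => y q; apply: (le_trans (ler_norm_sum _ _ _)); apply: ler_sum => j _.
exact: (HM j).2.
Qed.

(* The term j = i, where the uncontrolled pure second derivative of f would appear,
   cancels by the relation between phi and psi. *)
Lemma slice_single n d (f : 'rV[R]_n -> R) (U : 'I_n -> 'rV[R]_d -> R) (i : 'I_n) (k l : 'I_d)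
    (phi psi : 'rV[R]_d -> R) : sepC2 f -> (forall j, C1 (U j)) ->
  C1 phi -> bsupp phi -> C1 psi -> bsupp psi ->
  (forall y, partial k (U i) y * phi y = partial l (U i) y * psi y) ->
  LI (fun y => partial i f (vals U y) * (partial k phi y - partial l psi y)) =
  LI (fun y => \sum_j mixed f i j (vals U y) *
        (partial l (U j) y * psi y - partial k (U j) y * phi y)).
Proof.
move=> sf CU Cphi bphi Cpsi bpsi phipsi.
have Cf := sepC2_C1 sf; have cU j := (CU j).1.
pose T j y := partial l (U j) y * psi y - partial k (U j) y * phi y.
pose A_ (q : nat) j (y : 'rV[R]_d) : R := if j == i then 0 else diffq (partial j f) i q (vals U y).
pose S y := partial k phi y - partial l psi y.
have bB (g h : 'rV[R]_d -> R) : bsupp g -> bsupp h -> bsupp (fun y => g y - h y).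
  move=> [r gr] [r' hr]; exists (Num.max r r') => y; rewrite gt_max => /andP[/gr -> /hr ->].
  by rewrite subrr.
have bpart (g : 'rV[R]_d -> R) j : bsupp g -> bsupp (partial j g).
  by move=> [r gr]; exists r; exact: bsupp_partial.
have cT j : continuous (T j).
  by apply: contB; apply: contM; [exact: ((CU j).2 l).2|exact: Cpsi.1|exact: ((CU j).2 k).2|exact: Cphi.1].
have bT j : bsupp (T j) by apply: bB; exact: bsupp_Ml.
have cS : continuous S by apply: contB; [exact: (Cphi.2 k).2|exact: (Cpsi.2 l).2].
have bS : bsupp S by apply: bB; exact: bpart.
(* The left side is written as a sum over one index so that [LI_dominated_bsupp] handles both limits
   in q. *)
have Eq q : LI (fun y => \sum_(j < 1) diffq f i q (vals U y) * S y) =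
    LI (fun y => \sum_j A_ q j y * T j y).
  have [CG dG] := C1_vals (C1_diffq i q Cf) CU.
  rewrite (_ : (fun y => _) = fun y => diffq f i q (vals U y) * partial k phi y -
      diffq f i q (vals U y) * partial l psi y); last first.
    by apply/funext => y; rewrite big_ord1 mulrBr.
  have LiG (g : 'rV[R]_d -> R) h : continuous g -> continuous h -> bsupp h -> Li (fun y => g y * h y).
    by move=> cg ch bh; apply: Li_cont; [exact: contM|exact: bsupp_Ml].
  rewrite LIB; [|by apply: LiG; [exact: CG.1|exact: (Cphi.2 k).2|exact: bpart]
                |by apply: LiG; [exact: CG.1|exact: (Cpsi.2 l).2|exact: bpart]].
  rewrite !LI_by_parts // opprK addrC -LIB;
    [|by apply: LiG => //; [exact: (CG.2 l).2|exact: Cpsi.1]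
     |by apply: LiG => //; [exact: (CG.2 k).2|exact: Cphi.1]].
  congr LI; apply/funext => y; rewrite !dG !mulr_suml -sumrB; apply: eq_bigr => j _.
  rewrite partial_diffq // /A_ /T; have [->|_] := eqVneq j i; last by ring.
  rewrite mul0r mulrAC -phipsi; ring.
have H1 : (fun q => LI (fun y => \sum_(j < 1) diffq f i q (vals U y) * S y)) @ \oo -->
    LI (fun y => \sum_(j < 1) partial i f (vals U y) * S y).
  apply: (@LI_dominated_bsupp _ 1 (fun q _ y => diffq f i q (vals U y))
     (fun _ y => partial i f (vals U y)) (fun _ => S)) => //.
  - by move=> q _; exact: (C1_vals (C1_diffq i q Cf) CU).1.1.
  - by move=> _; apply: continuous_vals => //; exact: (Cf.2 i).2.
  - by move=> _ y; apply: diffq_cvg; exact: (Cf.2 i).1.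
  - move=> _ r; have [K K0 HK] := vals_bounded r cU.
    have [M M0 HM] := diffq_bound (Cf.2 i).1 (Cf.2 i).2 K.
    by exists M => // q y yr; apply: HM; exact: HK.
have H2 : (fun q => LI (fun y => \sum_j A_ q j y * T j y)) @ \oo -->
    LI (fun y => \sum_j mixed f i j (vals U y) * T j y).
  apply: (@LI_dominated_bsupp _ n A_ (fun j y => mixed f i j (vals U y)) T) => //.
  - move=> q j; rewrite /A_; case: (j == i); first exact: cont_cst.
    apply: continuous_vals => //; exact: continuous_diffq (Cf.2 j).2.
  - by move=> j; apply: continuous_vals => //; exact: continuous_mixed.
  - move=> j y; rewrite /A_ /mixed; have [_|ji] := eqVneq j i; first exact: cvg_cst.
    by apply: diffq_cvg; exact: (sf.2 _ _ ji).1.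
  move=> j r; rewrite /A_; have [_|ji] := eqVneq j i; first by exists 0 => // q y _; rewrite normr0.
  have [K K0 HK] := vals_bounded r cU.
  have [M M0 HM] := diffq_bound (sf.2 _ _ ji).1 (sf.2 _ _ ji).2 K.
  by exists M => // q y yr; apply: HM; exact: HK.
rewrite -(cvg_lim (@Rhausdorff R) H2) (_ : (fun y => _ * _) = fun y => \sum_(j < 1) partial i f (vals U y) * S y).
  by rewrite -(cvg_lim (@Rhausdorff R) H1); congr (lim (_ @ \oo)); exact/funext.
by apply/funext => y; rewrite big_ord1.
Qed.

(** The factor 1/2 compensates for summing over ordered pairs: by symmetry this is the sum over i <
    j of F_ij v_i v_j (sg_i - sg_j)^2. *)
Definition coupling n (f : 'rV[R]_n -> R) (xi : 'rV[R]_n) (v sg : 'I_n -> R) : R :=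
  2^-1 * \sum_i \sum_j mixed f i j xi * v i * v j * (sg i - sg j) ^+ 2.

(** With t = w / v and h_ij = F_ij v_i v_j the summand is h_ij (t_i^2 - t_i t_j) s. As h is
    symmetric, averaging with the swapped indices completes the square (t_i - t_j)^2 / 2. *)
Lemma coupling_symmetrization n (f : 'rV[R]_n -> R) (xi : 'rV[R]_n) (v w : 'I_n -> R) (s : R) :
  sepC2 f -> (forall i, v i != 0) ->
  \sum_i \sum_j mixed f i j xi * (v j * (w i ^+ 2 * s / v i) - w j * (w i * s)) =
  coupling f xi v (fun i => w i / v i) * s.
Proof.
move=> sf v0; rewrite /coupling.
pose h i j := mixed f i j xi * v i * v j.
pose t i := w i / v i.
have E1 : \sum_i \sum_j mixed f i j xi * (v j * (w i ^+ 2 * s / v i) - w j * (w i * s)) =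
    \sum_i \sum_j h i j * (t i ^+ 2 - t i * t j) * s.
  apply: eq_bigr => i _; apply: eq_bigr => j _; rewrite /h /t.
  by field; rewrite !v0.
have E2 : \sum_i \sum_j h i j * (t i ^+ 2 - t i * t j) * s =
    \sum_i \sum_j h i j * (t j ^+ 2 - t i * t j) * s.
  rewrite exchange_big /=; apply: eq_bigr => i _; apply: eq_bigr => j _.
  by rewrite /h mixedC //; ring.
rewrite E1.
have E3 : \sum_i \sum_j h i j * (t i - t j) ^+ 2 * s =
   \sum_i \sum_j h i j * (t i ^+ 2 - t i * t j) * s + \sum_i \sum_j h i j * (t j ^+ 2 - t i * t j) * s.
  rewrite -big_split /=; apply: eq_bigr => i _; rewrite -big_split /=; apply: eq_bigr => j _; ring.
have E4 : \sum_i \sum_j h i j * (t i - t j) ^+ 2 * s = (\sum_i \sum_j h i j * (t i - t j) ^+ 2) * s.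
  by rewrite mulr_suml; apply: eq_bigr => i _; rewrite mulr_suml.
rewrite -mulrA -E4 E3 -E2; set S := \sum_i _; by field.
Qed.

(** A single equation carries no sign. Only after summation over i do the terms pair up under
    exchange of i and j. *)
Lemma slice_identity n d (f : 'rV[R]_n -> R) (U : 'I_n -> 'rV[R]_d -> R) (k l : 'I_d)
    (theta : 'rV[R]_d -> R) : sepC2 f -> (forall j, C1 (U j)) ->
  (forall i j, C1 (partial j (U i))) -> (forall i y, partial l (U i) y != 0) ->
  C1 theta -> bsupp theta ->
  LI (fun y => \sum_i partial i f (vals U y) *
    (partial k (fun z => partial k (U i) z * theta z ^+ 2) y -
     partial l (fun z => partial k (U i) z ^+ 2 * theta z ^+ 2 / partial l (U i) z) y)) =
  LI (fun y => coupling f (vals U y) (fun i => partial l (U i) y)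
      (fun i => partial k (U i) y / partial l (U i) y) * theta y ^+ 2).
Proof.
move=> sf CU C2U v0 Ct [r tr].
pose phi i z := partial k (U i) z * theta z ^+ 2.
pose psi i z := partial k (U i) z ^+ 2 * theta z ^+ 2 / partial l (U i) z.
have Cphi i : C1 (phi i) by apply: C1M => //; exact: C1M.
have Cpsi i : C1 (psi i).
  by apply: C1M; [apply: C1M; exact: C1M|exact: C1V].
have pr i y : r < `|y| -> phi i y = 0 by move=> /tr E; rewrite /phi E expr0n mulr0.
have qr i y : r < `|y| -> psi i y = 0 by move=> /tr E; rewrite /psi E expr0n mulr0 mul0r.
have cU j := (CU j).1.
pose T i j y := partial l (U j) y * psi i y - partial k (U j) y * phi i y.
have cT i j : continuous (T i j).
  by apply: contB; apply: contM; [exact: ((CU j).2 l).2|exact: (Cpsi i).1|exact: ((CU j).2 k).2|exact: (Cphi i).1].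
have E i := @slice_single n d f U i k l (phi i) (psi i) sf CU (Cphi i) (ex_intro _ r (pr i))
    (Cpsi i) (ex_intro _ r (qr i)) _.
have Cf := sepC2_C1 sf.
rewrite LI_sum; last first.
  move=> i; apply: Li_cont.
    apply: contM; first by apply: continuous_vals => //; exact: (Cf.2 i).2.
    by apply: contB; [exact: ((Cphi i).2 k).2|exact: ((Cpsi i).2 l).2].
  exists r => y yr; rewrite (bsupp_partial k (pr i) yr) (bsupp_partial l (qr i) yr).
  by rewrite subrr mulr0.
rewrite (eq_bigr (fun i => LI (fun y => \sum_j mixed f i j (vals U y) * T i j y))); last first.
  by move=> i _; apply: (E _ i) => {}i y; rewrite /phi /psi; field; exact: v0.
rewrite -LI_sum; last first.
  move=> i; apply: Li_cont.
    apply: cont_sum => j; apply: contM => //; apply: continuous_vals => //; exact: continuous_mixed.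
  by exists r => y yr; apply: big1 => j _; rewrite /T pr // qr // !mulr0 subrr mulr0.
congr LI; apply/funext => y; exact: coupling_symmetrization.
Qed.

End slice.

(** * The energy identity *)

Section slice_restriction.
Context {R : realType}.
Implicit Types n : nat.

Lemma borel_LI n (h : 'rV[R]_n -> R) : continuous h -> bsupp h ->
  (\int[borel_lebesgue_rV n]_y (h y)%:E = (LI h)%:E)%E.
Proof.
move=> ch bh; have ih := Li_cont ch bh; rewrite -(LI_EFin ih).
have mh : measurable_fun setT (EFin \o h).
  by apply/measurable_EFinP; exact: continuous_measurable_rV.
apply/esym; apply: (integral_preserving (@measurable_idL R n) (@lebesgue_idL R n)).
exact: (integrable_preservingP (@measurable_idL R n) (@lebesgue_idL R n) mh ih).
Qed.

Lemma borel_ae_dense n (P : 'rV[R]_n -> Prop) (x0 : 'rV[R]_n) (r : R) :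
  {ae (@borel_lebesgue_rV R n), forall x, P x} -> 0 < r -> exists2 x, `|x - x0| < r & P x.
Proof.
move=> [A [mA A0 PA]] r0; apply: contrapT => nP.
have : (borel_lebesgue_rV n (shift_rV (- x0) @^-1` (@cube R n r)) <= borel_lebesgue_rV n A)%E.
  apply: le_measure; rewrite ?inE //.
    have := @measurable_shift_rV R n (- x0) measurableT _ (@measurable_cube R n r); by rewrite setTI.
  move=> x xc; apply: PA => /= Px; apply: nP; exists x => //; exact: cube_norm.
rewrite A0 borel_lebesgue_shift; last exact: measurable_cube.
rewrite borel_lebesgue_cube; last exact: ltW.
by rewrite lee_fin leNgt exprn_gt0 // mulr_gt0.
Qed.

Lemma row_mx_line m d (x : 'rV[R]_m) (y : 'rV[R]_d) (k : 'I_d) (s : R) :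
  row_mx x (y + s *: delta_mx ord0 k) = row_mx x y + s *: delta_mx ord0 (rshift m k).
Proof.
apply/rowP => l; rewrite !mxE; case: splitP => j lj; rewrite ?mxE.
- by rewrite (_ : (l == rshift m k) = false) ?andbF ?mulr0 ?addr0 //; apply/eqP => E;
  move: (ltn_ord j); rewrite -lj E /= ltnNge leq_addr.
- have -> : l = rshift m j by exact/val_inj.
  by rewrite (inj_eq (@rshift_inj _ _)).
Qed.

Lemma is_derive_slice m d (f : 'rV[R]_(m + d) -> R) (x : 'rV[R]_m) (y : 'rV[R]_d) k D :
  is_derive (row_mx x y) (delta_mx ord0 (rshift m k)) f D ->
  is_derive y (delta_mx ord0 k) (fun y => f (row_mx x y)) D.
Proof.
move=> /is_derive_lineP H; apply/is_derive_lineP.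
by rewrite (_ : (fun s : R => _) = fun s : R => f (row_mx x y + s *: delta_mx ord0 (rshift m k))) //;
  apply/funext => s; rewrite row_mx_line.
Qed.

Lemma continuous_slice m d (f : 'rV[R]_(m + d) -> R) (x : 'rV[R]_m) :
  continuous f -> continuous (fun y => f (row_mx x y)).
Proof.
move=> cf y; apply/cont_normP => e e0.
have /cont_normP /(_ e e0) [del del0 H] := cf (row_mx x y).
exists del => // z zy; apply: H; apply: le_lt_trans zy; apply/row_normP => // l.
rewrite !mxE; case: splitP => j _; first by rewrite subrr normr0.
by have := row_norm_coord (z - y) j; rewrite !mxE.
Qed.

Lemma C1_slice m d (f : 'rV[R]_(m + d) -> R) (x : 'rV[R]_m) : C1 f ->
  C1 (fun y => f (row_mx x y)).
Proof.
move=> Cf; apply: (C1_intro (df := fun k y => partial (rshift m k) f (row_mx x y))).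
- exact: continuous_slice Cf.1.
- by move=> k y; apply: is_derive_slice; exact: C1_is_derive.
- by move=> k; apply: continuous_slice; exact: (Cf.2 _).2.
Qed.

Lemma partial_slice m d (f : 'rV[R]_(m + d) -> R) (x : 'rV[R]_m) k : C1 f ->
  partial k (fun y => f (row_mx x y)) = fun y => partial (rshift m k) f (row_mx x y).
Proof.
move=> Cf; apply/funext => y; apply: is_derive_partial.
by apply: is_derive_slice; exact: C1_is_derive.
Qed.

Lemma bsupp_slice m d (f : 'rV[R]_(m + d) -> R) (x : 'rV[R]_m) : bsupp f ->
  bsupp (fun y => f (row_mx x y)).
Proof.
move=> [r fr]; exists r => y yr; apply: fr; apply: (lt_le_trans yr).
apply/row_normP => // j; have := row_norm_coord (row_mx x y) (rshift m j).
by rewrite row_mxEr.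
Qed.

Lemma Lloc_quad n (M : 'rV[R]_n -> 'M[R]_n) (v w : 'rV[R]_n -> 'rV[R]_n) :
  (forall j l, Lloc (fun X => M X j l)) -> (forall j, continuous (fun X => v X ord0 j)) ->
  (forall j, continuous (fun X => w X ord0 j)) -> Lloc (fun X => quad (M X) (v X) (w X)).
Proof.
move=> LM cv cw.
rewrite (_ : (fun X => _) = fun X => \sum_l \sum_j M X j l * (v X ord0 j * w X ord0 l)).
  by apply: Lloc_sum => l; apply: Lloc_sum => j; apply: Lloc_M => //; exact: contM.
apply/funext => X; apply: eq_bigr => l _; rewrite !mxE mulr_suml.
by apply: eq_bigr => j _; ring.
Qed.

End slice_restriction.
Section test_gradients.
Context {R : realType}.
Variable d : nat.
Implicit Types (f w v theta : 'rV[R]_d -> R) (X : 'rV[R]_d).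

Lemma is_derive_sqr f X (l : 'I_d) : C1 f ->
  is_derive X (delta_mx ord0 l) (fun Y => f Y ^+ 2) (2 * f X * partial l f X).
Proof.
move=> Cf; apply: (is_derive_eq (is_derive_mul (C1_is_derive X l Cf) (C1_is_derive X l Cf))).
ring.
Qed.

Lemma grad_mul_sqr w theta X : C1 w -> C1 theta ->
  grad (fun Y => w Y * theta Y ^+ 2) X =
  (theta X ^+ 2) *: grad w X + (2 * w X * theta X) *: grad theta X.
Proof.
move=> Cw Ct; apply/rowP => l; rewrite !mxE; apply: is_derive_partial.
apply: (is_derive_eq (is_derive_mul (C1_is_derive X l Cw) (is_derive_sqr X l Ct))).
ring.
Qed.

Lemma grad_sqr_mul_div w v theta X : C1 w -> C1 v -> C1 theta -> (forall Y, v Y != 0) ->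
  grad (fun Y => w Y ^+ 2 * theta Y ^+ 2 / v Y) X =
  (2 * (w X / v X) * theta X ^+ 2) *: grad w X +
  (- ((w X / v X) ^+ 2 * theta X ^+ 2)) *: grad v X +
  (2 * w X * (w X / v X) * theta X) *: grad theta X.
Proof.
move=> Cw Cv Ct v0.
have H l := is_derive_partial (is_derive_mul (is_derive_mul (is_derive_sqr X l Cw) (is_derive_sqr X l Ct))
  (is_derive_inv (v0 X) (C1_is_derive X l Cv))).
apply/rowP => l; rewrite [LHS]mxE H.
rewrite !mxE; field; exact: v0.
Qed.

(** For x = grad w, y = grad v, t = grad theta and s = w / v, the difference of the two pairings
    completes a square in x - s y = v grad sigma. Symmetry of M merges the cross terms. *)
Lemma quad_twist (M : 'M[R]_d) (x y t : 'rV[R]_d) (s th w : R) : M^T = M ->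
  quad M x (th ^+ 2 *: x + (2 * w * th) *: t) -
  quad M y ((2 * s * th ^+ 2) *: x + (- (s ^+ 2 * th ^+ 2)) *: y + (2 * w * s * th) *: t) =
  quad M (x + (- s) *: y) (x + (- s) *: y) * th ^+ 2 + 2 * (w * th) * quad M (x + (- s) *: y) t.
Proof.
move=> Ms; have S : quad M y x = quad M x y by exact: dotv_sym.
rewrite !(quadDl, quadDr, quadZl, quadZr) S; ring.
Qed.

End test_gradients.

Section global.
Context {R : realType}.
Variables m p n : nat.
Notation N := (m + p.+1)%N.
Implicit Types (a : 'rV[R]_m -> R -> R) (v u theta : 'rV[R]_N -> R) (k : 'I_p.+1).

Lemma Agrad_sym a u X : (Agrad a u X)^T = Agrad a u X.
Proof. by apply/matrixP => i j; rewrite !mxE eq_sym [X in _ * (X / _)]mulrC. Qed.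

Definition dlast u : 'rV[R]_N -> R := partial (y_last m p) u.
Definition dy k u : 'rV[R]_N -> R := partial (rshift m k) u.
Definition ratio k u X : R := dy k u X / dlast u X.
(* [dlast u] times the gradient of [ratio k u]. *)
Definition twist k u X : 'rV[R]_N := grad (dy k u) X + (- ratio k u X) *: grad (dlast u) X.
Definition test1 k u theta X : R := dy k u X * theta X ^+ 2.
Definition test2 k u theta X : R := dy k u X ^+ 2 * theta X ^+ 2 / dlast u X.

Lemma dflux_quad a u k X (g : 'rV[R]_N) :
  \sum_l dflux a u k l X * g ord0 l = quad (Agrad a u X) (grad (dy k u) X) g.
Proof.
by apply: eq_bigr => l _; rewrite !mxE; congr (_ * _); apply: eq_bigr => j _; rewrite [in RHS]mxE.
Qed.

Lemma C1_test1 k u theta : (forall j, C1 (partial j u)) -> C1 theta -> C1 (test1 k u theta).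
Proof. by move=> Cu Ct; apply: C1M; [exact: Cu|exact: C1M]. Qed.

Lemma C1_test2 k u theta : (forall j, C1 (partial j u)) -> C1 theta ->
  (forall X, dlast u X != 0) -> C1 (test2 k u theta).
Proof.
move=> Cu Ct u0; have Cw : C1 (dy k u) by exact: Cu.
have Cv : C1 (dlast u) by exact: Cu.
by apply: C1M; [apply: C1M; exact: C1M|exact: C1V].
Qed.

Lemma bsupp_test1 k u theta : bsupp theta -> bsupp (test1 k u theta).
Proof. by move=> [r tr]; exists r => X /tr E; rewrite /test1 E expr0n mulr0. Qed.

Lemma bsupp_test2 k u theta : bsupp theta -> bsupp (test2 k u theta).
Proof. by move=> [r tr]; exists r => X /tr E; rewrite /test2 E expr0n mulr0 mul0r. Qed.

Lemma flux_identity a u k theta X : (forall j, C1 (partial j u)) -> C1 theta ->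
  (forall Y, dlast u Y != 0) ->
  \sum_l dflux a u k l X * partial l (test1 k u theta) X -
  \sum_l dflux a u ord_max l X * partial l (test2 k u theta) X =
  quad (Agrad a u X) (twist k u X) (twist k u X) * theta X ^+ 2 +
  2 * (dy k u X * theta X) * quad (Agrad a u X) (twist k u X) (grad theta X).
Proof.
move=> Cu Ct u0.
have E (f : 'rV[R]_N -> R) k' : \sum_l dflux a u k' l X * partial l f X =
    quad (Agrad a u X) (grad (dy k' u) X) (grad f X).
  by rewrite -dflux_quad; apply: eq_bigr => l _; rewrite mxE.
have Cw : C1 (dy k u) by exact: Cu.
have Cv : C1 (dlast u) by exact: Cu.
rewrite E E (grad_mul_sqr X Cw Ct) (grad_sqr_mul_div X Cw Cv Ct u0).
exact: quad_twist (Agrad_sym _ _ _).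
Qed.

Implicit Types (A : 'I_n -> 'rV[R]_m -> R -> R) (F : 'rV[R]_m -> 'rV[R]_n -> R)
  (us : 'I_n -> 'rV[R]_N -> R).

Definition reaction F us (i : 'I_n) (X : 'rV[R]_N) : R := F1 F i (lsubmx X) (values us X).

Definition monotone_system A F us : Prop :=
  [/\ forall x, sepC2 (F x), forall i, nondegenerate (A i) (us i),
    forall i, weak_div (flux (A i) (us i)) (reaction F us i) &
    forall i j X, 0 <= mixed (F (lsubmx X)) i j (values us X) * dlast (us i) X * dlast (us j) X].

Lemma values_slice us (x : 'rV[R]_m) (y : 'rV[R]_p.+1) :
  values us (row_mx x y) = vals (fun i z => us i (row_mx x z)) y.
Proof. by apply/rowP => i; rewrite !mxE. Qed.

Lemma continuous_coupling d (f : 'rV[R]_n -> R) (U V S : 'I_n -> 'rV[R]_d -> R) :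
  sepC2 f -> (forall i, continuous (U i)) -> (forall i, continuous (V i)) ->
  (forall i, continuous (S i)) ->
  continuous (fun y => coupling f (vals U y) (fun i => V i y) (fun i => S i y)).
Proof.
move=> sf cU cV cS; apply: contM; first exact: cont_cst.
apply: cont_sum => i; apply: cont_sum => j; apply: contM.
  apply: contM => //; apply: contM => //; apply: continuous_vals => //; exact: continuous_mixed.
by apply: contM; exact: contB.
Qed.

Lemma coupling_ge0 (f : 'rV[R]_n -> R) xi (v s : 'I_n -> R) :
  (forall i j, 0 <= mixed f i j xi * v i * v j) -> 0 <= coupling f xi v s.
Proof.
move=> h; apply: mulr_ge0; first by rewrite invr_ge0.
by apply: sumr_ge0 => i _; apply: sumr_ge0 => j _; apply: mulr_ge0; rewrite ?sqr_ge0.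
Qed.

Definition coupling_at k F us (X : 'rV[R]_N) : R :=
  coupling (F (lsubmx X)) (values us X) (fun i => dlast (us i) X) (fun i => ratio k (us i) X).

(** For fixed x, F(x, .) is one separately C^2 function, so [slice_identity] applies to the
    functions y -> u^i(x, y). It holds for every x, with continuity on the slice although H need not
    be continuous in x. *)
Lemma coupling_slice A F us k (theta : 'rV[R]_N -> R) (x : 'rV[R]_m) :
  monotone_system A F us -> C1 theta -> bsupp theta ->
  let H X := \sum_i reaction F us i X *
     (partial (rshift m k) (test1 k (us i) theta) X - partial (y_last m p) (test2 k (us i) theta) X) in
  let c y := coupling_at k F us (row_mx x y) * theta (row_mx x y) ^+ 2 in
  [/\ continuous (fun y => H (row_mx x y)), bsupp (fun y => H (row_mx x y)),
     continuous c, bsupp c & LI (fun y => H (row_mx x y)) = LI c].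
Proof.
move=> [sF nu _ _] Ct bt H c.
pose U i y := us i (row_mx x y).
have Cu i : C1 (us i) by have [] := nu i.
have C2u i j : C1 (partial j (us i)) by have [] := nu i.
have u0 i X : dlast (us i) X != 0 by have [] := nu i.
have CU i : C1 (U i) by exact: C1_slice.
have E i k' : partial k' (U i) = fun y => dy k' (us i) (row_mx x y) by exact: partial_slice.
have C2U i j : C1 (partial j (U i)) by rewrite E; apply: C1_slice; exact: C2u.
have C1t i := C1_test1 k (C2u i) Ct; have C2t i := C1_test2 k (C2u i) Ct (u0 i).
pose th y := theta (row_mx x y).
have Cth : C1 th by exact: C1_slice.
have T1 i : partial k (fun z => partial k (U i) z * th z ^+ 2) =
    fun y => partial (rshift m k) (test1 k (us i) theta) (row_mx x y).
  by rewrite -(partial_slice x k (C1t i)) E.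
have T2 i : partial ord_max (fun z => partial k (U i) z ^+ 2 * th z ^+ 2 / partial ord_max (U i) z) =
    fun y => partial (y_last m p) (test2 k (us i) theta) (row_mx x y).
  by rewrite -(partial_slice x ord_max (C2t i)) !E.
have HE : (fun y => H (row_mx x y)) = fun y => \sum_i partial i (F x) (vals U y) *
   (partial k (fun z => partial k (U i) z * th z ^+ 2) y -
    partial ord_max (fun z => partial k (U i) z ^+ 2 * th z ^+ 2 / partial ord_max (U i) z) y).
  apply/funext => y; apply: eq_bigr => i _; rewrite T1 T2.
  by rewrite /reaction /F1 row_mxKl values_slice.
have cE : c = fun y => coupling (F x) (vals U y) (fun i => partial ord_max (U i) y)
      (fun i => partial k (U i) y / partial ord_max (U i) y) * th y ^+ 2.
  apply/funext => y.
  rewrite (_ : (fun i => partial ord_max (U i) y) = fun i => dlast (us i) (row_mx x y)); last first.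
    by apply/funext => i; rewrite E.
  rewrite (_ : (fun i => partial k (U i) y / _) = fun i => ratio k (us i) (row_mx x y)); last first.
    by apply/funext => i; rewrite !E.
  by rewrite /c /coupling_at row_mxKl values_slice.
have U0 i y : partial ord_max (U i) y != 0 by rewrite E; exact: u0.
split.
- rewrite HE; apply: cont_sum => i; apply: contM.
    apply: continuous_vals => [j|]; first exact: (CU j).1.
    exact: ((sepC2_C1 (sF x)).2 i).2.
  rewrite T1 T2; apply: contB; apply: continuous_slice; [exact: ((C1t i).2 _).2|exact: ((C2t i).2 _).2].
- apply: bsupp_slice; have [r tr] := bt; exists r => X Xr.
  apply: big1 => i _.
  have s1 Y : r < `|Y| -> test1 k (us i) theta Y = 0.
    by move=> /tr tY; rewrite /test1 tY expr0n mulr0.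
  have s2 Y : r < `|Y| -> test2 k (us i) theta Y = 0.
    by move=> /tr tY; rewrite /test2 tY expr0n mulr0 mul0r.
  have -> := bsupp_partial (rshift m k) s1 Xr; have -> := bsupp_partial (y_last m p) s2 Xr.
  by rewrite subrr mulr0.
- rewrite cE; apply: contM; last by apply: contM; exact: Cth.1.
  apply: (@continuous_coupling _ (F x) U (fun i => partial ord_max (U i))
    (fun i y => partial k (U i) y / partial ord_max (U i) y) (sF x)) => i.
  - exact: (CU i).1.
  - exact: (C2U i ord_max).1.
  - by apply: contM; [exact: (C2U i k).1|apply: contV; [exact: (C2U i ord_max).1|exact: U0]].
- have [r tr] := bsupp_slice x bt; exists r => y /tr ty.
  by rewrite /c ty expr0n mulr0.
rewrite HE cE.
have := @slice_identity R n p.+1 (F x) U k ord_max th (sF x) CU C2U U0 Cth (bsupp_slice x bt).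
exact.
Qed.

Definition energy A us k (theta : 'rV[R]_N -> R) (X : 'rV[R]_N) : R :=
  \sum_i (quad (Agrad (A i) (us i) X) (twist k (us i) X) (twist k (us i) X) * theta X ^+ 2 +
    2 * (dy k (us i) X * theta X) * quad (Agrad (A i) (us i) X) (twist k (us i) X) (grad theta X)).

(** The energy integrates to minus the integral of H, whose slice integrals are those of the
    coupling and hence nonnegative. In the equality case almost every slice integral vanishes, so by
    continuity in y the coupling term vanishes on whole slices over a dense set of x. *)
Lemma global_identity A F us k (theta : 'rV[R]_N -> R) :
  monotone_system A F us -> C1 theta -> bsupp theta ->
  [/\ Li (energy A us k theta), LI (energy A us k theta) <= 0 &
    LI (energy A us k theta) = 0 -> forall (x0 : 'rV[R]_m) (r : R), 0 < r ->
      exists2 x, `|x - x0| < r &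
        forall y, coupling_at k F us (row_mx x y) * theta (row_mx x y) ^+ 2 = 0].
Proof.
move=> ms Ct bt; have [sF nu wd mn] := ms.
have Cu i : C1 (us i) by have [] := nu i.
have C2u i j : C1 (partial j (us i)) by have [] := nu i.
have u0 i X : dlast (us i) X != 0 by have [] := nu i.
pose A1 i X := \sum_l dflux (A i) (us i) k l X * partial l (test1 k (us i) theta) X.
pose A2 i X := \sum_l dflux (A i) (us i) ord_max l X * partial l (test2 k (us i) theta) X.
pose B1 i X := reaction F us i X * partial (rshift m k) (test1 k (us i) theta) X.
pose B2 i X := reaction F us i X * partial (y_last m p) (test2 k (us i) theta) X.
have P1 i : [/\ Li (A1 i), Li (B1 i) & LI (A1 i) = - LI (B1 i)].
  exact: (weak_div_dflux k (nu i) (wd i) (C1_test1 k (C2u i) Ct) (bsupp_test1 k (us i) bt)).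
have P2 i : [/\ Li (A2 i), Li (B2 i) & LI (A2 i) = - LI (B2 i)].
  exact: (weak_div_dflux ord_max (nu i) (wd i) (C1_test2 k (C2u i) Ct (u0 i))
    (bsupp_test2 k (us i) bt)).
have eE : energy A us k theta = fun X => \sum_i (A1 i X - A2 i X).
  by apply/funext => X; apply: eq_bigr => i _; rewrite -flux_identity.
pose H X := \sum_i reaction F us i X *
     (partial (rshift m k) (test1 k (us i) theta) X - partial (y_last m p) (test2 k (us i) theta) X).
have HE : H = fun X => \sum_i (B1 i X - B2 i X).
  by apply/funext => X; apply: eq_bigr => i _; rewrite mulrBr.
have iA i : Li (fun X => A1 i X - A2 i X).
  by have [i1 _ _] := P1 i; have [i2 _ _] := P2 i; exact: LiB.
have iB i : Li (fun X => B1 i X - B2 i X).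
  by have [_ i1 _] := P1 i; have [_ i2 _] := P2 i; exact: LiB.
have iH : Li H by rewrite HE; exact: Li_sum.
have eH : LI (energy A us k theta) = - LI H.
  rewrite eE HE (LI_sum iA) (LI_sum iB) -sumrN; apply: eq_bigr => i _.
  have [a1 b1 e1] := P1 i; have [a2 b2 e2] := P2 i.
  apply: (etrans (LIB a1 a2)); apply: (etrans _ (esym (congr1 -%R (LIB b1 b2)))).
  by rewrite e1 e2 opprB opprK addrC.
pose c x y := coupling_at k F us (row_mx x y) * theta (row_mx x y) ^+ 2.
have sl x : [/\ continuous (fun y => H (row_mx x y)), bsupp (fun y => H (row_mx x y)),
     continuous (c x), bsupp (c x) & LI (fun y => H (row_mx x y)) = LI (c x)].
  exact: coupling_slice.
have c0 x y : 0 <= c x y.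
  by apply: mulr_ge0; [apply: coupling_ge0 => i j; exact: mn|exact: sqr_ge0].
have sI x : (\int[borel_lebesgue_rV p.+1]_y (H (cat_rV (x, y)))%:E = (LI (c x))%:E)%E.
  have [cH bH _ _ <-] := sl x; exact: borel_LI.
have mH x : measurable_fun setT (fun y : 'rV[R]_p.+1 => H (cat_rV (x, y))).
  by have [cH _ _ _ _] := sl x; exact: continuous_measurable_rV.
have pH x : (0 <= \int[borel_lebesgue_rV p.+1]_y (H (cat_rV (x, y)))%:E)%E.
  have [_ _ cc bc _] := sl x; rewrite sI lee_fin.
  exact: (LI_ge0 (Li_cont cc bc) (LaeW (c0 x))).
have [h1 h2] := slices_ge0 iH mH pH.
rewrite (LI_EFin iH) in h1 h2; split; first by rewrite eE; exact: Li_sum.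
  by rewrite eH oppr_le0; move: h1; rewrite lee_fin.
rewrite eH => /eqP; rewrite oppr_eq0 => /eqP H0 x0 r r0.
rewrite H0 in h2; have [x xr cx] := borel_ae_dense x0 (h2 erefl) r0; exists x => //.
have [_ _ cc bc _] := sl x.
rewrite sI in cx; have c_0 : LI (c x) = 0 by case: cx.
exact: (ae_eq0_continuous cc (LI_eq0 (Li_cont cc bc) (LaeW (c0 x)) c_0)).
Qed.

End global.

(** * Comparison with an integrand of unknown measurability *)

Section integral_comparison.
Context d (T : measurableType d) (R : realType) (mu : {measure set T -> \bar R}).
Import HBNNSimple.

(* No measurability is assumed of g: the library integral is then the difference of
   the lower integrals of its positive and negative parts. *)
Lemma le_integral_nonmeasurable (h g : T -> R) (D : set T) :
  mu.-integrable setT (EFin \o h) -> {ae mu, forall x, 0 <= h x} ->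
  {ae mu, forall x, (D x -> h x <= g x) /\ (~ D x -> h x = 0)} ->
  (\int[mu]_x (h x)%:E <= \int[mu]_(x in D) (g x)%:E)%E.
Proof.
move=> ih h0 hg.
have [A [mA A0 HA]] : {ae mu, forall x, 0 <= h x /\ (D x -> h x <= g x) /\ (~ D x -> h x = 0)}.
  by apply: filterS2 h0 hg.
have HA' x : ~ A x -> 0 <= h x /\ (D x -> h x <= g x) /\ (~ D x -> h x = 0).
  by move=> nA; apply: contrapT => H; apply: nA; apply: HA.
pose G : T -> \bar R := (EFin \o g) \_ D.
have hG x : ~ A x -> ((h x)%:E <= G x)%E.
  move=> /HA' [h_0 [hgx hx]]; rewrite /G patchE; case: ifPn; rewrite ?inE ?notin_setE.
    by move=> /hgx; rewrite /= lee_fin.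
  by move=> /hx ->.
have G0 x : ~ A x -> (0 <= G x)%E.
  by move=> nA; apply: le_trans (hG x nA); rewrite lee_fin; have [] := HA' x nA.
(* G is nonnegative off the null set A, so each simple function below its negative part vanishes
   almost everywhere. *)
have Gneg : (\int[mu]_x (G^\-)%E x = 0)%E.
  apply/eqP; rewrite eq_le integral_ge0 ?andbT; last by move=> x _; exact: funeneg_ge0.
  rewrite ge0_integralTE; last exact: funeneg_ge0.
  apply: ge_ereal_sup => _ [s /= sG <-]; rewrite -integralT_nnsfun.
  rewrite (@ae_eq_integral _ _ _ mu setT (cst 0%E)) //; first by rewrite integral0.
    by apply/measurable_EFinP; exact: measurable_funP.
  exists A; split => // x /= H; apply: contrapT => nA; apply: H => _.
  apply/eqP; rewrite eqe eq_le fun_ge0 andbT -lee_fin (le_trans (sG x)) //.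
  by rewrite funenegE ge_max lexx andbT oppe_le0 G0.
rewrite (integral_mkcond D) -/G (integralE mu setT G) Gneg sube0.
(* Setting h to 0 on A makes h1 <= G^+ hold at every point, so simple functions below h1 are below
   G^+. *)
pose h1 x := h x * \1_(~` A) x.
have mh : measurable_fun setT h by move/integrableP: ih => [/measurable_EFinP].
have mh1 : measurable_fun setT (EFin \o h1).
  apply/measurable_EFinP; apply: measurable_funM => //.
  by apply: measurable_indic; exact: measurableC.
have h1E x : ~ A x -> h1 x = h x by move=> nA; rewrite /h1 indicE mem_set // mulr1.
have h10 x : A x -> h1 x = 0 by move=> nA; rewrite /h1 indicE memNset ?mulr0 //; exact.
rewrite (@ae_eq_integral _ _ _ mu setT (EFin \o h1)) //; last 2 first.
- by apply/measurable_EFinP.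
- exists A; split => // x /= H; apply: contrapT => nA; apply: H => _ /=.
  by rewrite h1E.
have h1_ge0 x : (0 <= (h1 x)%:E)%E.
  rewrite lee_fin; have [/h10 ->//|nA] := pselect (A x).
  by rewrite h1E //; have [] := HA' x nA.
rewrite ge0_integralTE // ge0_integralTE; last exact: funepos_ge0.
apply: le_ereal_sup => _ [s /= sh <-]; exists s => // x.
apply: (le_trans (sh x)); rewrite funeposE le_max.
have [/h10 E|nA] := pselect (A x); first by rewrite /= E lexx orbT.
by rewrite /= h1E // hG.
Qed.

End integral_comparison.

(** * Cutoffs and the Liouville argument *)

Section liouville.
Context {R : realType}.

(** Meant for the growth hypothesis, whose integrand contains [max_eigenvalue]: a measurable
    minorant is bounded without establishing measurability of that integrand. *)
Lemma LI_le_integral n (D : set 'rV[R]_n) (h g : 'rV[R]_n -> R) (c : R) : Li h ->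
  Lae (fun X => 0 <= h X) -> Lae (fun X => (D X -> h X <= g X) /\ (~ D X -> h X = 0)) ->
  (\int[lebesgue_rV R n]_(X in D) (g X)%:E <= c%:E)%E -> LI h <= c.
Proof.
move=> ih h0 hg gc; rewrite -lee_fin -(LI_EFin ih).
exact: le_trans (le_integral_nonmeasurable ih h0 hg) gc.
Qed.

(** A bounded nondecreasing sequence has increments tending to 0, so its limit is at most del K for
    every del. *)
Lemma bounded_telescoping_eq0 (J : nat -> R) (K : R) :
  (forall j, 0 <= J j) -> (forall j, J j <= J j.+1) -> (forall j, J j <= K) ->
  (forall (del : R) j, 0 < del -> J j.+1 <= del^-1 * (J j.+2 - J j) + del * K) ->
  forall j, J j = 0.
Proof.
move=> J0 Jinc JK H j.
have Jm : nondecreasing_seq J by apply/nondecreasing_seqP.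
have cJ : cvgn J.
  by apply: nondecreasing_is_cvgn => //; exists K => _ [i _ <-].
set l := limn J in cJ *; have Jl : J @ \oo --> l by [].
have l0 : l <= 0.
  rewrite leNgt; apply/negP => lp.
  have K0 : 0 <= K by exact: le_trans (J0 0%N) (JK 0%N).
  have Jle j' : J j' <= l by exact: nondecreasing_cvgn_le.
  have lK : l <= K by apply: limr_le => //; exact: nearW.
  (* With this del both terms of the bound are at most l / 4 once J is within del l / 4 of l. Then J
     would be at most l / 2 and also above 3 l / 4. *)
  pose del := l / (4 * (K + 1)).
  have K1 : 0 < 4 * (K + 1) by rewrite mulr_gt0 // ltr_wpDl.
  have dp : 0 < del by rewrite divr_gt0.
  have dK : del * K <= l / 4.
    rewrite /del mulrAC ler_pdivrMr //; nra.
  have d1 : del <= 1 by rewrite ler_pdivrMr // mul1r; lra.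
  have ep : 0 < del * l / 4 by rewrite divr_gt0 // mulr_gt0.
  have [m _ Hm] : \forall m \near \oo, l - del * l / 4 < J m.
    by apply: (cvgr_gt _ Jl); rewrite gtrBl.
  have := Hm m (leqnn m); have := H del m dp; have := Jle m.+2; have := Jinc m => h1 h2 h3 h4.
  have h5 : del^-1 * (J m.+2 - J m) <= l / 4.
    rewrite mulrC ler_pdivrMr //; lra.
  have h6 : del * l <= l by rewrite ler_piMl // ltW.
  lra.
apply/le_anti; rewrite J0 andbT; apply: le_trans l0.
exact: nondecreasing_cvgn_le.
Qed.

(* A bounded derivative follows from compactness, since it vanishes off [1, 4]. *)
Lemma cutoff_profile : exists (tau dtau : R -> R) (c : R), 0 <= c /\
  [/\ forall s : R, is_derive s 1 tau (dtau s), continuous dtau, forall s : R, `|dtau s| <= c,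
    forall s : R, 0 <= tau s <= 1 &
    [/\ forall s : R, s <= 1 -> tau s = 1, forall s : R, 4 <= s -> tau s = 0 &
      forall s : R, s <= 1 \/ 4 <= s -> dtau s = 0]].
Proof.
pose f : R -> R := flat 0; pose g : R -> R := flat 2.
have df (t : R) : is_derive t 1 f (g t).
  by have := is_derive_flat 0 t; rewrite mul0r subr0.
have dg (t : R) : is_derive t 1 g (flat 4 t - 2%:R * flat 3 t) by exact: is_derive_flat.
have cf : continuous f by move=> t; apply: continuous_derivable1; have [] := df t.
have cg : continuous g by move=> t; apply: continuous_derivable1; have [] := dg t.
(* The profile is A / (A + B), with A living on s < 4 and B on s > 1. As s will be |X|^2 / r^2, the
   thresholds mean |X| = r and |X| = 2r. *)
pose A s := f (4 - s); pose B s := f (s - 1).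
have f0 s : s <= 0 -> f s = 0 by move=> s0; rewrite /f /flat ltNge s0.
have g0 s : s <= 0 -> g s = 0 by move=> s0; rewrite /g /flat ltNge s0.
have AB s : 0 < A s + B s.
  have [s4|s4] := ltP s 4.
    by rewrite ltr_pwDl ?flat_ge0 // flat_gt0 subr_gt0.
  by rewrite ltr_wpDl ?flat_ge0 // flat_gt0 subr_gt0; lra.
have dA (s : R) : is_derive s 1 A (- g (4 - s)).
  rewrite -mulrN1; apply: (@is_derive1_comp _ f (fun s => 4 - s)).
  by have := is_deriveB (is_derive_cst (4 : R) s (1 : R)) (is_derive_id s (1 : R)); rewrite sub0r.
have dB (s : R) : is_derive s 1 B (g (s - 1)).
  rewrite -[g _]mulr1; apply: (@is_derive1_comp _ f (fun s => s - 1)).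
  by have := is_deriveB (is_derive_id s (1 : R)) (is_derive_cst (1 : R) s (1 : R)); rewrite subr0.
pose dtau s := (- g (4 - s) * B s - A s * g (s - 1)) / (A s + B s) ^+ 2.
have cA : continuous A by move=> t; apply: continuous_derivable1; have [] := dA t.
have cB : continuous B by move=> t; apply: continuous_derivable1; have [] := dB t.
have cid : continuous (fun s : R => s) by move=> t; exact: cvg_id.
have cdt : continuous dtau.
  apply: contM; last first.
    by apply: contV => [|s]; [apply: contM; exact: contD|rewrite gt_eqF // exprn_gt0].
  apply: contB; apply: contM => //.
    rewrite (_ : (fun s => - g (4 - s)) = fun s => 0 - g (4 - s)); last by apply/funext => s; rewrite sub0r.
    apply: contB; first exact: cont_cst.
    apply: (cont_comp (g := g)) => //; apply: contB => //; exact: cont_cst.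
  apply: (cont_comp (g := g)) => //; apply: contB => //; exact: cont_cst.
have dt0 s : s <= 1 \/ 4 <= s -> dtau s = 0.
  move=> [s1|s4]; rewrite /dtau /A /B.
    by rewrite (f0 (s - 1)) ?(g0 (s - 1)) ?subr_le0 // !mulr0 subrr mul0r.
  by rewrite (f0 (4 - s)) ?(g0 (4 - s)) ?subr_le0 // oppr0 !mul0r subrr mul0r.
exists (fun s => A s / (A s + B s)), dtau.
have cX : continuous (fun X : 'rV[R]_1 => dtau (X ord0 ord0)).
  by apply: cont_comp => //; exact: (C1_coord ord0).1.
have [c c0 Hc] := cont_bounded 4 cX.
exists c; split; first exact: c0.
split.
- move=> s; have ABs : (A + B : R -> R) s != 0 by exact: lt0r_neq0 (AB s).
  have H := is_deriveM (dA s) (is_deriveV ABs (is_deriveD (dA s) (dB s))).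
  have E (x y z t : R) : x + y != 0 ->
    x * (- (x + y) ^- 2 * (- z + t)) + (x + y)^-1 * - z = (- z * y - x * t) / (x + y) ^+ 2.
    by move=> xy; field.
  apply: (is_derive_eq H); exact: E.
- exact: cdt.
- move=> s; have [[s1|s4]|] := pselect (s <= 1 \/ 4 <= s).
  + by rewrite dt0 ?normr0 //; left.
  + by rewrite dt0 ?normr0 //; right.
  move=> /not_orP [/negP + /negP]; rewrite -!ltNge => s1 s4.
  have := Hc (const_mx s); rewrite mxE; apply; apply/row_normP => // i.
  by rewrite mxE ger0_norm; lra.
- move=> s; rewrite divr_ge0 ?flat_ge0 ?(ltW (AB s)) //=.
  by rewrite ler_pdivrMr // mul1r lerDl flat_ge0.
split; last exact: dt0; move=> s hs.
- by rewrite /B f0 ?subr_le0 // addr0 divff // /A /f gt_eqF // flat_gt0 subr_gt0; lra.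
- by rewrite /A f0 ?subr_le0 // mul0r.
Qed.

Lemma is_derive_sqnorm d (X : 'rV[R]_d) (j : 'I_d) :
  is_derive X (delta_mx ord0 j) (@sqnorm R d) (2 * X ord0 j).
Proof.
have H := is_derive_sum (fun k => is_derive_mul (is_derive_coord k j X) (is_derive_coord k j X)).
apply: (is_derive_eq H); rewrite (bigD1 j) //= eqxx big1 ?addr0.
  by rewrite mul1r mulr1 mulr_natl mulr2n.
by move=> k /negbTE ->; rewrite mul0r mulr0 addr0.
Qed.

Lemma sqr_enorm_le d (X : 'rV[R]_d) (r : R) : 0 <= r -> (enorm X <= r) = (sqnorm X <= r ^+ 2).
Proof. by move=> r0; rewrite /sqnorm -enorm_sqr ler_pXn2r // nnegrE ?enorm_ge0. Qed.

Lemma sqr_enorm_ge d (X : 'rV[R]_d) (r : R) : 0 <= r -> (r <= enorm X) = (r ^+ 2 <= sqnorm X).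
Proof. by move=> r0; rewrite /sqnorm -enorm_sqr ler_pXn2r // nnegrE ?enorm_ge0. Qed.

Lemma norm_le_enorm d (X : 'rV[R]_d) : `|X| <= enorm X.
Proof.
by rewrite -(ler_pXn2r (n := 2)) ?nnegrE ?enorm_ge0 // enorm_sqr; exact: sqnorm_ge.
Qed.

(** Here y is the derivative of the profile, x is |X|^2, and y (2 / r^2) X is the gradient of the
    cutoff; |X| <= 2r gives the 16. *)
Lemma cutoff_gradient_bound (y x r c : R) : 0 < r -> 0 <= x -> x <= 2 ^+ 2 * r ^+ 2 ->
  y ^+ 2 <= c ^+ 2 -> y * (2 / r ^+ 2) * (y * (2 / r ^+ 2) * x) * r ^+ 2 <= 16 * c ^+ 2 + 1.
Proof.
move=> r0 xp H D; have r2 : 0 < r ^+ 2 by rewrite exprn_gt0.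
have -> : y * (2 / r ^+ 2) * (y * (2 / r ^+ 2) * x) * r ^+ 2 = 4 * (y ^+ 2) * (x / r ^+ 2).
  by field; rewrite gt_eqF.
have x4 : x / r ^+ 2 <= 4.
  by rewrite ler_pdivrMr // (le_trans H) // (_ : 2 ^+ 2 = 4 :> R) // -natrX.
have x0 : 0 <= x / r ^+ 2 by rewrite divr_ge0 // ltW.
have := sqr_ge0 y; have := sqr_ge0 c; nra.
Qed.

Lemma cutoff_exists d : exists (th : R -> 'rV[R]_d -> R) (c : R), 0 < c /\
  forall r : R, 0 < r -> [/\ C1 (th r), bsupp (th r), forall X, 0 <= th r X <= 1,
    (forall X, enorm X <= r -> th r X = 1) /\ (forall X, 2 * r <= enorm X -> th r X = 0) &
    forall X, dotv (grad (th r) X) (grad (th r) X) <= c / r ^+ 2 /\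
      (enorm X <= r \/ 2 * r <= enorm X -> grad (th r) X = 0)].
Proof.
have [tau [dtau [c [c0 [dt cdt dtc t01 [t1 t0 dt0]]]]]] := cutoff_profile.
(* The square of the Euclidean norm is smooth. The + 1 makes the constant positive, since only c >=
   0 is known. *)
exists (fun r X => tau (r ^- 2 * sqnorm X)), (16 * c ^+ 2 + 1); split.
  by rewrite ltr_wpDl // mulr_ge0 // sqr_ge0.
move=> r r0; have r2 : 0 < r ^+ 2 by rewrite exprn_gt0.
have Cs : C1 (fun X : 'rV[R]_d => r ^- 2 * sqnorm X).
  by apply: C1M; [exact: C1_cst|exact: smooth_C1 (smooth_sqnorm d)].
have Cth : C1 (fun X : 'rV[R]_d => tau (r ^- 2 * sqnorm X)) by exact: C1_comp1 Cs dt cdt.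
have s1 (X : 'rV[R]_d) : enorm X <= r -> r ^- 2 * sqnorm X <= 1.
  by rewrite sqr_enorm_le ?(ltW r0) // ler_pdivrMl // mulr1.
have s4 (X : 'rV[R]_d) : 2 * r <= enorm X -> 4 <= r ^- 2 * sqnorm X.
  rewrite sqr_enorm_ge ?mulr_ge0 ?(ltW r0) // ler_pdivlMl // exprMn.
  by rewrite (_ : 2 ^+ 2 = 4 :> R) 1?mulrC // -natrX.
have gE (X : 'rV[R]_d) : grad (fun X : 'rV[R]_d => tau (r ^- 2 * sqnorm X)) X =
    (dtau (r ^- 2 * sqnorm X) * (2 * r ^- 2)) *: X.
  apply/rowP => j; rewrite !mxE; apply: is_derive_partial.
  have H := is_derive_mul (is_derive_cst (r ^- 2 : R) X (delta_mx ord0 j)) (is_derive_sqnorm X j).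
  apply: (is_derive_eq (is_derive_comp1 H (dt _))).
  by rewrite /cst /=; ring.
split => //.
- exists (2 * r) => X Xr; apply: t0; apply: s4.
  by apply: ltW; apply: (lt_le_trans Xr); exact: norm_le_enorm.
- by split=> X H; [apply: t1; exact: s1|apply: t0; exact: s4].
move=> X; rewrite gE; split; last first.
  by move=> H; rewrite dt0 ?mul0r ?scale0r //; case: H => [/s1|/s4]; [left|right].
rewrite dotvZl dotvZr.
have [H|/ltW H] := leP (2 * r) (enorm X).
  by rewrite dt0 ?mul0r ?divr_ge0 ?(ltW r2) ?addr_ge0 ?mulr_ge0 ?sqr_ge0 //; right; exact: s4.
move: H; rewrite sqr_enorm_le ?mulr_ge0 ?(ltW r0) // exprMn /sqnorm => H.
have D : dtau (r ^- 2 * dotv X X) ^+ 2 <= c ^+ 2.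
  by rewrite -[leLHS]real_normK ?num_real // ler_pXn2r ?nnegrE.
rewrite ler_pdivlMr //.
have : 0 <= dotv X X by exact: dotv_ge0.
move: D H; move: (dtau (r ^- 2 * dotv X X)) (dotv X X) => y x D H xp.
exact: (cutoff_gradient_bound r0).
Qed.

Lemma quad0l d (M : 'M[R]_d) v : quad M 0 v = 0.
Proof. by rewrite /quad mul0mx; apply: big1 => j _; rewrite mxE mul0r. Qed.

Lemma quad0r d (M : 'M[R]_d) v : quad M v 0 = 0.
Proof. by apply: big1 => j _; rewrite [X in _ * X]mxE mulr0. Qed.

Section abstract_liouville.
Variables (d n : nat) (M : 'I_n -> 'rV[R]_d -> 'M[R]_d) (z : 'I_n -> 'rV[R]_d -> 'rV[R]_d)
  (w : 'I_n -> 'rV[R]_d -> R) (C R0 : R).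

Let Q i X (v1 v2 : 'rV[R]_d) := quad (M i X) v1 v2.

(** The growth hypothesis with the eigenvalue replaced by an arbitrary vector field t supported in
    the ball; it is applied to t = grad theta. *)
Definition growth_bound : Prop := forall i (r k : R) (t : 'rV[R]_d -> 'rV[R]_d), R0 <= r -> 0 < k ->
  (forall j, continuous (fun X => t X ord0 j)) -> (forall X, dotv (t X) (t X) <= k) ->
  (forall X, ~ eball d r X -> t X = 0) ->
  LI (fun X => w i X ^+ 2 * quad (M i X) (t X) (t X)) <= k * (C * r ^+ 2).

Definition energy_le0 : Prop := forall theta : 'rV[R]_d -> R, C1 theta -> bsupp theta ->
  LI (fun X => \sum_i (quad (M i X) (z i X) (z i X) * theta X ^+ 2 +
     2 * (w i X * theta X) * quad (M i X) (z i X) (grad theta X))) <= 0.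

(** Young's inequality for theta z and w t. The value of theta^2 matters only where t != 0, so any
    phi dominating it there may replace it. The choice phi = theta^2 yields boundedness of J, a
    difference of two cutoffs yields the recursive bound. *)
Lemma caccioppoli_pointwise i X (th : R) (t : 'rV[R]_d) (del phi : R) :
  (M i X)^T = M i X -> posdefmx (M i X) -> 0 < del -> 0 <= phi ->
  (t != 0 -> th ^+ 2 <= phi) ->
  - (2 * (w i X * th) * Q i X (z i X) t) <=
    del^-1 * (Q i X (z i X) (z i X) * phi) + del * (w i X ^+ 2 * Q i X t t).
Proof.
move=> Ms Mp d0 phi0 tphi.
have Q0 v : 0 <= Q i X v v.
  have [->|v0] := eqVneq v 0; last by rewrite ltW // Mp.
  by rewrite /Q quad0l.
have di : 0 < del^-1 by rewrite invr_gt0.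
have [t0|t0] := eqVneq t 0.
  rewrite {1}t0 /Q quad0r mulr0 oppr0.
  apply: addr_ge0; first by rewrite mulr_ge0 ?(ltW di) // mulr_ge0 //; exact: Q0.
  by rewrite mulr_ge0 ?(ltW d0) // mulr_ge0 ?sqr_ge0 //; exact: Q0.
have := quad_young (th *: z i X) (w i X *: t) Ms Q0 d0.
rewrite !(quadZl, quadZr) => H.
have H1 : del^-1 * (th * (th * Q i X (z i X) (z i X))) <= del^-1 * (Q i X (z i X) (z i X) * phi).
  rewrite ler_pM2l // mulrA mulrC; apply: ler_wpM2l; first exact: Q0.
  exact: tphi.
rewrite /Q in H1 *; move: H H1.
set a := quad _ (z i X) t; set b := quad _ t t; set e := quad _ (z i X) (z i X).
set x := w i X; set y := del^-1 * (e * phi); set y' := del^-1 * _.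
move=> H H1; apply: (@le_trans _ _ (y' + del * (x * (x * b)))).
  by apply: le_trans H; rewrite le_eqVlt; apply/orP; left; apply/eqP; ring.
by apply: lerD => //; rewrite expr2 -mulrA.
Qed.

Hypotheses (Ms : forall i X, (M i X)^T = M i X) (Mp : forall i, Lae (fun X => posdefmx (M i X)))
  (ML : forall i j l, Lloc (fun X => M i X j l))
  (cz : forall i j, continuous (fun X => z i X ord0 j)) (cw : forall i, continuous (w i))
  (C0 : 0 <= C) (R0_gt0 : 0 < R0) (gb : growth_bound) (el : energy_le0).

Let E X := \sum_i Q i X (z i X) (z i X).

Let LE : Lloc E.
Proof. by apply: Lloc_sum => i; exact: Lloc_quad. Qed.

Let aeM : Lae (fun X => forall i, posdefmx (M i X)).
Proof. exact: Lae_forall. Qed.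

Let Q_ge0 i X v : posdefmx (M i X) -> 0 <= Q i X v v.
Proof.
move=> H; have [->|v0] := eqVneq v 0; last by rewrite ltW // H.
by rewrite /Q quad0l.
Qed.

Let E_ge0 X : (forall i, posdefmx (M i X)) -> 0 <= E X.
Proof. by move=> H; apply: sumr_ge0 => i _; exact: Q_ge0. Qed.

Lemma caccioppoli (theta phi : 'rV[R]_d -> R) (r k del : R) : C1 theta -> bsupp theta ->
  continuous phi -> bsupp phi -> R0 <= r -> 0 < k -> 0 < del ->
  (forall X, dotv (grad theta X) (grad theta X) <= k) ->
  (forall X, ~ eball d r X -> grad theta X = 0) ->
  (forall X, 0 <= phi X) -> (forall X, grad theta X != 0 -> theta X ^+ 2 <= phi X) ->
  LI (fun X => E X * theta X ^+ 2) <=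
    del^-1 * LI (fun X => E X * phi X) + del * (n%:R * (k * (C * r ^+ 2))).
Proof.
move=> Ct bt cphi bphi rR k0 d0 tk t0 phi0 tphi; have [rt tr] := bt.
have cg j : continuous (fun X => grad theta X ord0 j).
  rewrite (_ : (fun X => _) = partial j theta); first exact: (Ct.2 j).2.
  by apply/funext => X; rewrite mxE.
have bg (f : 'rV[R]_d -> 'rV[R]_d -> R) : (forall X, f X 0 = 0) -> bsupp (fun X => f X (grad theta X)).
  move=> f0; exists rt => X Xr; rewrite (_ : grad theta X = 0) //.
  by apply/rowP => j; rewrite !mxE (bsupp_partial j tr Xr).
have Lb (f : 'rV[R]_d -> R) : Lloc f -> bsupp f -> Li f.
  move=> fl [rf fr]; have := fl (plateau rf) (@continuous_plateau _ _ _).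
  rewrite (_ : (fun X => _) = f); first by apply; exists (rf + 1) => X; exact: plateau0.
  apply/funext => X; have [Xr|Xr] := leP `|X| rf; first by rewrite plateau1 // mulr1.
  by rewrite fr // mul0r.
have ct2 : continuous (fun X => theta X ^+ 2) by apply: contM; exact: Ct.1.
have bt2 : bsupp (fun X => theta X ^+ 2) by exists rt => X /tr ->; rewrite expr0n.
have i1 : Li (fun X => E X * theta X ^+ 2) by exact: LE.
have i2 : Li (fun X => E X * phi X) by exact: LE.
have Q0 i X v : Q i X v 0 = 0 by exact: quad0r.
have Lt i : Li (fun X => w i X ^+ 2 * Q i X (grad theta X) (grad theta X)).
  apply: Lb; last by apply: (bg (fun X v => w i X ^+ 2 * Q i X v v)) => X; rewrite Q0 mulr0.
  rewrite (_ : (fun X => _) = fun X => Q i X (grad theta X) (grad theta X) * w i X ^+ 2).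
    by apply: Lloc_M; [exact: Lloc_quad|apply: contM].
  by apply/funext => X; rewrite mulrC.
have i3 : Li (fun X => \sum_i w i X ^+ 2 * Q i X (grad theta X) (grad theta X)) by exact: Li_sum.
have Lc i : Li (fun X => 2 * (w i X * theta X) * Q i X (z i X) (grad theta X)).
  apply: Lb; last by apply: (bg (fun X v => 2 * (w i X * theta X) * Q i X (z i X) v)) => X; rewrite Q0 mulr0.
  rewrite (_ : (fun X => _) = fun X => Q i X (z i X) (grad theta X) * (2 * (w i X * theta X))).
    apply: Lloc_M; first exact: Lloc_quad.
    by apply: contM; [exact: cont_cst|apply: contM => //; exact: Ct.1].
  by apply/funext => X; rewrite mulrC.
have i4 : Li (fun X => \sum_i 2 * (w i X * theta X) * Q i X (z i X) (grad theta X)) by exact: Li_sum.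
have e1 : LI (fun X => E X * theta X ^+ 2) +
    LI (fun X => \sum_i 2 * (w i X * theta X) * Q i X (z i X) (grad theta X)) <= 0.
  rewrite -(LID i1 i4); have := el Ct bt; congr (LI _ <= 0); apply/funext => X.
  by rewrite /E mulr_suml -big_split.
have e2 : LI (fun X => \sum_i w i X ^+ 2 * Q i X (grad theta X) (grad theta X)) <=
    n%:R * (k * (C * r ^+ 2)).
  rewrite (LI_sum Lt) mulr_natl -[X in _ *+ X]card_ord -sumr_const; apply: ler_sum => i _.
  exact: gb.
have e3 : - LI (fun X => \sum_i 2 * (w i X * theta X) * Q i X (z i X) (grad theta X)) <=
   LI (fun X => del^-1 * (E X * phi X) +
     del * (\sum_i w i X ^+ 2 * Q i X (grad theta X) (grad theta X))).
  rewrite -[leLHS]mulN1r -(LIZ _ i4); apply: LI_le; first exact: LiZ.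
    by apply: LiD; exact: LiZ.
  apply: LaeS aeM => X Xp; rewrite /E mulN1r -sumrN mulr_suml !mulr_sumr -big_split /=.
  apply: ler_sum => i _; apply: caccioppoli_pointwise => //; exact: tphi.
have i5 := LiZ del^-1 i2; have i6 := LiZ del i3.
rewrite (LID i5 i6) (LIZ del^-1 i2) (LIZ del i3) in e3.
have : del * LI (fun X => \sum_i w i X ^+ 2 * Q i X (grad theta X) (grad theta X)) <=
  del * (n%:R * (k * (C * r ^+ 2))) by rewrite ler_pM2l.
lra.
Qed.

Lemma liouville i X : z i X = 0.
Proof.
have [th [c [c0 thP]]] := cutoff_exists d.
pose J r := LI (fun X => E X * th r X ^+ 2).
(* n components, |grad theta_r|^2 <= c / r^2, and growth C (2r)^2 on the ball carrying the gradient: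
   the powers of r cancel. *)
pose K := n%:R * (c * (C * 4)).
have K0 : 0 <= K by rewrite !mulr_ge0 // ltW.
have bound r : R0 <= r -> 0 < r /\ n%:R * (c / r ^+ 2 * (C * (2 * r) ^+ 2)) = K.
  move=> rR; have r0 : 0 < r by exact: lt_le_trans rR.
  split => //; rewrite /K; field; exact: lt0r_neq0.
have sqi r : 0 < r -> Li (fun X => E X * th r X ^+ 2).
  move=> r0; have [Ct [rt tr] _ _ _] := thP r r0; apply: LE.
    by apply: contM; exact: Ct.1.
  by exists rt => Y /tr ->; rewrite expr0n.
have mono r s : 0 < r -> 2 * r <= s -> forall Y, th r Y ^+ 2 <= th s Y ^+ 2.
  move=> r0 rs Y; have s0 : 0 < s by apply: lt_le_trans rs; rewrite mulr_gt0.
  have [_ _ t01 [_ t0] _] := thP r r0; have [_ _ s01 [s1 _] _] := thP s s0.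
  have [H|H] := leP (2 * r) (enorm Y); first by rewrite t0 // expr0n sqr_ge0.
  rewrite (s1 Y) ?expr1n; last exact: le_trans (ltW H) rs.
  by have /andP[h0 h1] := t01 Y; rewrite expr_le1.
have main r del phi : R0 <= r -> 0 < del -> continuous phi -> bsupp phi -> (forall X, 0 <= phi X) ->
    (forall X, r < enorm X -> enorm X < 2 * r -> th r X ^+ 2 <= phi X) ->
    J r <= del^-1 * LI (fun X => E X * phi X) + del * K.
  move=> rR d0 cp bp p0 tp; have [r0 <-] := bound r rR.
  have [Ct bt t01 [t1 t0] g] := thP r r0.
  have ck : 0 < c / r ^+ 2 by rewrite divr_gt0 // exprn_gt0.
  have rR' : R0 <= 2 * r by apply: (le_trans rR); rewrite ler_peMl ?ler1n // ltW.
  apply: caccioppoli => //.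
  - by move=> Y; exact: (g Y).1.
  - by move=> Y /negP; rewrite /eball /= -leNgt => H; apply: (g Y).2; right.
  - move=> Y gY; apply: tp; rewrite ltNge; apply/negP => H; move/eqP: gY; apply.
      by apply: (g Y).2; left.
    by apply: (g Y).2; right.
have csq r : 0 < r -> continuous (fun X => th r X ^+ 2) /\ bsupp (fun X => th r X ^+ 2).
  move=> r0; have [Ct [rt tr] _ _ _] := thP r r0; split; first by apply: contM; exact: Ct.1.
  by exists rt => Y /tr ->; rewrite expr0n.
have J4 r : R0 <= r -> J r <= 4 * K.
  move=> rR; have [r0 _] := bound r rR; have [cs bs] := csq r r0.
  (* With phi = theta_r^2 and del = 2 the inequality reads J <= J / 2 + 2 K. *)
  have := main r 2 (fun X => th r X ^+ 2) rR _ cs bs (fun X => sqr_ge0 _) (fun X _ _ => lexx _).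
  rewrite -/(J r) ltr0n => /(_ isT) H; lra.
pose Js j := J (2 ^+ j * R0).
have rj j : R0 <= 2 ^+ j * R0 by rewrite ler_peMl ?(ltW R0_gt0) // exprn_ege1 // ler1n.
have rp j : 0 < 2 ^+ j * R0 by rewrite mulr_gt0 // exprn_gt0.
have Jz : forall j, Js j = 0.
  apply: (@bounded_telescoping_eq0 Js (4 * K)).
  - move=> j; apply: LI_ge0; first exact: sqi.
    by apply: LaeS aeM => Y Yp; rewrite mulr_ge0 ?sqr_ge0 // E_ge0.
  - move=> j; apply: LI_le; [exact: sqi|exact: sqi|].
    apply: LaeS aeM => Y Yp; apply: ler_wpM2l; first exact: E_ge0.
    by apply: mono => //; rewrite exprS mulrA.
  - by move=> j; exact: J4.
  move=> del j d0; have [c1 b1] := csq _ (rp j); have [c2 b2] := csq _ (rp j.+2).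
  have r1 : 2 * (2 ^+ j * R0) = 2 ^+ j.+1 * R0 by rewrite exprS mulrA.
  have r2 : 2 * (2 ^+ j.+1 * R0) = 2 ^+ j.+2 * R0 by rewrite (exprS _ j.+1) mulrA.
  have le02 Y : th (2 ^+ j * R0) Y ^+ 2 <= th (2 ^+ j.+2 * R0) Y ^+ 2.
    by apply: mono => //; rewrite r1 (exprS _ j.+1) -mulrA ler_peMl ?ler1n // ltW.
  (* On the annulus between 2^(j+1) R0 and 2^(j+2) R0 the larger cutoff is 1 and the smaller one 0,
     so their difference of squares dominates theta^2 there. *)
  have := main (2 ^+ j.+1 * R0) del (fun Y => th (2 ^+ j.+2 * R0) Y ^+ 2 - th (2 ^+ j * R0) Y ^+ 2)
    (rj _) d0 (contB c2 c1) _ _ _.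
  rewrite -/(Js j.+1) (_ : (fun Y => E Y * _) = fun Y => E Y * th (2 ^+ j.+2 * R0) Y ^+ 2 -
    E Y * th (2 ^+ j * R0) Y ^+ 2); last by apply/funext => Y; rewrite mulrBr.
  rewrite (LIB (sqi _ (rp j.+2)) (sqi _ (rp j))) -/(J _) -/(J _) -/(Js j) -/(Js j.+2) => H.
  apply: (@le_trans _ _ (del^-1 * (Js j.+2 - Js j) + del * K)); last first.
    by rewrite lerD2l ler_pM2l //; lra.
  apply: H.
  - move: b1 b2 => [r3 h3] [r4 h4]; exists (Num.max r3 r4) => Y.
    by rewrite gt_max => /andP[/h3 -> /h4 ->]; rewrite subrr.
  - by move=> Y; rewrite subr_ge0.
  move=> Y Y1 Y2; have [_ _ _ [s1 _] _] := thP _ (rp j.+2).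
  have [_ _ _ [_ s0] _] := thP _ (rp j); have [_ _ t01 _ _] := thP _ (rp j.+1).
  rewrite s1 ?s0 ?expr0n ?subr0 ?expr1n; [|by rewrite r1 ltW|by rewrite -r2 ltW].
  by have /andP[h0 h1] := t01 Y; rewrite expr_le1.
have aeE : Lae (fun X => forall j, E X * th (2 ^+ j * R0) X ^+ 2 = 0).
  apply: Lae_countable => j; apply: LI_eq0; [exact: sqi| |exact: Jz].
  by apply: LaeS aeM => Y Yp; rewrite mulr_ge0 ?sqr_ge0 // E_ge0.
have aez : Lae (fun X => z i X = 0).
  apply: LaeS2 aeM aeE => Y Yp YE.
  have EY : E Y = 0.
    (* The balls of radius 2^j R0 exhaust the space, since j < 2^j. *)
    pose j := (Num.bound (enorm Y / R0)).
    have := YE j; have [_ _ _ [t1 _] _] := thP _ (rp j); rewrite t1 ?expr1n ?mulr1 //.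
    rewrite -ler_pdivrMr //; apply: (@le_trans _ _ j%:R).
      by apply: ltW; apply: archi_boundP; rewrite divr_ge0 ?enorm_ge0 // ltW.
    by rewrite -natrX ler_nat ltnW // ltn_expl.
  have /eqP := EY; rewrite psumr_eq0; last by move=> k _; exact: Q_ge0.
  move=> /allP /(_ i); rewrite mem_index_enum => /(_ isT) /= /eqP Qi.
  by apply/eqP/negPn/negP => /(Yp i); rewrite -/(quad _ _ _) -/(Q i Y _ _) Qi ltxx.
apply/rowP => j; rewrite [RHS]mxE.
apply: (@ae_eq0_continuous _ _ (fun X => z i X ord0 j)); first exact: cz.
by apply: LaeS aez => Y ->; rewrite mxE.
Qed.

End abstract_liouville.

End liouville.

(** * One-dimensional symmetry *)

Section conclusion.
Context {R : realType}.
Variables m p n : nat.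
Notation N := (m + p.+1)%N.
Variables (a : 'I_n -> 'rV[R]_m -> R -> R) (F : 'rV[R]_m -> 'rV[R]_n -> R)
  (u : 'I_n -> 'rV[R]_N -> R).

Lemma coord_le_enorm d (v : 'rV[R]_d) (j : 'I_d) : v ord0 j ^+ 2 <= enorm v ^+ 2.
Proof.
rewrite enorm_sqr /dotv (bigD1 j) //= -expr2 lerDl.
by apply: sumr_ge0 => l _; rewrite -expr2 sqr_ge0.
Qed.

Lemma C1_constant d (f : 'rV[R]_d -> R) : C1 f -> (forall j X, partial j f X = 0) ->
  forall X Y, f X = f Y.
Proof.
move=> Cf f0 X Y; have [c [_]] := @telescope_MVT R d f Y (X - Y) (fun k _ => (Cf.2 k).1).
rewrite big1 => [|k _]; last by rewrite f0 mulr0.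
by rewrite [Y + _]addrC subrK => /eqP; rewrite subr_eq0 => /eqP.
Qed.

Lemma C1_constant_along d (f : 'rV[R]_d -> R) (X H : 'rV[R]_d) : C1 f ->
  (forall Y, \sum_j H ord0 j * partial j f Y = 0) -> f (X + H) = f X.
Proof.
move=> Cf H0.
have D (s : R) : is_derive s 1 (fun s : R => f (X + s *: H)) 0.
  have Dc j : is_derive s 1 (fun s : R => (X + s *: H) ord0 j) (H ord0 j).
    rewrite (_ : (fun s : R => _) = (fun s : R => X ord0 j + s * H ord0 j)); last first.
      by apply/funext => t; rewrite !mxE.
    have D1 := is_deriveD (is_derive_cst (X ord0 j) s (1 : R))
      (is_deriveM (is_derive_id s (1 : R)) (is_derive_cst (H ord0 j) s (1 : R))).
    apply: (is_derive_eq D1); rewrite scaler0 add0r add0r [_ *: _]mulr1 //.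
  have := @chain_rule R _ d (fun s : R => X + s *: H) f s 1 Cf.
  under eq_bigr do rewrite (derive_val (is_derive := Dc _)).
  rewrite H0; apply => j; exact: (ex_derive (is_derive := Dc j)).
have [t _] := @line_MVT R _ (fun s : R => f (X + s *: H)) 0 1 1 (fun t => ex_derive (is_derive := D _)).
rewrite (derive_val (is_derive := D _)) mulr0 !scale1r add0r scale1r scale0r addr0.
by move/eqP; rewrite subr_eq0 => /eqP.
Qed.

Lemma weak_solution_div : weak_solution a F u ->
  forall i, weak_div (flux (a i) (u i)) (reaction F u i).
Proof.
move=> W i psi tpsi; have [H1 H2 H3] := W (fun=> psi) (fun=> tpsi) i.
have E : (fun X => \sum_l flux (a i) (u i) l X * partial l psi X) =
    fun X => dotv (a i (lsubmx X) (enorm (grad (u i) X)) *: grad (u i) X) (grad psi X).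
  by apply/funext => X; apply: eq_bigr => l _; rewrite !mxE.
by rewrite E; split.
Qed.

Lemma monotone_systemP : (forall i, admissible_coefficient (a i)) ->
  admissible_nonlinearity F -> weak_solution a F u -> F_monotone F u ->
  (forall i, regular (u i)) -> (forall i, condition_B (a i) (u i)) -> monotone_system a F u.
Proof.
move=> adm [F1C F2C] W [mono1 mono2] reg B.
have sF x : sepC2 (F x) by split=> [i xi|i j ij]; [exact: F1C|exact: F2C].
split => //.
- by move=> i; apply: nondegenerateP => //; exact: mono1.
- exact: weak_solution_div.
move=> i j X; case: (ltngtP i j) => [ij|ji|/val_inj ->].
- rewrite (mixedC _ _ _ (sF _)) /mixed (_ : (i == j) = false); first exact: mono2.
  by apply/eqP => E; move: ij; rewrite E ltnn.
- rewrite mulrAC /mixed (_ : (j == i) = false); first exact: mono2.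
  by apply/eqP => E; move: ji; rewrite E ltnn.
- by rewrite /mixed eqxx !mul0r.
Qed.

Hypotheses (ms : monotone_system a F u)
  (pd : forall i, Lae (fun X => posdefmx (Agrad (a i) (u i) X))).

Lemma quad_cutoff_le i X (t : 'rV[R]_N) (k : R) (l : 'I_p.+1) : posdefmx (Agrad (a i) (u i) X) ->
  dotv t t <= k -> 0 <= k ->
  dy l (u i) X ^+ 2 * quad (Agrad (a i) (u i) X) t t <=
   k * (max_eigenvalue (Agrad (a i) (u i) X) * enorm (grad (u i) X) ^+ 2).
Proof.
move=> pX tk k0; have [_ nu _ _] := ms; have [u0 _ _ _ _] := nu i.
set M := Agrad _ _ _ in pX *; set e := max_eigenvalue M.
have g0 := grad_neq0 (u0 X).
have qle v : quad M v v <= e * dotv v v by apply: quad_le_max_eigenvalue; exact: Agrad_sym.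
(* The form is positive at the nonzero gradient, which forces the largest eigenvalue to be
   positive. *)
have e0 : 0 <= e.
  have := lt_le_trans (pX _ g0) (qle _); rewrite pmulr_lgt0 ?dotv_gt0 //; exact: ltW.
have w2 : dy l (u i) X ^+ 2 <= enorm (grad (u i) X) ^+ 2.
  by have := coord_le_enorm (grad (u i) X) (rshift m l); rewrite mxE.
apply: (@le_trans _ _ (dy l (u i) X ^+ 2 * (e * k))).
  by apply: ler_wpM2l; [exact: sqr_ge0|apply: (le_trans (qle t)); exact: ler_wpM2l].
rewrite mulrA [k * _]mulrC; apply: ler_wpM2r => //.
by rewrite [e * _]mulrC; exact: ler_wpM2r.
Qed.

Lemma Agrad_Lloc i j l : Lloc (fun X => Agrad (a i) (u i) X j l).
Proof.
have [_ nu _ _] := ms; have [_ _ _ _ /(_ j l) [mA bA]] := nu i; exact: Lloc_bounded.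
Qed.

Variables (C R0 : R).
Hypotheses (R0_gt0 : 0 < R0) (C_ge0 : 0 <= C).
Hypothesis growth : forall i r, R0 <= r ->
  (\int[lebesgue_rV R N]_(X in eball N r)
     (max_eigenvalue (Agrad (a i) (u i) X) * enorm (grad (u i) X) ^+ 2)%:E <= (C * r ^+ 2)%:E)%E.

Let C1u i : C1 (u i). Proof. by have [_ nu _ _] := ms; have [] := nu i. Qed.
Let C2u i j : C1 (partial j (u i)). Proof. by have [_ nu _ _] := ms; have [] := nu i. Qed.
Let u0 i X : dlast (u i) X != 0.
Proof. by have [_ nu _ _] := ms; have [H _ _ _ _] := nu i; exact: H. Qed.

(** Dividing by k bounds the left side pointwise by the integrand of [growth]; outside the ball it
    vanishes with t, as [LI_le_integral] requires. *)
Lemma cutoff_growth l : growth_bound (fun i => Agrad (a i) (u i)) (fun i => dy l (u i)) C R0.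
Proof.
move=> i r k t rR k0 ct tk t0.
have Lh : Li (fun X => dy l (u i) X ^+ 2 * quad (Agrad (a i) (u i) X) (t X) (t X)).
  have LQ : Lloc (fun X => quad (Agrad (a i) (u i) X) (t X) (t X)).
    by apply: Lloc_quad => // j j'; exact: Agrad_Lloc.
  (* t vanishes wherever |X| > r, since the Euclidean norm is the larger one. The plateau therefore
     changes nothing and supplies the bounded support. *)
  have cw : continuous (fun X => dy l (u i) X ^+ 2 * plateau r X).
    apply: contM; last exact: continuous_plateau.
    by apply: contM; exact: (C2u i _).1.
  have := LQ _ cw; rewrite (_ : (fun X => _) =
    fun X => dy l (u i) X ^+ 2 * quad (Agrad (a i) (u i) X) (t X) (t X)).
    by apply; exists (r + 1) => X Xr; rewrite plateau0 // mulr0.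
  apply/funext => X; have [Xr|Xr] := leP `|X| r; first by rewrite plateau1 // mulr1 mulrC.
  rewrite t0 ?quad0r ?mulr0 ?mul0r // => /= Xb.
  by have := le_lt_trans (norm_le_enorm X) Xb; rewrite ltNge ltW.
have Lk := LiZ k^-1 Lh.
rewrite mulrC -ler_pdivrMr // mulrC -(LIZ _ Lh).
apply: (LI_le_integral Lk _ _ (growth i rR)).
  apply: LaeS (pd i) => X pX; apply: mulr_ge0; first by rewrite invr_ge0 ltW.
  apply: mulr_ge0; first exact: sqr_ge0.
  by have [->|tX] := eqVneq (t X) 0; [rewrite quad0r|rewrite ltW // pX].
apply: LaeS (pd i) => X pX; split => [_|Xr]; last by rewrite t0 // quad0r !mulr0.
by rewrite ler_pdivrMl //; apply: quad_cutoff_le => //; exact: ltW.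
Qed.

Lemma twistE l (v : 'rV[R]_N -> R) X j : twist l v X ord0 j =
  partial j (dy l v) X + - ratio l v X * partial j (dlast v) X.
Proof. by rewrite !mxE. Qed.

Lemma twist_eq0 l i X : twist l (u i) X = 0.
Proof.
apply: (@liouville _ _ _ (fun i => Agrad (a i) (u i)) (fun i => twist l (u i))
  (fun i => dy l (u i)) C R0) => //.
- by move=> i' X'; exact: Agrad_sym.
- exact: Agrad_Lloc.
- move=> i' j; rewrite (_ : (fun X => _) = fun X => partial j (dy l (u i')) X +
     -1 * (dy l (u i') X * (dlast (u i') X)^-1 * partial j (dlast (u i')) X)).
    apply: contD; first exact: ((C2u i' _).2 j).2.
    apply: contM; first exact: cont_cst.
    apply: contM; last exact: ((C2u i' _).2 j).2.
    by apply: contM; [exact: (C2u i' _).1|apply: contV; [exact: (C2u i' _).1|exact: u0]].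
  by apply/funext => Y; rewrite twistE mulN1r mulNr.
- by move=> i'; exact: (C2u i' _).1.
- exact: cutoff_growth.
by move=> theta Ct bt; have [_ H _] := global_identity l ms Ct bt.
Qed.

Lemma ratio_constant l i X Y : ratio l (u i) X = ratio l (u i) Y.
Proof.
have Cr : C1 (ratio l (u i)) by apply: C1M; [exact: C2u|apply: C1V; [exact: C2u|exact: u0]].
apply: C1_constant => // j Z.
have H := is_derive_mul (C1_is_derive Z j (C2u i (rshift m l)))
  (is_derive_inv (u0 i Z) (C1_is_derive Z j (C2u i (y_last m p)))).
rewrite (is_derive_partial H).
have := congr1 (fun v : 'rV[R]_N => v ord0 j) (twist_eq0 l i Z).
rewrite twistE [RHS]mxE /ratio => E.
have -> : partial j (partial (rshift m l) (u i)) Z =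
    dy l (u i) Z / dlast (u i) Z * partial j (dlast (u i)) Z.
  by apply/eqP; rewrite -subr_eq0 -mulNr E.
rewrite /dy /dlast; field; exact: u0.
Qed.

(** All twists being zero, the energy vanishes and the equality case of [global_identity] applies.
    It reaches only points x arbitrarily close to x0, as F may be discontinuous in x. *)
Lemma coupling_vanishes l (x0 : 'rV[R]_m) (y : 'rV[R]_p.+1) (r : R) : 0 < r ->
  exists2 x, `|x - x0| < r & coupling_at l F u (row_mx x y) = 0.
Proof.
(* The margin 1 keeps (x, y) where the bump is positive while x moves by less than 1. *)
move=> r0; have q0 : 0 <= `|row_mx x0 y| + 1 by rewrite addr_ge0.
have [rho rho0 bp] := bump_locally_pos N q0.
have [tb bb] := (test_functionP _).1 (test_bump N rho0).
have [_ _ H] := global_identity l ms (smooth_C1 tb) bb.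
have E0 : energy a u l (bump rho) = fun=> 0.
  by apply/funext => X; apply: big1 => i _; rewrite twist_eq0 !quad0l mul0r mulr0 addr0.
have r1 : 0 < Num.min r 1 by rewrite lt_min r0 ltr01.
rewrite E0 LI0 in H; have [x] := H erefl x0 _ r1.
rewrite lt_min => /andP[xr x1] Hx; exists x => //.
move/eqP: (Hx y); rewrite mulf_eq0 expf_eq0 /= => /orP[/eqP //|].
rewrite gt_eqF //; apply: bp.
rewrite (_ : row_mx x y = row_mx x0 y + row_mx (x - x0) 0).
  apply: (le_trans (ler_normD _ _)); rewrite lerD2l.
  apply/row_normP => // j; rewrite mxE; case: splitP => j' _.
    by apply: le_trans (row_norm_coord _ _) (ltW x1).
  by rewrite mxE normr0.
by rewrite add_row_mx addr0 addrC subrK.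
Qed.

Lemma vals_near (x0 : 'rV[R]_m) (y : 'rV[R]_p.+1) (e : R) : 0 < e ->
  exists2 r : R, 0 < r & forall x, `|x - x0| < r ->
    `|values u (row_mx x y) - values u (row_mx x0 y)| < e.
Proof.
move=> e0.
have cs i : continuous (fun x : 'rV[R]_m => u i (row_mx x y)).
  move=> x; apply/cont_normP => d d0.
  have /cont_normP /(_ d d0) [del del0 H] := (C1u i).1 (row_mx x y).
  exists del => // z zx; apply: H; apply: le_lt_trans zx; apply/row_normP => // l.
  rewrite !mxE; case: splitP => j _; last by rewrite subrr normr0.
  by have := row_norm_coord (z - x) j; rewrite !mxE.
pose g (xi : 'rV[R]_n) := `|xi - values u (row_mx x0 y)|.
have cg : continuous g.
  move=> xi; apply/cont_normP => d d0; exists d => // zeta /ltW H.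
  apply: le_trans (ler_dist_dist _ _) _; apply: le_trans H.
  by rewrite opprB addrA subrK.
have e2 : 0 < e / 2 by rewrite divr_gt0.
have ch := continuous_vals cs cg.
have /cont_normP /(_ _ e2) [r r0 H] := ch x0.
exists r => // x /H; rewrite /g.
have E z : vals (fun i x => u i (row_mx x y)) z = values u (row_mx z y).
  by apply/rowP => i; rewrite !mxE.
rewrite !E subrr normr0 subr0 normr_id => H1; apply: (le_lt_trans H1).
by rewrite ltr_pdivrMr // ltr_pMr // ltr1n.
Qed.

(** The constant direction of grad_y u^i, scaled so that its last entry is 1. The ratios being
    constant, 0 is an arbitrary base point. *)
Definition slope i : 'rV[R]_p.+1 := \row_l ratio l (u i) 0.

Lemma slope_neq0 i : slope i != 0.
Proof.
apply/negP => /eqP /rowP /(_ ord_max); rewrite !mxE /ratio.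
by rewrite [dy ord_max _]/(dlast _) divff ?(u0 _ _) // => /eqP; rewrite oner_eq0.
Qed.

Lemma dy_slope l i X : dy l (u i) X = slope i ord0 l * dlast (u i) X.
Proof.
rewrite mxE (ratio_constant l i 0 X) /ratio; field; exact: u0.
Qed.

(** X - X' is orthogonal to the gradient of u^i at every point, because the y-gradient is always
    parallel to the slope. *)
Lemma one_dimensional i X X' : lsubmx X = lsubmx X' ->
  dotv (slope i) (rsubmx X) = dotv (slope i) (rsubmx X') -> u i X = u i X'.
Proof.
move=> ex ey; rewrite -[X](subrK X') addrC; apply: C1_constant_along => // Y.
rewrite big_split_ord /= big1 ?add0r => [|j _]; last first.
  by have /rowP /(_ j) := ex; rewrite !mxE => ->; rewrite subrr mul0r.
have E l : (X - X') ord0 (rshift m l) * partial (rshift m l) (u i) Y =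
    slope i ord0 l * (rsubmx X - rsubmx X') ord0 l * dlast (u i) Y.
  rewrite -[partial (rshift m l) (u i) Y]/(dy l (u i) Y) dy_slope.
  rewrite (_ : (rsubmx X - rsubmx X') ord0 l = (X - X') ord0 (rshift m l)); last by rewrite !mxE.
  by rewrite mulrCA mulrA.
under eq_bigr do rewrite E.
rewrite -mulr_suml (_ : \sum_l _ = dotv (slope i) (rsubmx X - rsubmx X')) //.
by rewrite -scaleN1r dotvDr dotvZr ey mulN1r subrr mul0r.
Qed.

(** Move x within U to a point where the coupling vanishes. Each term of that sum of nonnegative
    terms is 0, and F_jk, v_j, v_k are nonzero there, so the ratios for j and k agree. The point
    depends on l, which is harmless since the ratios are constant. *)
Lemma coupled_slopes (U : set ('rV[R]_m * 'rV[R]_n)) X0 (j k : 'I_n) : open U ->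
  U (lsubmx X0, values u X0) -> (forall z, U z -> F2 F j k z.1 z.2 != 0) -> slope j = slope k.
Proof.
move=> oU UX0 F0; have [->//|jk] := eqVneq j k.
have [e /= e0 He] : exists2 e : R, 0 < e & forall x xi, `|x - lsubmx X0| < e ->
    `|xi - values u X0| < e -> U (x, xi).
  have /nbhs_ballP [e e0 He] : nbhs (lsubmx X0, values u X0) U by exact: open_nbhs_nbhs.
  exists e => // x xi xe xie; apply: He; split; split => //= i i'; rewrite -ball_normE /= distrC !ord1.
    by apply: le_lt_trans xe; have := row_norm_coord (x - lsubmx X0) i'; rewrite !mxE.
  by apply: le_lt_trans xie; have := row_norm_coord (xi - values u X0) i'; rewrite !mxE.
have X0E : row_mx (lsubmx X0) (rsubmx X0) = X0 by exact: hsubmxK.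
have [r r0 Hr] := vals_near (lsubmx X0) (rsubmx X0) e0.
rewrite X0E in Hr.
apply/rowP => l; rewrite !mxE.
have re : 0 < Num.min r e by rewrite lt_min r0 e0.
have [x] := coupling_vanishes l (lsubmx X0) (rsubmx X0) re.
rewrite lt_min => /andP[xr xe]; set X := row_mx x _ => cX.
have UX : U (x, values u X) by apply: He => //; exact: Hr.
have [sF _ _ mn] := ms.
rewrite (ratio_constant l j 0 X) (ratio_constant l k 0 X).
pose v i := dlast (u i) X; pose s i := ratio l (u i) X.
have t0 i i' : 0 <= mixed (F (lsubmx X)) i i' (values u X) * v i * v i' * (s i - s i') ^+ 2.
  by apply: mulr_ge0; [exact: mn|exact: sqr_ge0].
move/eqP: cX; rewrite /coupling_at /coupling mulf_eq0 invr_eq0 pnatr_eq0 /=.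
rewrite psumr_eq0; last by move=> i _; apply: sumr_ge0 => i' _; exact: t0.
(* The order (k, j) is the one in which [mixed] unfolds to [F2 F j k]. *)
move=> /allP /(_ k); rewrite mem_index_enum => /(_ isT) /=.
rewrite psumr_eq0; last by move=> i _; exact: t0.
move=> /allP /(_ j); rewrite mem_index_enum => /(_ isT) /=.
rewrite /mixed (negbTE jk) !mulf_eq0 -!orbA.
have := F0 _ UX; rewrite /F2 /F1 /= row_mxKl => /negbTE ->.
rewrite (negbTE (u0 _ _)) (negbTE (u0 _ _)) /= orbb subr_eq0 => /eqP -> //.
Qed.

End conclusion.

Theorem theorem1p6 (R : realType) (m p n : nat) (m_gt0 : (0 < m)%N)
    (a : 'I_n -> 'rV[R]_m -> R -> R)
    (F : 'rV[R]_m -> 'rV[R]_n -> R)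
    (u : 'I_n -> 'rV[R]_(m + p.+1) -> R) :
  (forall i, admissible_coefficient (a i)) ->
  admissible_nonlinearity F ->
  weak_solution a F u ->
  F_monotone F u ->
  (forall i, regular (u i)) ->
  (forall i, condition_B (a i) (u i)) ->
  (forall i, {ae lebesgue_rV R (m + p.+1),
                forall X, posdefmx (Agrad (a i) (u i) X)}) ->
  (exists C : 'I_n -> R,
     (forall i, 1 <= C i) /\
     forall i r, (forall j, C j <= r) ->
       (\int[lebesgue_rV R (m + p.+1)]_(X in eball (m + p.+1) r)
          (max_eigenvalue (Agrad (a i) (u i) X) *
           enorm (grad (u i) X) ^+ 2)%:E <= (C i * r ^+ 2)%:E)%E) ->
  exists (ubar : 'I_n -> 'rV[R]_m -> R -> R) (omega : 'I_n -> 'rV[R]_p.+1),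
    [/\ forall i, enorm (omega i) = 1,
        forall i X, u i X = ubar i (lsubmx X) (dotv (omega i) (rsubmx X)) &
        forall U : set ('rV[R]_m * 'rV[R]_n),
          open U ->
          (exists X, U (lsubmx X, values u X)) ->
          (forall j k, (forall z, U z -> 0 < F2 F j k z.1 z.2) \/
                       (forall z, U z -> F2 F j k z.1 z.2 < 0)) ->
          forall j k, omega j = omega k].
Proof.
move=> adm nl W mono reg B pd [C [C1 HC]].
have ms := monotone_systemP adm nl W mono reg B.
(* The sum dominates every C_i, giving one growth constant and one threshold; the + 1 keeps R0
   positive also when n = 0. *)
pose C' := \sum_i C i; pose R0 := C' + 1.
have CC j : C j <= C'.
  by rewrite /C' (bigD1 j) //= lerDl; apply: sumr_ge0 => i _; exact: le_trans ler01 (C1 i).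
have C'0 : 0 <= C' by apply: sumr_ge0 => i _; exact: le_trans ler01 (C1 i).
have R0p : 0 < R0 by rewrite ltr_wpDl.
have gr i r : R0 <= r ->
    (\int[lebesgue_rV R (m + p.+1)]_(X in eball (m + p.+1) r)
       (max_eigenvalue (Agrad (a i) (u i) X) * enorm (grad (u i) X) ^+ 2)%:E <= (C' * r ^+ 2)%:E)%E.
  move=> rR; apply: (@le_trans _ _ (C i * r ^+ 2)%:E).
    by apply: HC => j; apply: (le_trans (CC j)); apply: le_trans rR; rewrite lerDl.
  by rewrite lee_fin; apply: ler_wpM2r; rewrite ?sqr_ge0.
pose s := slope u.
have s0 i : s i != 0 by exact: (slope_neq0 ms).
pose omega i := (enorm (s i))^-1 *: s i.
have es i : enorm (s i) != 0 by exact: lt0r_neq0 (enorm_gt0 (s0 i)).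
have so i : dotv (omega i) (omega i) = 1.
  by rewrite /omega dotvZl dotvZr -enorm_sqr; field.
(* As omega_i is a unit vector, the point t omega_i has inner product t with it, so (x, y) and (x,
   <omega_i, y> omega_i) lie on the same level set of the slope. *)
exists (fun i x t => u i (row_mx x (t *: omega i))), omega; split.
- by move=> i; rewrite /enorm so sqrtr1.
- move=> i X; apply: (one_dimensional ms pd R0p C'0 gr); first by rewrite row_mxKl.
  rewrite row_mxKr dotvZr.
  have sE v : dotv (s i) v = enorm (s i) * dotv (omega i) v by rewrite dotvZl mulrA divff ?mul1r.
  by rewrite -/(s i) !sE so mulr1 mulrC.
move=> U oU [X0 UX0] sgn j k; rewrite /omega.
suff -> : s j = s k by [].
apply: (coupled_slopes ms pd R0p C'0 gr oU UX0) => z Uz.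
by have [H|H] := sgn j k; [rewrite gt_eqF // H|rewrite lt_eqF // H].
Qed.
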